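(* Let $D$ be a strongly connected digraph with at least two vertices. Then the following statements are equivalent: (i) $\mathrm{dtw}(D)=1$, i.e. $D$ has directed treewidth exactly one; (ii) the cycle hypergraph $\mathcal{C}(D)$ is a hypertree; (iii) $D$ contains neither a bicycle nor $A_4$ as a butterfly minor (that is, no bicycle of any length $\ell\ge 3$ and not the digraph $A_4$).
   Context: All digraphs $D=(V(D),E(D))$ are finite, nonempty and simple: no loops and no parallel edges, but both edges $(u,v)$ and $(v,u)$ may be present (a digon). A directed walk may repeat vertices. A directed cycle has pairwise distinct vertices; a digon is a directed cycle of length $2$. $D$ is strongly connected if for all $u,v\in V(D)$ there is a directed path from $u$ to $v$. Directed treewidth. An arborescence $T$ is an orientation of an undirected tree with a unique vertex $r$ (the root) from which all vertices are reachable; for $t\in V(T)$, $T_t$ is the subgraph of $T$ induced by the vertices reachable from $t$. A directed tree decomposition of $D$ is a triple $(T,\beta,\gamma)$ where $T$ is an arborescence, $\beta:V(T)\to 2^{V(D)}$ is such that the sets $\beta(t)$ form a partition of $V(D)$ into nonempty sets, and $\gamma:E(T)\to 2^{V(D)}$ is such that for every $(d,t)\in E(T)$ the set $\gamma((d,t))$ meets every directed walk in $D$ that starts and ends in $\beta(T_t):=\bigcup_{t'\in V(T_t)}\beta(t')$ and contains a vertex not in $\beta(T_t)$. Put $\Gamma(t):=\beta(t)\cup\bigcup_{e\text{ incident with }t}\gamma(e)$. The width is $\max_{t\in V(T)}|\Gamma(t)|-1$, and $\mathrm{dtw}(D)$ is the minimum width of a directed tree decomposition of $D$. Cycle hypergraph.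 $\mathcal{C}(D)$ is the hypergraph with vertex set $V(D)$ having one hyperedge $V(C)$ for each directed cycle $C$ of $D$ (multiple hyperedges allowed). A hypergraph $H$ is a hypertree if there is a tree $T$ with $V(T)=V(H)$ such that every hyperedge of $H$ induces a subtree (connected subgraph) of $T$. Butterfly minors. An edge $(u,v)$ is butterfly contractible if it is the only outgoing edge of $u$ or the only incoming edge of $v$. Its butterfly contraction identifies $u$ and $v$ into one vertex and deletes resulting loops and parallel edges. $D'$ is a butterfly minor of $D$ if it can be obtained (up to isomorphism) from a subgraph of $D$ by a sequence of butterfly contractions. A bicycle of length $\ell\ge3$ is the digraph obtained from an undirected cycle of length $\ell$ by replacing each edge $uv$ by both $(u,v)$ and $(v,u)$. $A_4$ is the digraph with vertices $v_1,v_2,v_3,v_4$ and edges $(v_1,v_2),(v_2,v_3),(v_3,v_4),(v_4,v_1),(v_1,v_3),(v_3,v_1),(v_2,v_4),(v_4,v_2)$. *)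

(* Defs.v *)
From mathcomp Require Import all_boot.

Set Implicit Arguments.
Unset Strict Implicit.
Unset Printing Implicit Defensive.

(* Finite digraphs without loops or parallel arcs; digons are allowed.
   Nonemptiness is not part of the structure. *)
Record digraph := Digraph {
  dvert :> finType;
  arc : rel dvert;
  arc_irr : irreflexive arc }.

Definition strongly_connected (D : digraph) :=
  forall u v : D, connect (@arc D) u v.

(* Trees, as adjacency relations of simple graphs. A single edge {x, y} gives
   the ucycle [:: x; y], so graph cycles are the ucycles of size at least 3. *)
Definition is_tree (T : finType) (e : rel T) :=
  [/\ 0 < #|T|, symmetric e, irreflexive e, forall x y, connect e x y
    & forall c : seq T, ucycle e c -> size c < 3].

Definition arborescence (T : finType) (a : rel T) :=
  [/\ forall x y, a x y -> ~~ a y x,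
      is_tree (fun x y => a x y || a y x)
    & exists! r, forall t, connect a r t].

(* beta (T_t), where T_t is the part of the arborescence reachable from t *)
Definition bag_below (T V : finType) (a : rel T) (beta : T -> {set V}) (t : T) :
    {set V} :=
  \bigcup_(t' | connect a t t') beta t'.

(* W meets every directed walk that starts and ends in B and leaves B. *)
Definition guards (D : digraph) (W B : {set D}) :=
  forall (x : D) (p : seq D), path (@arc D) x p ->
    x \in B -> last x p \in B -> (exists2 y, y \in x :: p & y \notin B) ->
  exists2 z, z \in x :: p & z \in W.

(* dtd_gamma s t is only meaningful when dtd_arc s t. *)
Record dir_tree_decomp (D : digraph) := DirTreeDecomp {
  dtd_node : finType;
  dtd_arc : rel dtd_node;
  dtd_beta : dtd_node -> {set D};
  dtd_gamma : dtd_node -> dtd_node -> {set D};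
  dtd_arborescence : arborescence dtd_arc;
  dtd_beta_neq0 : forall t, dtd_beta t != set0;
  dtd_beta_disjoint :
    forall s t, s != t -> [disjoint dtd_beta s & dtd_beta t];
  dtd_beta_cover : \bigcup_t dtd_beta t = [set: D];
  dtd_guards : forall d t, dtd_arc d t ->
    guards (dtd_gamma d t) (bag_below dtd_arc dtd_beta t) }.

Definition dtd_Gamma (D : digraph) (X : dir_tree_decomp D) (t : dtd_node X) :
    {set D} :=
  dtd_beta t :|: (\bigcup_(s | dtd_arc s t) dtd_gamma s t)
             :|: (\bigcup_(s | dtd_arc t s) dtd_gamma t s).

(* The maximum is positive, so the truncated predecessor is harmless. *)
Definition dtd_width (D : digraph) (X : dir_tree_decomp D) : nat :=
  (\max_(t : dtd_node X) #|dtd_Gamma t|).-1.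

(* dtw(D) = k *)
Definition has_dtw (D : digraph) (k : nat) :=
  (exists X : dir_tree_decomp D, dtd_width X = k) /\
  (forall X : dir_tree_decomp D, k <= dtd_width X).

(* Hyperedges form an indexed family, so multiple hyperedges are allowed. *)
Record hypergraph := Hypergraph {
  hvert : finType;
  hedge : Type;
  hedge_set : hedge -> {set hvert} }.

Definition induces_connected (T : finType) (e : rel T) (S : {set T}) :=
  forall x y, x \in S -> y \in S ->
    connect (fun u v => [&& e u v, u \in S & v \in S]) x y.

Definition hypertree (H : hypergraph) :=
  exists2 e : rel (hvert H), is_tree e
    & forall i : hedge H, induces_connected e (hedge_set i).

Definition cyclic_seq (D : digraph) (c : seq D) :=
  [&& c != [::], uniq c & cycle (@arc D) c].

Definition seq_arcs (D : digraph) (c : seq D) : {set D * D} :=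
  [set (x, next c x) | x in c].

(* A directed cycle is identified with its arc set, so that the rotations of a
   vertex sequence count as one cycle; the bound on the length only serves to
   make the predicate boolean (see is_dicycleP). *)
Definition is_dicycle (D : digraph) (A : {set D * D}) : bool :=
  [exists n : 'I_#|D|.+1, [exists c : n.-tuple D,
     cyclic_seq c && (A == seq_arcs c)]].

Lemma is_dicycleP (D : digraph) (A : {set D * D}) :
  reflect (exists2 c : seq D, cyclic_seq c & A = seq_arcs c) (is_dicycle A).
Proof.
apply: (iffP existsP) => [[n /existsP[c /andP[cc /eqP ->]]]|[c cc ->]].
  by exists c.
have lec : size c < #|D|.+1.
  by have /and3P[_ /card_uniqP <- _] := cc; rewrite ltnS max_card.
by exists (Ordinal lec); apply/existsP; exists (in_tuple c); rewrite cc /=.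
Qed.

Definition dicycle (D : digraph) := {A : {set D * D} | is_dicycle A}.

Definition dicycle_verts (D : digraph) (C : dicycle D) : {set D} :=
  [set a.1 | a in val C].

Definition cycle_hypergraph (D : digraph) : hypergraph :=
  Hypergraph (@dicycle_verts D).

Definition butterfly_contractible (D : digraph) (u v : D) : bool :=
  arc u v && ([forall w, arc u w ==> (w == v)] ||
              [forall w, arc w v ==> (w == u)]).

(* Identification of v with u: the merged vertex is represented by u. *)
Definition merge (D : digraph) (u v x : D) : D := if x == v then u else x.

Definition contract_arc (D : digraph) (u v : D) : rel {x : D | x != v} :=
  fun x y => (x != y) && [exists a, exists b,
    [&& arc a b, merge u v a == val x & merge u v b == val y]].

Lemma contract_arc_irr (D : digraph) (u v : D) :
  irreflexive (@contract_arc D u v).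
Proof. by move=> x; rewrite /contract_arc eqxx. Qed.

Definition contract (D : digraph) (u v : D) : digraph :=
  Digraph (@contract_arc_irr D u v).

Inductive butterfly_contracts : digraph -> digraph -> Prop :=
| bc_refl (D : digraph) : butterfly_contracts D D
| bc_step (D : digraph) (u v : D) (D' : digraph) : butterfly_contractible u v ->
    butterfly_contracts (contract u v) D' -> butterfly_contracts D D'.

Definition digraph_iso (D D' : digraph) :=
  exists2 f : D -> D', bijective f & forall x y, arc (f x) (f y) = arc x y.

(* S is a subgraph of D, up to isomorphism. *)
Definition subdigraph (S D : digraph) :=
  exists2 f : S -> D, injective f & forall x y, arc x y -> arc (f x) (f y).

Definition butterfly_minor (D' D : digraph) :=
  exists S M : digraph,
    [/\ subdigraph S D, butterfly_contracts S M & digraph_iso M D'].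

(* The bicycle of length l, meaningful for l >= 3; the condition i != j only
   excludes a loop when l = 1. *)
Definition bicycle_arc (l : nat) : rel 'I_l := fun i j =>
  (i != j) && ((j == ordS i) || (i == ordS j)).

Lemma bicycle_arc_irr l : irreflexive (@bicycle_arc l).
Proof. by move=> i; rewrite /bicycle_arc eqxx. Qed.

Definition bicycle (l : nat) : digraph := Digraph (@bicycle_arc_irr l).

(* v_1, ..., v_4 are the elements 0, ..., 3 of 'I_4. *)
Definition A4_arc : rel 'I_4 := fun i j =>
  (val i, val j) \in [:: (0, 1); (1, 2); (2, 3); (3, 0);
                         (0, 2); (2, 0); (1, 3); (3, 1)].

Lemma A4_arc_irr : irreflexive A4_arc.
Proof. by case=> [[|[|[|[|]]]]]. Qed.

Definition A4 : digraph := Digraph A4_arc_irr.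

(* Main.v *)
Require Import Defs.
From mathcomp Require Import all_boot zify.
Import Defs.

Set Implicit Arguments.
Unset Strict Implicit.
Unset Printing Implicit Defensive.

(* Call a vertex set strong if it induces a strongly connected subdigraph. If
   the cycle hypergraph is a hypertree, its tree connects every strong set, so
   strong sets have the Helly property for triples. In a decomposition of width
   one, take the node where the paths between three pairwise meeting points of
   strong sets A, B, C meet: guards of size at most two force any two of the
   three sets to share a vertex of Gamma at this node, hence A, B, C have a
   common vertex. A failure of this property lifts through butterfly minors,
   and bicycles and A_4 fail it.

   Conversely, exclude these minors. Then every strong component C of D - d has
   a gate: a vertex t of C that lies on every strong set containing d and
   meeting C. Otherwise Menger's theorem gives, after contracting into d what
   lies outside C, two cycles that share only d and whose other vertices lie in
   the strong set C, and such a configuration contracts to a bicycle or A_4.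
   Gates produce a tree: the children of t are the gates of the strong
   components of D - t below t. A strong component C' of C - t is again a
   strong component of D - t, because a strong set joining it to d would have
   to use t. The tree connects all strong sets, and it is a directed tree
   decomposition with beta(t) = {t} and gamma(d, t) = {d}. *)

(** The Helly property mediates between the statements because it mentions neither a tree nor a
    decomposition: along a contraction only vertex sets have to be followed. Strong sets serve in
    place of cycles because every arc inside a strong set lies on a cycle inside it, and because the
    strong components that build the tree are such sets. Two obstacles shape the search for minors.
    A contraction changes the vertex type; therefore minors are sought in a relation on one fixed
    type, where a contracted vertex stays behind as an isolated one, and whole families of trees are
    contracted at once. Moreover a connected set cannot be contracted freely: it must split into an
    in-tree and an out-tree at one vertex, and afterwards arcs can enter only through the in-tree
    and leave only from the out-tree. Along a path this makes the order of the entering and the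
    leaving arcs decisive, and the case distinctions below are about this order. *)

(** * Isomorphisms and contractions of digraphs *)

Lemma digraph_iso_refl D : digraph_iso D D.
Proof. by exists id => //; exists id. Qed.

Lemma digraph_iso_trans D1 D2 D3 :
  digraph_iso D1 D2 -> digraph_iso D2 D3 -> digraph_iso D1 D3.
Proof.
move=> [f bf ef] [g bg eg]; exists (g \o f); first exact: bij_comp.
by move=> x y; rewrite /= eg ef.
Qed.

Lemma digraph_iso_sym D1 D2 : digraph_iso D1 D2 -> digraph_iso D2 D1.
Proof.
move=> [f [g fK gK] ef]; exists g; first by exists f.
by move=> x y; rewrite -{2}[x]gK -{2}[y]gK ef.
Qed.

Lemma arc_neq (D : digraph) (x y : D) : arc x y -> x != y.
Proof. by apply: contraTneq => ->; rewrite arc_irr. Qed.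

Section ContractIso.
Variables (D N : digraph) (u v : D) (q : D -> N).
Hypotheses (auv : arc u v) (quv : q u = q v).
Hypothesis q_inj : forall x y, x != v -> y != v -> q x = q y -> x = y.
Hypothesis q_surj : forall a, exists x, q x = a.
Hypothesis q_arc : forall a b, arc a b <->
  a != b /\ exists x y, [/\ arc x y, q x = a & q y = b].

(** The vertices other than [v] biject onto [N] under [q], and [merge] does not change [q]. A
    contraction can thus be recognised by its quotient map, without handling the subtype on which
    [contract] is built. *)
Lemma contract_iso : digraph_iso (contract u v) N.
Proof.
have uv : u != v := arc_neq auv.
have qm x : q (merge u v x) = q x by rewrite /merge; case: eqP => [->|].
have mv x : merge u v x != v by rewrite /merge; case: ifP => // /negbT.
have injq : injective (fun x : contract u v => q (val x)).
  by move=> x y /= e; apply/val_inj; apply: q_inj => //; apply: (valP x) || apply: (valP y).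
exists (fun x => q (val x)).
  have sq a : exists x : contract u v, q (val x) == a.
    have [x <-] := q_surj a.
    by exists (Sub (merge u v x) (mv x)); rewrite SubK qm.
  exists (fun a => xchoose (sq a)).
    by move=> x; apply: injq => /=; apply/eqP; apply: (xchooseP (sq (q (val x)))).
  by move=> a; apply/eqP; apply: (xchooseP (sq a)).
move=> x y; apply/idP/idP.
  case/q_arc => nxy [a [b [ab ea eb]]]; rewrite /= /contract_arc.
  rewrite (contraNneq _ nxy) ?eqxx //=; last by move=> ->.
  apply/existsP; exists a; apply/existsP; exists b; rewrite ab /=.
  apply/andP; split; apply/eqP; apply: q_inj; rewrite ?mv ?qm //;
    by [apply: (valP x) | apply: (valP y)].
rewrite /= /contract_arc => /andP[nxy /existsP[a /existsP[b /and3P[ab /eqP ea /eqP eb]]]].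
apply/q_arc; split; first by apply: contra_neq nxy => /injq.
by exists a, b; split; rewrite // -?ea -?eb qm.
Qed.

End ContractIso.

(** The isomorphism followed by the quotient map meets the hypotheses of [contract_iso], so it
    passes to the contracted digraphs, one contraction at a time. *)
Lemma butterfly_contracts_iso D M : butterfly_contracts D M ->
  forall D', digraph_iso D' D ->
  exists2 M', butterfly_contracts D' M' & digraph_iso M' M.
Proof.
elim=> {D M} [D D' iD|D u v M cuv _ IH D' [f [g fK gK] ef]].
  by exists D' => //; exact: bc_refl.
have /andP[auv suv] := cuv.
have uv : u != v := arc_neq auv.
have mv x : merge u v x != v by rewrite /merge; case: ifP => // /negbT.
pose q (x : D) : contract u v := Sub (merge u v x) (mv x).
have c' : butterfly_contractible (g u) (g v).
  rewrite /butterfly_contractible -ef !gK auv /=.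
  case/orP: suv => /forallP h; apply/orP; [left | right]; apply/forallP => w;
    by apply/implyP; rewrite -ef gK => /(implyP (h (f w)))/eqP <-; rewrite fK.
have [M' bM iM] : exists2 M', butterfly_contracts (contract (g u) (g v)) M'
    & digraph_iso M' M.
  apply: IH; apply: (@contract_iso _ _ _ _ (q \o f)).
  - by case/andP: c'.
  - by apply/val_inj; rewrite /= !gK /merge eqxx (negbTE uv).
  - move=> x y; rewrite -(can_eq fK) gK -(can_eq fK y) gK => nx ny /(congr1 val).
    by rewrite /= /merge (negbTE nx) (negbTE ny) => /(can_inj fK).
  - move=> a; exists (g (val a)); apply/val_inj; rewrite /= gK /merge.
    by rewrite (negbTE (valP a)).
  move=> a b; rewrite /= /contract_arc; split.
    move=> /andP[nab /existsP[x /existsP[y /and3P[xy /eqP ea /eqP eb]]]].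
    split=> //; exists (g x), (g y); rewrite -ef !gK; split=> //;
      by apply/val_inj.
  move=> [nab [x [y [xy ea eb]]]]; rewrite nab /=.
  apply/existsP; exists (f x); apply/existsP; exists (f y).
  by rewrite ef xy -ea -eb /= !eqxx.
by exists M' => //; apply: bc_step c' bM.
Qed.

(** * Butterfly minors of relations *)

Definition bicycle_or_A4 (M : digraph) :=
  (exists2 l, 3 <= l & digraph_iso M (bicycle l)) \/ digraph_iso M A4.

Lemma bicycle_or_A4_iso M M' : digraph_iso M' M -> bicycle_or_A4 M -> bicycle_or_A4 M'.
Proof.
move=> i [[l hl j]|j]; [left; exists l => // | right]; exact: digraph_iso_trans i j.
Qed.

(* Requiring out-arcs everywhere keeps the embedded digraph away from the
   vertices that contractions leave isolated. *)
Definition has_obst (V : finType) (e : rel V) :=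
  exists (S M : digraph) (f : S -> V),
    [/\ injective f, forall x y, arc x y -> e (f x) (f y),
        forall x : S, exists y : S, arc x y, butterfly_contracts S M & bicycle_or_A4 M].

Lemma has_obst_sub (V : finType) (e e' : rel V) :
  subrel e e' -> has_obst e -> has_obst e'.
Proof.
move=> sub [S [M [f [fi fa so SM tM]]]]; exists S, M, f; split=> // x y xy.
exact/sub/fa.
Qed.

Lemma has_obst_minor (D : digraph) : has_obst (@arc D) ->
  (exists2 l, 3 <= l & butterfly_minor (bicycle l) D) \/ butterfly_minor A4 D.
Proof.
move=> [S [M [f [fi fa _ SM [[l hl i]|i]]]]]; [left; exists l => // | right];
  by exists S, M; split=> //; exists f.
Qed.

Section Steps.
Variables (V : finType) (e : rel V).

(** Contraction of the arc from [x] to [y] after the other arcs leaving [x] are dropped; [step_out]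
    is the dual, for an arc from [y] to [x]. The vertex [x] stays in [V], isolated. A loop at [y]
    may arise, but no embedded loopless digraph uses it. *)
Definition step_in (x y : V) : rel V := fun a b =>
  [&& a != x, b != x & e a b || (b == y) && e a x].

Definition step_out (x y : V) : rel V := fun a b =>
  [&& a != x, b != x & e a b || (a == y) && e x b].

Lemma has_obst_lift (S S' M : digraph) (f : S' -> V) (u v : S') (q : S' -> S) :
  injective f -> (forall x y, arc x y -> e (f x) (f y)) ->
  (forall x : S', exists y : S', arc x y) -> butterfly_contractible u v ->
  q u = q v -> (forall x y, x != v -> y != v -> q x = q y -> x = y) ->
  (forall a, exists x, q x = a) ->
  (forall a b, arc a b <->
    a != b /\ exists x y, [/\ arc x y, q x = a & q y = b]) ->
  butterfly_contracts S M -> bicycle_or_A4 M -> has_obst e.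
Proof.
move=> fi fa so cuv quv qi qs qa SM tM.
have auv : arc u v by case/andP: cuv.
have [M' SM' iM'] := butterfly_contracts_iso SM (contract_iso auv quv qi qs qa).
exists S', M', f; split=> //; first exact: bc_step cuv SM'.
exact: bicycle_or_A4_iso tM.
Qed.

(** The contraction is undone in [S]: [None] stands for [x], its only out-arc goes to the vertex
    [s0] over [y], and each arc into [s0] is drawn to [s0], to [None] or to both, as [e] allows.
    Contracting the arc from [None] to [s0] gives [S] back. *)
Lemma has_obst_step_in (x y : V) :
  e x y -> x != y -> has_obst (step_in x y) -> has_obst e.
Proof.
move=> exy nxy [S [M [f [fi fa so SM tM]]]].
have fx a : f a != x by have [b /fa/and3P[]] := so a.
have [s0 /eqP fs0|ny] := pickP (fun s => f s == y); last first.
  exists S, M, f; split=> // a b ab; have /and3P[_ _ /orP[//|]] := fa _ _ ab.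
  by rewrite ny.
pose r (a b : option S) := match a, b with
  | Some a, Some b => arc a b && e (f a) (f b)
  | Some a, None => arc a s0 && e (f a) x
  | None, Some b => b == s0
  | None, None => false end.
have ri : irreflexive r by case=> [a|] //=; rewrite arc_irr.
pose S' := Digraph ri.
pose q (a : S') : S := odflt s0 a.
pose F (a : S') : V := if a is Some a then f a else x.
have lift a b : arc a b -> exists a' b' : S', [/\ arc a' b', q a' = a & q b' = b].
  move=> ab; have /and3P[_ _ /orP[eab|/andP[/eqP fb eax]]] := fa _ _ ab.
    by exists (Some a), (Some b); rewrite /= ab eab.
  exists (Some a), None; rewrite /= eax andbT.
  by have -> : s0 = b by apply: fi; rewrite fs0.
apply: (@has_obst_lift S S' M F None (Some s0) q) SM tM.
- case=> [a|] [b|] //= => [/fi -> //|h|h]; [have := fx a|have := fx b];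
    by rewrite h ?eqxx // -h eqxx.
- case=> [a|] [b|] //= => [/andP[]|/andP[]|/eqP ->] //; by rewrite fs0.
- case=> [a|]; last by exists (Some s0) => /=.
  have [b ab] := so a; have /and3P[_ _ /orP[eab|/andP[/eqP fb eax]]] := fa _ _ ab.
    by exists (Some b); rewrite /= ab.
  exists None; rewrite /= eax andbT.
  by have -> : s0 = b by apply: fi; rewrite fs0.
- rewrite /butterfly_contractible /= eqxx /=; apply/orP; left.
  by apply/forallP; case=> [b|] //=; apply/implyP => /eqP ->.
- by [].
- case=> [a|] [b|] //= na nb; rewrite /q /=; first by move=> ->.
    by move=> h; move: na; rewrite h eqxx.
  by move=> h; move: nb; rewrite -h eqxx.
- by move=> a; exists (Some a).
move=> a b; split=> [ab|]; first by split; [exact: arc_neq ab | exact: lift].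
case=> nab [[c|] [[c'|] []]]; rewrite /q //=; try by move=> /andP[? _] <- <-.
by move=> /eqP -> ha hb; move: nab; rewrite -ha -hb eqxx.
Qed.

Lemma has_obst_step_out (x y : V) :
  e y x -> x != y -> has_obst (step_out x y) -> has_obst e.
Proof.
move=> eyx nxy [S [M [f [fi fa so SM tM]]]].
have fx a : f a != x by have [b /fa/and3P[]] := so a.
(* The new vertex must have an out-arc. So a vertex over [y] is split only if [e] lacks one of its
   out-arcs; if there is no such vertex, [S] embeds in [e] as it is. *)
have [s1 /existsP[b1 /and3P[ab1 /eqP fs1 nb1]]|ny] :=
  pickP (fun s => [exists b : S, [&& arc s b, f s == y & ~~ e y (f b)]]); last first.
  exists S, M, f; split=> // a b ab; have /and3P[_ _ /orP[//|/andP[fay _]]] := fa _ _ ab.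
  by have /negbT/existsPn/(_ b) := ny a; rewrite ab fay negbK (eqP fay).
pose s0 := s1.
pose r (a b : option S) := match a, b with
  | Some a, Some b => arc a b && e (f a) (f b)
  | None, Some b => arc s0 b && e x (f b)
  | Some a, None => a == s0
  | None, None => false end.
have ri : irreflexive r by case=> [a|] //=; rewrite arc_irr.
pose S' := Digraph ri.
pose q (a : S') : S := odflt s0 a.
pose F (a : S') : V := if a is Some a then f a else x.
have lift a b : arc a b -> exists a' b' : S', [/\ arc a' b', q a' = a & q b' = b].
  move=> ab; have /and3P[_ _ /orP[eab|/andP[/eqP fb eax]]] := fa _ _ ab.
    by exists (Some a), (Some b); rewrite /= ab eab.
  exists None, (Some b); rewrite /= eax andbT.
  by have -> : s0 = a by apply: fi; rewrite fs1.
apply: (@has_obst_lift S S' M F (Some s0) None q) SM tM.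
- case=> [a|] [b|] //= => [/fi -> //|h|h]; [have := fx a|have := fx b];
    by rewrite h ?eqxx // -h eqxx.
- case=> [a|] [b|] //= => [/andP[]|/eqP ->|/andP[]] //; by rewrite fs1.
- case=> [a|].
    have [b ab] := so a; have /and3P[_ _ /orP[eab|/andP[/eqP fb eax]]] := fa _ _ ab.
      by exists (Some b); rewrite /= ab.
    exists None; rewrite /=; apply/eqP; apply: fi; by rewrite fs1.
  exists (Some b1); rewrite /= ab1 /=.
  by have /and3P[_ _] := fa _ _ ab1; rewrite fs1 (negbTE nb1) eqxx.
- rewrite /butterfly_contractible /= eqxx /=; apply/orP; right.
  by apply/forallP; case=> [b|] //=; apply/implyP => /eqP ->.
- by [].
- by case=> [a|] [b|] //= na nb; rewrite /q /= => ->.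
- by move=> a; exists (Some a).
move=> a b; split=> [ab|]; first by split; [exact: arc_neq ab | exact: lift].
case=> nab [[c|] [[c'|] []]]; rewrite /q //=; try by move=> /andP[? _] <- <-.
by move=> /eqP -> ha hb; move: nab; rewrite -ha -hb eqxx.
Qed.

End Steps.

(** * Simultaneous contractions *)

Section Contraction.
Variable V : finType.
Implicit Types (e : rel V) (I O : {set V}) (k : V -> V).

Definition in_rel e I k : rel V := fun a b => [&& e a b, a \in I & k a == k b].
Definition out_rel e O k : rel V := fun a b => [&& e a b, b \in O & k a == k b].

(* Every fibre of [k] consists of its representative, of an in-tree inside [I]
   and of an out-tree inside [O]; the arcs leaving [I] or entering [O] outside
   these trees are discarded. *)
Definition contraction e I O k :=
  [/\ forall x, x \in I -> x \notin O,
      forall x, x \notin I -> x \notin O -> k x = x,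
      forall x, (k x \notin I) && (k x \notin O),
      forall x, x \in I -> connect (in_rel e I k) x (k x)
    & forall x, x \in O -> connect (out_rel e O k) (k x) x].

Definition minor_rel e I O k : rel V := fun a b =>
  [exists x, exists y, [&& x \notin I, y \notin O, k x == a, k y == b & e x y]].

Lemma minor_relI e I O k x y :
  x \notin I -> y \notin O -> e x y -> minor_rel e I O k (k x) (k y).
Proof.
move=> xI yO xy; apply/existsP; exists x; apply/existsP; exists y.
by rewrite xI yO !eqxx.
Qed.

Lemma in_rel_last e I k x t : connect (in_rel e I k) x t -> x \in I ->
  t \notin I -> k t = t -> exists x1, [/\ x1 \in I, e x1 t & k x1 = t].
Proof.
case/connectP => p; elim: p x => [|y p IH] x /= => [_ -> -> //|].
case/andP=> /and3P[xy xI /eqP kxy] pth lt _ tI kt.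
case: p IH pth lt => [_ _ /= ty|z p IH pth lt].
  by subst t; exists x; rewrite xI kxy.
by apply: (IH y) => //; have /andP[/and3P[_ ->]] := pth.
Qed.

Lemma out_rel_first e O k x t : connect (out_rel e O k) t x -> x \in O ->
  t \notin O -> k t = t -> exists x1, [/\ x1 \in O, e t x1 & k x1 = t].
Proof.
case/connectP=> [[|y p]] /= => [_ -> -> //|].
by case/andP=> /and3P[ty yO /eqP kxy] _ _ _ _ kt; exists y; rewrite -kxy.
Qed.

Lemma connect_out_const e O k x t : connect (out_rel e O k) x t -> k x = k t.
Proof.
case/connectP => p; elim: p x => [|y p IH] x /= => [_ -> //|].
by case/andP=> /and3P[_ _ /eqP ->] /IH h /h.
Qed.

(** Induction on the number of vertices still to be contracted. The contracted arc joins a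
    representative [t] to a neighbour [x0] in its tree, so that whatever hung on [x0] hangs on [t]
    afterwards, and [x0] becomes a class of its own. In-trees are treated first; the case of
    out-trees can therefore use that [I] is empty. *)
Lemma has_obst_contraction e I O k :
  contraction e I O k -> has_obst (minor_rel e I O k) -> has_obst e.
Proof.
have [n] := ubnP (#|I| + #|O|); elim: n e I O k => // n IH e I O k.
rewrite ltnS => len [dIO kid krep cI cO] H.
have kk x : k (k x) = k x by have /andP[h1 h2] := krep x; apply: kid.
have [I0|[x xI]] := set_0Vmem I; last first.
  have /andP[tI tO] := krep x.
  have [x0 [{}xI ex kx]] := in_rel_last (cI _ xI) xI tI (kk x).
  set t := k x in tI tO ex kx; have kt : k t = t by apply: kk.
  have nxt : x0 != t by apply: contraNneq tI => <-.
  apply: (has_obst_step_in ex nxt).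
  have szI : #|I :\ x0| + #|O| < n.
    by apply: leq_trans len; rewrite [#|I|](cardsD1 x0) xI.
  pose k1 z := if z == x0 then x0 else k z.
  have kx0 z : k z != x0 by have /andP[h _] := krep z; apply: contraNneq h => ->.
  apply: (IH _ (I :\ x0) O k1 szI).
    split.
    - by move=> z /setD1P[_]; apply: dIO.
    - move=> z; rewrite in_setD1 /k1; case: eqP => //= _; exact: kid.
    - move=> z; rewrite /k1 in_setD1; case: (eqVneq z x0) => [_|nz].
        by rewrite eqxx /= dIO.
      by have /andP[/negbTE-> ->] := krep z; rewrite andbF.
    - move=> z /setD1P[nz zI]; rewrite /k1 (negbTE nz).
      (* The path from [z] to its representative survives with [x0] replaced by [t]; a path that
         reaches [x0] has then already arrived. *)
      pose g b := if b == x0 then t else b.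
      suff : forall p b, k b = k z -> path (in_rel e I k) b p -> last b p = k z ->
          connect (in_rel (step_in e x0 t) (I :\ x0) k1) (g b) (k z).
        case/connectP: (cI _ zI) => p pp lp /(_ p z erefl pp (esym lp)).
        by rewrite /g (negbTE nz).
      elim=> [|c p IHp] b kb /=.
        by move=> _ eb; rewrite /g eb (negbTE (kx0 z)).
      case/andP=> /and3P[bc bI /eqP kbc] pp lp.
      have cc := IHp c (etrans (esym kbc) kb) pp lp.
      rewrite /g; case: (eqVneq b x0) => [bx|nb].
        by rewrite bx kx in kb; rewrite -kb connect0.
      apply: connect_trans cc; apply: connect1.
      have gx : g c != x0 by rewrite /g; case: (eqVneq c x0) => //; rewrite eq_sym.
      rewrite /in_rel /step_in gx nb !inE nb bI /k1 (negbTE nb) (negbTE gx) /=.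
      rewrite /g; case: (eqVneq c x0) => [cx|ncx].
        by rewrite eqxx -cx bc orbT /= kt kbc cx kx.
      by rewrite bc /= kbc.
    - move=> z zO; have nz : z != x0 by apply: contraTneq zO => ->; apply: dIO.
      rewrite /k1 (negbTE nz).
      suff : forall p b, b \notin I -> path (out_rel e O k) b p ->
          connect (out_rel (step_in e x0 t) O k1) b (last b p).
        have /andP[zI' _] := krep z.
        by case/connectP: (cO _ zO) => p pp lp /(_ p _ zI' pp); rewrite -lp.
      elim=> [|c p IHp] b bI //= /andP[/and3P[bc cO' kbc] pp].
      have cI' : c \notin I by apply: contraL cO'; apply: dIO.
      apply: connect_trans (IHp _ cI' pp); apply: connect1.
      have nb : b != x0 by apply: contraNneq bI => ->.
      have nc : c != x0 by apply: contraNneq cI' => ->.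
      by rewrite /out_rel /step_in nb nc bc cO' /k1 (negbTE nb) (negbTE nc).
  apply: has_obst_sub H => a b /existsP[y /existsP[z /and5P[yI zO /eqP <- /eqP <- yz]]].
  have ny : y != x0 by apply: contraNneq yI => ->.
  have ky1 : k1 y = k y by rewrite /k1 (negbTE ny).
  have [zx|nz] := eqVneq z x0; last first.
    have <- : k1 z = k z by rewrite /k1 (negbTE nz).
    rewrite -ky1; apply: minor_relI; rewrite ?in_setD1 ?(negbTE yI) ?andbF //.
    by rewrite /step_in ny nz yz.
  have -> : k z = k1 t by rewrite /k1 eq_sym (negbTE nxt) kt zx kx.
  rewrite -ky1; apply: minor_relI; rewrite ?in_setD1 ?(negbTE yI) ?andbF //.
  by rewrite /step_in ny eq_sym nxt eqxx -zx yz orbT.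
have [O0|[x xO]] := set_0Vmem O; last first.
  have /andP[tI tO] := krep x.
  have [x0 [{}xO ex kx]] := out_rel_first (cO _ xO) xO tO (kk x).
  set t := k x in tI tO ex kx; have kt : k t = t by apply: kk.
  have nxt : x0 != t by apply: contraNneq tO => <-.
  apply: (has_obst_step_out ex nxt).
  have szO : #|I| + #|O :\ x0| < n.
    by apply: leq_trans len; rewrite [#|O|](cardsD1 x0) xO add1n addnS.
  pose k1 z := if z == x0 then x0 else k z.
  have kx0 z : k z != x0 by have /andP[_ h] := krep z; apply: contraNneq h => ->.
  apply: (IH _ I (O :\ x0) k1 szO).
    split.
    - by move=> z; rewrite I0 inE.
    - move=> z _; rewrite in_setD1 /k1; case: eqP => //= _.
      by apply: kid; rewrite I0 inE.
    - move=> z; rewrite /k1 in_setD1 I0 !inE; case: (eqVneq z x0) => [_|nz].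
        by rewrite eqxx.
      by have /andP[_ /negbTE->] := krep z; rewrite andbF.
    - by move=> z; rewrite I0 inE.
    move=> z /setD1P[nz zO]; rewrite /k1 (negbTE nz).
    pose g b := if b == x0 then t else b.
    suff : forall p, path (out_rel e O k) (k z) p ->
        connect (out_rel (step_out e x0 t) (O :\ x0) k1) (k z) (g (last (k z) p)).
      case/connectP: (cO _ zO) => p pp lp /(_ p pp).
      by rewrite -lp /g (negbTE nz).
    elim/last_ind=> [|p c IHp] /=; first by rewrite /g (negbTE (kx0 z)).
    rewrite rcons_path last_rcons => /andP[pp /and3P[bc cO' /eqP kbc]].
    have cc := IHp pp; have kb : k (last (k z) p) = k z.
      have /connect_out_const <- : connect (out_rel e O k) (k z) (last (k z) p).
        by apply/connectP; exists p.
      exact: kk.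
    rewrite /g; case: (eqVneq c x0) => [cx|nc].
      have -> : t = k z by rewrite -kb kbc cx kx.
      exact: connect0.
    apply: connect_trans cc _; apply: connect1; move: bc kbc kb.
    set b := last _ _ => bc kbc kb.
    have gx : g b != x0 by rewrite /g; case: (eqVneq b x0) => //; rewrite eq_sym.
    rewrite /out_rel /step_out gx nc !inE nc cO' /k1 (negbTE nc) (negbTE gx) /=.
    rewrite /g; case: (eqVneq b x0) => [bx|nb].
      by rewrite eqxx -bx bc orbT /= kt -kbc bx kx.
    by rewrite bc /= kbc.
  apply: has_obst_sub H => a b /existsP[y /existsP[z /and5P[yI zO /eqP <- /eqP <- yz]]].
  have nz : z != x0 by apply: contraNneq zO => ->.
  have kz1 : k1 z = k z by rewrite /k1 (negbTE nz).
  have [yx|ny] := eqVneq y x0; last first.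
    have <- : k1 y = k y by rewrite /k1 (negbTE ny).
    rewrite -kz1; apply: minor_relI; rewrite ?in_setD1 ?(negbTE zO) ?andbF //.
    by rewrite /step_out ny nz yz.
  have -> : k y = k1 t by rewrite /k1 eq_sym (negbTE nxt) kt yx kx.
  rewrite -kz1; apply: minor_relI; rewrite ?in_setD1 ?(negbTE zO) ?andbF //.
  by rewrite /step_out nz eq_sym nxt eqxx -yx yz orbT.
apply: has_obst_sub H => a b /existsP[x /existsP[y]].
by rewrite I0 O0 !inE /= => /and3P[/eqP<- /eqP<-]; rewrite !kid ?I0 ?O0 ?inE.
Qed.
End Contraction.

(** * Contractions given by lists of vertices *)

Section Branches.
Variables (V : finType) (e : rel V).

(* A branch [(c, (s, t))] collapses to [c] the vertices of [s], which lead to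
   [c], and those of [t], which are reached from [c]. *)
Definition branch := (V * (seq V * seq V))%type.
Implicit Types (b : branch) (bs : seq branch).

Definition bverts b := b.1 :: b.2.1 ++ b.2.2.
Definition bflat bs := flatten (map bverts bs).
Definition bI bs := [set x in flatten [seq b.2.1 | b <- bs]].
Definition bO bs := [set x in flatten [seq b.2.2 | b <- bs]].
Definition bk bs x :=
  (nth (x, ([::], [::])) bs (find (fun b => x \in bverts b) bs)).1.

Definition branchb b :=
  (forall x, x \in b.2.1 -> connect (fun u v => e u v && (u \in b.2.1)) x b.1) /\
  (forall x, x \in b.2.2 -> connect (fun u v => e u v && (v \in b.2.2)) b.1 x).

Definition brel bs := minor_rel e (bI bs) (bO bs) (bk bs).
(** Only the centre and the out-tree of a branch can emit arcs of the minor, and only the centre and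
    the in-tree can receive them. The two predicates record at which end of an arc [x] may stand. *)
Definition out_pt bs x a := x \notin bI bs /\ bk bs x = a.
Definition in_pt bs x a := x \notin bO bs /\ bk bs x = a.

Lemma brelI bs x y (a a' : V) :
  out_pt bs x a -> in_pt bs y a' -> e x y -> brel bs a a'.
Proof. by case=> hx <- [hy <-]; apply: minor_relI. Qed.

Lemma bflat_cons b bs : bflat (b :: bs) = bverts b ++ bflat bs.
Proof. by []. Qed.

Lemma bk_in bs b x : uniq (bflat bs) -> b \in bs -> x \in bverts b -> bk bs x = b.1.
Proof.
rewrite /bk; elim: bs => // b0 bs IH.
rewrite bflat_cons cat_uniq => /and3P[_ /hasPn dis un].
rewrite in_cons /= => /orP[/eqP <- -> //|bbs] xb; case: ifP => [xb0|_]; last exact: IH.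
have : x \in bflat bs by apply/flatten_mapP; exists b.
by move/dis; rewrite /= xb0.
Qed.

Lemma bk_out bs x : x \notin bflat bs -> bk bs x = x.
Proof.
rewrite /bk; elim: bs => // b0 bs IH.
by rewrite bflat_cons mem_cat negb_or /= => /andP[/negbTE -> /IH].
Qed.

Lemma bflat_memI bs x : x \in bI bs -> exists b, [/\ b \in bs, x \in b.2.1 & x \in bverts b].
Proof.
rewrite inE => /flatten_mapP[b bb xb]; exists b.
by rewrite bb xb /bverts in_cons mem_cat xb orbT.
Qed.

Lemma bflat_memO bs x : x \in bO bs -> exists b, [/\ b \in bs, x \in b.2.2 & x \in bverts b].
Proof.
rewrite inE => /flatten_mapP[b bb xb]; exists b.
by rewrite bb xb /bverts in_cons mem_cat xb !orbT.
Qed.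

Lemma bflat_uniq bs b b' x : uniq (bflat bs) -> b \in bs -> b' \in bs ->
  x \in bverts b -> x \in bverts b' -> b = b'.
Proof.
elim: bs => // b0 bs IH; rewrite bflat_cons cat_uniq => /and3P[_ /hasPn dis un].
rewrite !in_cons => /orP[/eqP ->|h] /orP[/eqP ->|h'] xb xb' //; last exact: IH.
  have : x \in bflat bs by apply/flatten_mapP; exists b'.
  by move/dis/negP; case.
have : x \in bflat bs by apply/flatten_mapP; exists b.
by move/dis/negP; case.
Qed.

Lemma bverts_uniq bs b : uniq (bflat bs) -> b \in bs -> uniq (bverts b).
Proof.
elim: bs => // b0 bs IH; rewrite bflat_cons cat_uniq => /and3P[u0 _ un].
by rewrite in_cons => /orP[/eqP -> //|]; apply: IH.
Qed.

Lemma out_ptB bs b x : uniq (bflat bs) -> b \in bs -> x \in b.1 :: b.2.2 ->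
  out_pt bs x b.1.
Proof.
move=> un bb xb; have xv : x \in bverts b.
  by move: xb; rewrite /bverts !in_cons mem_cat => /orP[->|->]; rewrite ?orbT.
split; last exact: bk_in.
apply/negP => /bflat_memI[b' [bb' xb' xv']].
have eb := bflat_uniq un bb' bb xv' xv; subst b'.
have := bverts_uniq un bb; rewrite /bverts /= cat_uniq mem_cat negb_or.
case/and4P=> /andP[n1 _] _ /hasPn dis _.
move: xb; rewrite in_cons => /orP[/eqP ex|/dis]; last by rewrite /= xb'.
by rewrite ex (negbTE n1) in xb'.
Qed.

Lemma in_ptB bs b x : uniq (bflat bs) -> b \in bs -> x \in b.1 :: b.2.1 ->
  in_pt bs x b.1.
Proof.
move=> un bb xb; have xv : x \in bverts b.
  by move: xb; rewrite /bverts !in_cons mem_cat => /orP[->|->]; rewrite ?orbT.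
split; last exact: bk_in.
apply/negP => /bflat_memO[b' [bb' xb' xv']].
have eb := bflat_uniq un bb' bb xv' xv; subst b'.
have := bverts_uniq un bb; rewrite /bverts /= cat_uniq mem_cat negb_or.
case/and4P=> /andP[_ n1] _ /hasPn dis _.
move: xb; rewrite in_cons => /orP[/eqP ex|xb].
  by rewrite ex (negbTE n1) in xb'.
by have := dis _ xb'; rewrite /= xb.
Qed.

Lemma out_pt0 bs x : x \notin bflat bs -> out_pt bs x x.
Proof.
move=> nx; split; last exact: bk_out.
apply: contra nx => /bflat_memI[b [bb _ xb]]; apply/flatten_mapP; exists b => //.
Qed.

Lemma in_pt0 bs x : x \notin bflat bs -> in_pt bs x x.
Proof.
move=> nx; split; last exact: bk_out.
apply: contra nx => /bflat_memO[b [bb _ xb]]; apply/flatten_mapP; exists b => //.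
Qed.

Lemma has_obst_brel bs : uniq (bflat bs) ->
  (forall b, b \in bs -> branchb b) -> has_obst (brel bs) -> has_obst e.
Proof.
move=> un hb; apply: has_obst_contraction; split.
- move=> x /bflat_memI[b [bb xb xv]]; apply/negP => /bflat_memO[b' [bb' xb' xv']].
  have eb := bflat_uniq un bb' bb xv' xv; subst b'.
  have := bverts_uniq un bb; rewrite /bverts /= cat_uniq => /and4P[_ _ /hasPn dis _].
  by have := dis _ xb'; rewrite /= xb.
- move=> x xI xO; case: (boolP (x \in bflat bs)) => [|/bk_out //].
  case/flatten_mapP=> b bb xb; rewrite (bk_in un bb xb).
  move: xb; rewrite /bverts in_cons mem_cat => /or3P[/eqP //|h|h].
    by case/negP: xI; rewrite inE; apply/flatten_mapP; exists b.
  by case/negP: xO; rewrite inE; apply/flatten_mapP; exists b.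
- move=> x; case: (boolP (x \in bflat bs)) => [/flatten_mapP[b bb xb]|nx].
    rewrite (bk_in un bb xb).
    have [-> _] := out_ptB un bb (mem_head _ _).
    by have [-> _] := in_ptB un bb (mem_head _ _).
  by rewrite (bk_out nx); case: (out_pt0 nx) => -> _; case: (in_pt0 nx) => ->.
- move=> x /bflat_memI[b [bb xb xv]]; rewrite (bk_in un bb xv).
  have [h _] := hb _ bb; have /connectP[p] := h _ xb.
  elim: p x {xb xv} => [|y p IH] x /=; first by move=> _ ->; rewrite connect0.
  case/andP=> /andP[xy xb] pp lp; apply: connect_trans (IH y pp lp).
  apply: connect1.
  have xv : x \in bverts b by rewrite /bverts in_cons mem_cat xb orbT.
  have yv : y \in bverts b.
    case: p {IH} pp lp => [_ /= <-|z p /= /andP[/andP[_ yb] _] _].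
      by rewrite /bverts mem_head.
    by rewrite /bverts in_cons mem_cat yb orbT.
  rewrite /in_rel xy (bk_in un bb xv) (bk_in un bb yv) eqxx andbT inE.
  by apply/flatten_mapP; exists b.
move=> x /bflat_memO[b [bb xb xv]]; rewrite (bk_in un bb xv).
have [_ h] := hb _ bb; have /connectP[p] := h _ xb.
elim/last_ind: p x {xb xv} => [|p y IH] x /=; first by move=> _ ->; rewrite connect0.
rewrite rcons_path last_rcons => /andP[pp /andP[xy xb]] ->.
apply: connect_trans (IH _ pp erefl) _; apply: connect1.
have xv : y \in bverts b by rewrite /bverts in_cons mem_cat xb !orbT.
have yv : last b.1 p \in bverts b.
  case/lastP: p {IH} pp {xy} => [_|p z]; first by rewrite /bverts mem_head.
  rewrite rcons_path last_rcons => /andP[_ /andP[_ zb]].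
  by rewrite /bverts in_cons mem_cat zb !orbT.
rewrite /out_rel xy (bk_in un bb xv) (bk_in un bb yv) eqxx andbT inE.
by apply/flatten_mapP; exists b.
Qed.

Lemma brel_path bs x s y a a' : out_pt bs x a -> in_pt bs y a' ->
  {in s, forall z, z \notin bflat bs} -> path e x (rcons s y) ->
  path (brel bs) a (rcons s a').
Proof.
elim: s x a => [|z s IH] x a ox iy ns /=.
  by rewrite !andbT; apply: brelI.
case/andP=> xz pp; have nz : z \notin bflat bs by apply: ns; rewrite mem_head.
rewrite (brelI ox (in_pt0 nz) xz); apply: IH pp => //; first exact: out_pt0.
by move=> w ws; apply: ns; rewrite in_cons ws orbT.
Qed.

Lemma branch_in s c : sorted e (rcons s c) ->
  forall x, x \in s -> connect (fun u v => e u v && (u \in s)) x c.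
Proof.
move=> pth x; move=> xs; move: pth; case/splitPr: xs => s1 s2.
rewrite rcons_cat /= => pth; have {pth} : path e x (rcons s2 c).
  by case: s1 pth => [|a s1] //=; rewrite cat_path => /and3P[].
have : {subset x :: s2 <= s1 ++ x :: s2} by move=> z zs; rewrite mem_cat zs orbT.
move: (s1 ++ x :: s2) => S; elim: s2 x {s1} => [|y s2 IH] x sub /=.
  by rewrite andbT => xc; apply: connect1; rewrite xc sub ?mem_head.
case/andP=> xy pp; apply: connect_trans (IH y _ pp) => [|z zs].
  by apply: connect1; rewrite xy sub ?mem_head.
by apply: sub; rewrite in_cons zs orbT.
Qed.

Lemma branch_out c s : path e c s ->
  forall x, x \in s -> connect (fun u v => e u v && (v \in s)) c x.
Proof.
move=> pth x xs; have : {subset s <= s} by [].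
move: {2 3}s => S; elim: s c pth xs => // y s IH c /= /andP[cy pp].
rewrite in_cons => xs sub; have cy' : connect (fun u v => e u v && (v \in S)) c y.
  by apply: connect1; rewrite cy sub ?mem_head.
case/orP: xs => [/eqP -> //|xs]; apply: connect_trans cy' (IH y pp xs _).
by move=> z zs; apply: sub; rewrite in_cons zs orbT.
Qed.

Lemma branch_lists c s t : sorted e (rcons s c) -> path e c t ->
  branchb (c, (s, t)).
Proof. by move=> h1 h2; split; [apply: branch_in | apply: branch_out]. Qed.

End Branches.

(** * Finding bicycles and A_4 *)

Section Obstructions.
Variable V : finType.
Implicit Types (e : rel V) (X : {set V}) (s t p q : seq V).

Definition digon e : rel V := fun x y => e x y && e y x.

Lemma cycle_nth e s x0 i : uniq s -> cycle e s -> i < size s ->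
  e (nth x0 s i) (nth x0 s (i.+1 %% size s)).
Proof.
move=> us cs lti; have xs := mem_nth x0 lti.
have := next_cycle cs xs; rewrite next_nth xs.
case: s us cs lti xs => // y s us cs lti xs.
rewrite index_uniq //; congr (e _ _).
have [lti'|gei] := ltnP i (size s).
  by rewrite modn_small //= (set_nth_default x0).
rewrite (nth_default _ gei); have -> : i.+1 = size (y :: s) by rewrite /= in lti *; lia.
by rewrite modnn.
Qed.

Lemma bicycle_obst e s : 3 <= size s -> uniq s -> cycle (digon e) s -> has_obst e.
Proof.
move=> s3 us cs; have [x0 _] : exists x0, x0 \in s.
  by case: s s3 {us cs} => // x s _; exists x; rewrite mem_head.
exists (bicycle (size s)), (bicycle (size s)), (fun i => nth x0 s (val i)); split.
- move=> i j /eqP; rewrite nth_uniq //; try exact: ltn_ord.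
  by move/eqP/val_inj.
- move=> i j /= /andP[_ /orP[|]] /eqP ->.
    by have /andP[] := cycle_nth x0 us cs (ltn_ord i).
  by have /andP[] := cycle_nth x0 us cs (ltn_ord j).
- move=> i; exists (ordS i); rewrite /= /bicycle_arc eqxx orTb andbT.
  apply/eqP => /(congr1 val) /=; have := ltn_ord i.
  have [h|h] := ltnP i.+1 (size s); first by rewrite modn_small //; lia.
  move=> h'; have -> : i.+1 = size s by lia.
  by rewrite modnn; lia.
- exact: bc_refl.
by left; exists (size s) => //; apply: digraph_iso_refl.
Qed.

Lemma A4_obst e a b c d : uniq [:: a; b; c; d] ->
  e a b -> e b c -> e c d -> e d a -> digon e a c -> digon e b d -> has_obst e.
Proof.
move=> us ab bc cd da /andP[ac ca] /andP[bd db].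
exists A4, A4, (fun i : 'I_4 => nth a [:: a; b; c; d] i); split.
- move=> i j /eqP; rewrite nth_uniq //; try exact: ltn_ord.
  by move/eqP/val_inj.
- by case=> [[|[|[|[|i]]]] hi] // [[|[|[|[|j]]]] hj].
- move=> [[|[|[|[|i]]]] hi] //.
  + by exists (@Ordinal 4 1 isT).
  + by exists (@Ordinal 4 2 isT).
  + by exists (@Ordinal 4 3 isT).
  + by exists (@Ordinal 4 0 isT).
- exact: bc_refl.
by right; apply: digraph_iso_refl.
Qed.

(* The end points [a] and [b] need not lie in [X]. *)
Definition reach e X a b := exists2 p, path e a (rcons p b) & {subset p <= X}.

Lemma reach_uniq e X a b : reach e X a b -> a != b ->
  exists p, [/\ path e a (rcons p b), {subset p <= X} & uniq (a :: rcons p b)].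
Proof.
move=> [p pth sub] nab.
have := last_rcons a p b; case/shortenP: pth => p' pth' up' sub'.
case/lastP: p' pth' up' sub' => [|p' c] pth' up' sub'.
  by move=> /= ab; move: nab; rewrite ab eqxx.
rewrite last_rcons => ?; subst c; exists p'; split=> // x xp.
have : x \in rcons p b by apply: sub'; rewrite mem_rcons in_cons xp orbT.
rewrite mem_rcons in_cons => /orP[/eqP xb|/sub //].
by move: up'; rewrite cons_uniq rcons_uniq -xb xp andbF.
Qed.

Lemma split_first (P : pred V) s : has P s ->
  exists s1 x s2, [/\ s = s1 ++ x :: s2, P x & ~~ has P s1].
Proof.
move=> hs; have x0 : V by case: s hs.
exists (take (find P s) s), (nth x0 s (find P s)), (drop (find P s).+1 s).
split; first by rewrite -drop_nth ?cat_take_drop // -has_find.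
  exact: nth_find.
apply/hasPn => x xt; apply/negP => Px.
have := before_find x0 (_ : index x s < find P s).
rewrite nth_index ?Px => [h|]; last exact: mem_take xt.
suff lt : index x s < find P s by have := h lt.
rewrite -[s in index x s](cat_take_drop (find P s) s) index_cat xt.
apply: leq_trans (_ : size (take (find P s) s) <= _); first by rewrite index_mem.
by rewrite size_take; case: ltnP.
Qed.

Lemma split_last (P : pred V) s : has P s ->
  exists s1 x s2, [/\ s = s1 ++ x :: s2, P x & ~~ has P s2].
Proof.
rewrite -has_rev => /split_first[s1 [x [s2 [e Px n1]]]].
exists (rev s2), x, (rev s1); rewrite has_rev; split=> //.
by rewrite -[s]revK e rev_cat rev_cons cat_rcons.
Qed.

(** Cut at the first [Q] vertex after [x], then go back to the last [P] vertex before it. *)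
Lemma split_segment (P Q : pred V) x s y : P x -> Q y ->
  exists s1 u m w s2, [/\ x :: rcons s y = s1 ++ u :: m ++ w :: s2,
    P u, Q w, ~~ has P m & ~~ has Q m].
Proof.
move=> Px Qy.
have /split_first[t1 [w [s2 [e1 Qw n1]]]] : has Q (rcons s y).
  by rewrite has_rcons Qy.
have /split_last[s1 [u [m [e2 Pu n2]]]] : has P (x :: t1) by rewrite /= Px.
exists s1, u, m, w, s2; split=> //; first by rewrite e1 -cat_cons e2 -catA.
case: s1 e2 => [|z s1] [_ e2]; first by rewrite -e2.
by apply: contra n1; rewrite e2 has_cat /= => ->; rewrite !orbT.
Qed.

Lemma path_segment e x s s1 u m w s2 : x :: s = s1 ++ u :: m ++ w :: s2 ->
  path e x s -> path e u (rcons m w).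
Proof.
move=> es pth; have : sorted e (s1 ++ u :: m ++ w :: s2) by rewrite -es.
move/cat_sorted2 => [_ /=]; rewrite -cat_rcons cat_path.
by case/andP.
Qed.

End Obstructions.

Section Bicycles.
Variable V : finType.
Implicit Types (e : rel V) (X : {set V}) (s t p q : seq V).

Lemma uniq_catI s t : uniq s -> uniq t -> {in s, forall x, x \notin t} ->
  uniq (s ++ t).
Proof.
move=> us ut dis; rewrite cat_uniq us ut andbT; apply/hasPn => x xt.
by apply/negP => /dis; rewrite xt.
Qed.

Definition fixpt bs (x : V) := out_pt bs x x /\ in_pt bs x x.

Lemma fixpt_center bs b : uniq (bflat bs) -> b \in bs -> fixpt bs b.1.
Proof.
by move=> un bb; split; [apply: out_ptB | apply: in_ptB]; rewrite // mem_head.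
Qed.

Lemma fixpt_out bs x : x \notin bflat bs -> fixpt bs x.
Proof. by move=> nx; split; [apply: out_pt0 | apply: in_pt0]. Qed.

Lemma digon_brel_path e bs x s : {in x :: s, forall v, fixpt bs v} ->
  path (digon e) x s -> path (digon (brel e bs)) x s.
Proof.
elim: s x => //= y s IH x fx /andP[/andP[xy yx] pth].
have [ox ix] := fx x (mem_head _ _).
have [oy iy] : fixpt bs y by apply: fx; rewrite !in_cons eqxx orbT.
rewrite /digon (brelI ox iy xy) (brelI oy ix yx) /=; apply: IH => // v vs.
by apply: fx; rewrite in_cons vs orbT.
Qed.

(* The first vertex [v] of the return path that lies on the path from [y] to [z]
   can be made the next vertex of the path of digons, leaving a smaller [X]. *)
Lemma digon_path_obst e X y m z : m != [::] -> uniq (y :: rcons m z) ->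
  path (digon e) y (rcons m z) -> {in X, forall x, x \notin y :: rcons m z} ->
  reach e X y z -> reach e X z y -> has_obst e.
Proof.
have [n] := ubnP #|X|; elim: n e X y m z => // n IH e X y m z leX m0 um pm dX ryz rzy.
have yX : y \notin X by apply/negP => /dX; rewrite mem_head.
have zX : z \notin X by apply/negP => /dX; rewrite in_cons mem_rcons mem_head orbT.
have nyz : y != z.
  by move: um; rewrite cons_uniq mem_rcons in_cons negb_or => /andP[/andP[]].
have [q [pq qX uq]] := reach_uniq ryz nyz.
have [r [pr rX ur]] : exists r, [/\ path e z (rcons r y), {subset r <= X}
    & uniq (z :: rcons r y)] by apply: reach_uniq => //; rewrite eq_sym.
have uq1 : uniq q by move: uq; rewrite cons_uniq rcons_uniq => /and3P[].
have ur1 : uniq r by move: ur; rewrite cons_uniq rcons_uniq => /and3P[].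
have nq x : x \in y :: rcons m z -> x \notin q.
  by move=> xm; apply/negP => /qX/dX; rewrite xm.
have nr x : x \in y :: rcons m z -> x \notin r.
  by move=> xm; apply/negP => /rX/dX; rewrite xm.
have ym : y \in y :: rcons m z by rewrite mem_head.
have zm : z \in y :: rcons m z by rewrite in_cons mem_rcons mem_head orbT.
have pq1 : path e y q by move: pq; rewrite rcons_path => /andP[].
have pr1 : path e z r by move: pr; rewrite rcons_path => /andP[].
have [|/negbTE/negbT/hasPn dqr] := boolP (has (mem q) r); last first.
  (* With [q] contracted into [y] and [r] into [z], the last arcs of the two paths form a digon that
     closes the path of digons to a bicycle. Its length is at least 3 because [m] is nonempty. *)
  pose bs : seq (branch V) := [:: (y, ([::], q)); (z, ([::], r))].
  have eb : bflat bs = (y :: q) ++ (z :: r) by rewrite /bflat /= cats0.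
  have ub : uniq (bflat bs).
    rewrite eb; apply: uniq_catI.
    - by rewrite cons_uniq uq1 nq.
    - by rewrite cons_uniq ur1 nr.
    move=> x; rewrite in_cons => /orP[/eqP -> | xq].
      by rewrite in_cons negb_or nyz nr.
    rewrite in_cons negb_or; apply/andP; split.
      by apply: contraTneq xq => ->; apply: nq.
    by apply/negP => /dqr; rewrite /= xq.
  have b1 : (y, ([::], q)) \in bs by rewrite mem_head.
  have b2 : (z, ([::], r)) \in bs by rewrite !in_cons eqxx orbT.
  apply: (has_obst_brel ub).
    by move=> b; rewrite !in_cons in_nil orbF => /orP[] /eqP ->; apply: branch_lists.
  apply: (@bicycle_obst _ _ (y :: rcons m z)) => //.
    by rewrite /= size_rcons; case: m m0 {um pm dX nq nr ym zm}.
  rewrite /cycle rcons_path last_rcons; apply/andP; split.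
    apply: digon_brel_path => // v; rewrite in_cons mem_rcons in_cons.
    case/or3P=> [/eqP ->|/eqP ->|vm].
    - exact: (fixpt_center ub b1).
    - exact: (fixpt_center ub b2).
    apply: fixpt_out; rewrite eb mem_cat !in_cons !negb_or.
    have vm' : v \in y :: rcons m z by rewrite in_cons mem_rcons in_cons vm !orbT.
    rewrite nq // nr // andbT /=; move: um; rewrite cons_uniq rcons_uniq mem_rcons.
    rewrite in_cons negb_or => /and3P[/andP[_ h1] h2 _].
    by rewrite andbT; apply/andP; split; apply: contraTneq vm => ->.
  have [_ iy] := fixpt_center ub b1; have [_ iz] := fixpt_center ub b2.
  apply/andP; split.
    apply: (brelI (x := last z r) (y := y) _ iy).
      by apply: (out_ptB ub b2); apply: mem_last.
    by move: pr; rewrite rcons_path => /andP[].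
  apply: (brelI (x := last y q) (y := z) _ iz).
    by apply: (out_ptB ub b1); apply: mem_last.
  by move: pq; rewrite rcons_path => /andP[].
move/split_first => [r' [v [r'' [er vq nr']]]].
case/splitPr: q / vq pq qX uq uq1 nq pq1 nr' => q' q'' pq qX uq uq1 nq pq1 /hasPn nr'.
have vX : v \in X by apply: qX; rewrite mem_cat mem_head orbT.
(* With [q''] contracted into [v] and [r'] into [z], the last arc of [r'] into [v] and the last arc
   of [q''] into [z] form a digon, which prolongs the path of digons to [v]. The rest [q'] still
   leads from [y] to [v]. *)
pose bs : seq (branch V) := [:: (v, ([::], q'')); (z, ([::], r'))].
have nv : v \notin y :: rcons m z := dX _ vX.
have nvz : v != z by apply: contraNneq nv => ->.
move: uq1; rewrite cat_uniq cons_uniq => /and3P[uq' /hasPn dq /andP[vq'' uq'']].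
move: ur1; rewrite er cat_uniq cons_uniq => /and3P[ur' /hasPn dr /andP[vr'' ur'']].
have zq'' : z \notin v :: q'' by have := nq z zm; rewrite mem_cat negb_or => /andP[].
have zr' : z \notin r' by have := nr z zm; rewrite er mem_cat negb_or => /andP[].
have vr' : v \notin r' by have := dr v (mem_head _ _).
have eb : bflat bs = (v :: q'') ++ (z :: r') by rewrite /bflat /= cats0.
have ub : uniq (bflat bs).
  rewrite eb; apply: uniq_catI.
  - by rewrite cons_uniq vq''.
  - by rewrite cons_uniq ur' zr'.
  move=> x xv; rewrite in_cons negb_or; apply/andP; split.
    by apply: contraTneq xv => ->.
  by apply/negP => /nr'; rewrite /= mem_cat xv orbT.
have b1 : (v, ([::], q'')) \in bs by rewrite mem_head.
have b2 : (z, ([::], r')) \in bs by rewrite !in_cons eqxx orbT.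
have pqv : path e v (rcons q'' z).
  by move: pq; rewrite rcons_cat cat_path /= => /and3P[].
have [prz prv] : path e z (rcons r' v) /\ path e v (rcons r'' y).
  by move: pr; rewrite er rcons_cat /= -cat_rcons cat_path last_rcons => /andP[].
apply: (has_obst_brel ub).
  move=> b; rewrite !in_cons in_nil orbF => /orP[] /eqP ->; apply: branch_lists => //.
    by move: pqv; rewrite rcons_path => /andP[].
  by move: prz; rewrite rcons_path => /andP[].
have [ov iv] := fixpt_center ub b1; have [oz iz] := fixpt_center ub b2.
have nflat x : x \in bflat bs -> (x == z) || (x \in X).
  rewrite eb mem_cat !in_cons -orbA => /or4P[/eqP->|xq|->|xr] //.
  - by rewrite vX orbT.
  - by rewrite qX ?orbT // mem_cat in_cons xq !orbT.
  by rewrite rX ?orbT // er mem_cat xr.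
have yflat : y \notin bflat bs.
  by apply/negP => /nflat; rewrite (negbTE nyz) (negbTE yX).
pose X' := [set x in X | x \notin bflat bs].
apply: (IH _ X' y (rcons m z) v).
- apply: leq_trans (proper_card _) leX; apply/properP; split.
    by apply/subsetP => x; rewrite inE => /andP[].
  by exists v => //; rewrite inE eb mem_head andbF.
- by case: m {um pm dX nq nr ym zm nv m0}.
- by rewrite -rcons_cons rcons_uniq um nv.
- rewrite rcons_path last_rcons; apply/andP; split.
    apply: digon_brel_path => // x; rewrite in_cons mem_rcons in_cons.
    case/or3P=> [/eqP ->|/eqP ->|xm] //; first exact: fixpt_out.
    apply: fixpt_out; apply/negP => /nflat /orP[/eqP xz|/dX].
      by move: um; rewrite cons_uniq rcons_uniq -xz xm /= andbF.
    by rewrite in_cons mem_rcons in_cons xm !orbT.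
  apply/andP; split.
    apply: (brelI (x := last z r') (y := v) _ iv).
      by apply: (out_ptB ub b2); apply: mem_last.
    by move: prz; rewrite rcons_path => /andP[].
  apply: (brelI (x := last v q'') (y := z) _ iz).
    by apply: (out_ptB ub b1); apply: mem_last.
  by move: pqv; rewrite rcons_path => /andP[].
- move=> x; rewrite [x \in X']inE => /andP[/dX nx nf].
  rewrite -rcons_cons mem_rcons in_cons negb_or nx andbT.
  by apply: contraNneq nf => ->; rewrite eb mem_head.
- have dq' : {in q', forall x, x \notin bflat bs}.
    move=> x xq; rewrite eb mem_cat negb_or.
    apply/andP; split; first by apply/negP => /dq; rewrite /= xq.
    rewrite in_cons negb_or; apply/andP; split.
      by apply: contraTneq xq => ->; have := nq z zm; rewrite mem_cat negb_or => /andP[].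
    by apply/negP => /nr'; rewrite /= mem_cat xq.
  exists q'.
    apply: (brel_path (x := y) (y := v)) => //; first exact: out_pt0.
    by move: pq; rewrite rcons_cat /= -cat_rcons cat_path => /andP[].
  by move=> x xq; rewrite inE dq' // qX // mem_cat xq.
have /split_last[s1 [u [s2 [es uv ns2]]]] : has (mem (v :: q'')) (v :: r'').
  by rewrite /= mem_head.
have s2r : {subset s2 <= r''}.
  move=> x xs; case: s1 es => [|w s1] [_ ->] //.
  by rewrite mem_cat in_cons xs !orbT.
have dq' : {in s2, forall x, x \notin bflat bs}.
  move=> x xs; rewrite eb mem_cat negb_or.
  apply/andP; split; first by apply/negP => h; case/hasP: ns2; exists x.
  rewrite in_cons negb_or; apply/andP; split.
    apply: contraNneq (nr z zm) => <-; by rewrite er mem_cat in_cons s2r // !orbT.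
  by have := dr x; rewrite /= in_cons s2r ?orbT //; apply.
exists s2.
  apply: (brel_path (x := u) (y := y)) => //; first exact: (out_ptB ub b1).
    exact: in_pt0.
  have : sorted e (rcons (v :: r'') y) by [].
  by rewrite es rcons_cat => /cat_sorted2[].
by move=> x xs; rewrite inE dq' // rX // er mem_cat in_cons s2r // !orbT.
Qed.

End Bicycles.

(** * Reachability inside a set, and collapsing a closed path *)

Section Digons.
Variable V : finType.
Implicit Types (e : rel V) (X : {set V}) (s t p q : seq V).

Definition restr e X : rel V := fun a b => [&& e a b, a \in X & b \in X].

Lemma reach_sub e X (Y : {set V}) a b : {subset X <= Y} -> reach e X a b -> reach e Y a b.
Proof. by move=> XY [s ps sX]; exists s => // x /sX/XY. Qed.

Lemma connect_restr_path e X a b : a \in X -> connect (restr e X) a b ->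
  exists s, [/\ path e a s, {subset a :: s <= X} & b = last a s].
Proof.
move=> aX /connectP[s ps ->]; exists s.
elim: s a aX ps => [|c s IH] a aX /=; first by split=> // x; rewrite inE => /eqP ->.
case/andP=> /and3P[ac _ cX] ps; have [p1 p2 _] := IH _ cX ps.
by split; rewrite ?ac // => x; rewrite in_cons => /orP[/eqP -> // | /p2].
Qed.

Lemma path_connect_restr e X a s : path e a s -> {subset a :: s <= X} ->
  connect (restr e X) a (last a s).
Proof.
move=> ps sX; apply/connectP; exists s => //.
elim: s a ps sX => //= c s IH a /andP[ac ps] sX.
rewrite /restr ac !sX ?in_cons ?eqxx ?orbT //=; apply: IH => // x xs.
by apply: sX; rewrite in_cons xs orbT.
Qed.

Lemma reach_cons e X a b c : e a b -> b \in X -> reach e X b c -> reach e X a c.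
Proof.
move=> ab bX [s ps sX]; exists (b :: s); first by rewrite /= ab.
by move=> x; rewrite in_cons => /orP[/eqP -> | /sX].
Qed.

Lemma reach_connectl e X a b c : connect (restr e X) a b -> reach e X b c ->
  reach e X a c.
Proof.
case/connectP => s; elim: s a => [|x s IH] a /= => [_ -> //|].
case/andP=> /and3P[ax _ xX] ps lb rbc; apply: reach_cons ax xX _; exact: IH.
Qed.

Lemma reach_connectr e X a b c : reach e X a b -> connect (restr e X) b c ->
  reach e X a c.
Proof.
move=> rab /connectP[s]; elim/last_ind: s c => [|s x IH] c; first by move=> _ ->.
rewrite rcons_path last_rcons => /andP[ps /and3P[lx lX xX]] ->.
have [t pt tX] := IH _ ps erefl; exists (rcons t (last b s)).
  by rewrite rcons_path last_rcons pt.
by move=> y; rewrite mem_rcons in_cons => /orP[/eqP -> | /tX].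
Qed.

Lemma reach_connect e X a b : a \in X -> b \in X -> reach e X a b ->
  connect (restr e X) a b.
Proof.
move=> aX bX [s ps sX]; rewrite -(last_rcons a s b); apply: path_connect_restr => //.
move=> x; rewrite in_cons mem_rcons in_cons => /or3P[/eqP -> // | /eqP -> // | /sX //].
Qed.

Definition reachb e X a b := e a b ||
  [exists c in X, [exists c' in X, [&& e a c, connect (restr e X) c c' & e c' b]]].

Lemma reachP e X a b : reflect (reach e X a b) (reachb e X a b).
Proof.
apply: (iffP orP) => [[ab|/'exists_in_exists_inP[c cX [c' c'X /and3P[ac cc cb]]]]|].
- by exists [::] => //=; rewrite ab.
- by apply: reach_cons ac cX _; apply: reach_connectl cc _; exists [::]; rewrite //= cb.
case=> -[|c s] /=; first by rewrite andbT; left.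
case/andP=> ac; rewrite rcons_path => /andP[ps lb] sX; right.
have cX : c \in X by apply: sX; rewrite mem_head.
apply/'exists_in_exists_inP; exists c => //; exists (last c s).
  by apply: sX; apply: mem_last.
by rewrite ac lb path_connect_restr.
Qed.

Lemma closed_path e d d' pre c post : path e d (rcons (pre ++ c :: post) d') ->
  [/\ sorted e (rcons pre c), path e c post,
      exists2 h, h \in c :: pre & e d h & e (last c post) d'].
Proof.
rewrite rcons_cat /= -cat_rcons cat_path last_rcons.
case/andP=> pp; rewrite rcons_path => /andP[ppost elast]; split=> //.
  by case: pre pp => //= h pre /andP[].
case: pre pp => [|h pre] /= /andP[dh _]; first by exists c; rewrite ?mem_head.
by exists h; rewrite // !in_cons eqxx orbT.
Qed.

Lemma single_branch e pre c post : uniq (pre ++ c :: post) ->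
  sorted e (rcons pre c) -> path e c post ->
  let bs := [:: (c, (pre, post))] in
  [/\ uniq (bflat bs), bflat bs =i pre ++ c :: post
    & has_obst (brel e bs) -> has_obst e].
Proof.
move=> us pre_c post_c bs; have eb : bflat bs = c :: pre ++ post.
  by rewrite /bflat /= cats0.
have pe : perm_eq (bflat bs) (pre ++ c :: post).
  by rewrite eb perm_sym (perm_catCA pre [:: c] post).
have ub : uniq (bflat bs) by rewrite (perm_uniq pe).
split=> //; first exact: perm_mem pe.
apply: has_obst_brel => // b; rewrite inE => /eqP ->; exact: branch_lists.
Qed.

(** The closed path collapses to [c], with [pre] as in-branch and [post] as out-branch. Then [c],
    [d], [p] is a path of digons, closed up by the connections between [p] and [c] as in
    [digon_path_obst]. The vertex [o] must not precede [c], since a vertex of the in-branch could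
    not emit the arc towards [p]. *)
Lemma digon_bypass_obst e X (d p c o : V) pre post :
  uniq (d :: p :: pre ++ c :: post) -> digon e d p ->
  path e d (rcons (pre ++ c :: post) d) ->
  {in X, forall x, x \notin d :: p :: pre ++ c :: post} ->
  reach e X p c -> o \in c :: post -> reach e X o p -> has_obst e.
Proof.
move=> /and3P[]; rewrite in_cons negb_or => /andP[ndp dP] pP uP dp pd dX rpc oc rop.
have [pre_c post_c [h hc dh] ld] := closed_path pd.
have [ub eb] := single_branch uP pre_c post_c; apply.
set bs := [:: _] in ub eb *; have b1 : (c, (pre, post)) \in bs by rewrite mem_head.
have [od id] : fixpt bs d by apply: fixpt_out; rewrite eb.
have [op ip] : fixpt bs p by apply: fixpt_out; rewrite eb.
have [oC iC] := fixpt_center ub b1.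
have nX s : {subset s <= X} -> {in s, forall x, x \notin bflat bs}.
  by move=> sX x /sX/dX; rewrite eb !in_cons !negb_or => /and3P[].
apply: (@digon_path_obst _ _ X c [:: d] p) => //.
- rewrite /= !inE negb_or ndp !andbT; apply/andP; split.
    by apply: contraNneq dP => <-; rewrite mem_cat mem_head orbT.
  by apply: contraNneq pP => <-; rewrite mem_cat mem_head orbT.
- move: dp => /andP[dp pd']; rewrite /= /digon (brelI od ip dp) (brelI op id pd').
  rewrite (brelI od (in_ptB ub b1 hc) dh) !andbT.
  by apply: (brelI (out_ptB ub b1 (mem_last _ _)) id).
- move=> x /dX; rewrite !in_cons mem_cat !in_cons !negb_or => /and5P[-> -> _ -> _].
  by [].
- case: rop => s ps sX; exists s => //.
  by apply: (brel_path (out_ptB ub b1 oc) ip (nX _ sX) ps).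
case: rpc => s ps sX; exists s => //.
exact: (brel_path op iC (nX _ sX) ps).
Qed.

End Digons.

Section ClosedPaths.
Variable V : finType.
Implicit Types (e : rel V) (X : {set V}).

(** The paths from [d] to [z] and back may intersect, so a closed path through [z] itself need not
    exist. The first path is left at its first vertex [y] on the second one; [y] can replace [z],
    being joined to it both ways inside [X]. *)
Lemma closed_path_through e X (d z : V) : z \in X -> d \notin X ->
  reach e X d z -> reach e X z d ->
  exists (s t : seq V) y, [/\ path e d (rcons (s ++ y :: t) d), uniq (s ++ y :: t),
    {subset s ++ y :: t <= X}, connect (restr e X) z y & connect (restr e X) y z].
Proof.
move=> zX dX rdz rzd; have ndz : d != z by apply: contraNneq dX => ->.
have [u [pu uX uu]] := reach_uniq rdz ndz.
have nzd : z != d by rewrite eq_sym.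
have [w [pw wX uw]] := reach_uniq rzd nzd.
have u1X : {subset rcons u z <= X}.
  by move=> x; rewrite mem_rcons in_cons => /orP[/eqP -> | /uX].
have w1X : {subset z :: w <= X}.
  by move=> x; rewrite in_cons => /orP[/eqP -> | /wX].
have /split_first[s [y [s' [es yw ns]]]] : has (mem (z :: w)) (rcons u z).
  by rewrite has_rcons /= mem_head.
have [t' [t et]] : exists t' t, z :: w = t' ++ y :: t.
  by case/splitPr: yw => t' t; exists t', t.
have pzw : sorted e (rcons (t' ++ y :: t) d) by rewrite -et /=.
have pyt : path e y (rcons t d) by move: pzw; rewrite rcons_cat => /cat_sorted2[].
have pty : sorted e (rcons t' y).
  by move: pzw; rewrite rcons_cat rcons_cons -cat_rcons => /cat_sorted2[].
have [pds pys] : path e d (rcons s y) /\ path e y s'.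
  by move: pu; rewrite es -cat_rcons cat_path last_rcons => /andP[].
exists s, t, y; split.
- by rewrite rcons_cat rcons_cons -cat_rcons cat_path pds last_rcons.
- rewrite cat_uniq; apply/and3P; split.
  + move: uu; rewrite cons_uniq => /andP[_]; rewrite es cat_uniq.
    by case/andP.
  + apply/hasPn => x xt; apply/negP => xs; case/hasP: ns; exists x => //=.
    by rewrite et mem_cat xt orbT.
  move: uw; rewrite -rcons_cons rcons_uniq et cat_uniq => /andP[_].
  by case/and3P.
- move=> x; rewrite mem_cat => /orP[xs|xt].
    by apply: u1X; rewrite es mem_cat xs.
  by apply: w1X; rewrite et mem_cat xt orbT.
- case: t' et pty {pzw} => [|a t'] /= [za ew] pty; first by rewrite za connect0.
  subst a; rewrite -(last_rcons z t' y); apply: path_connect_restr => // x xt.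
  apply: w1X; rewrite ew; move: xt; rewrite !(in_cons, mem_rcons, mem_cat).
  by case/or3P=> ->; rewrite ?orbT.
have -> : z = last y s' by rewrite -(last_rcons d u z) es last_cat.
apply: path_connect_restr => // x xs; apply: u1X.
by rewrite es mem_cat xs orbT.
Qed.

Lemma reach_first e X (P : pred V) (p z : V) : P z -> z \in X -> reach e X p z ->
  exists2 y, P y & reach e [set x in X | ~~ P x] p y /\ connect (restr e X) y z.
Proof.
move=> Pz zX [s ps sX].
have /split_first[s1 [y [s2 [es Py ns]]]] : has P (rcons s z) by rewrite has_rcons Pz.
move: ps; rewrite es -cat_rcons cat_path last_rcons => /andP[p1 p2].
have sX' : {subset rcons s z <= X}.
  by move=> x; rewrite mem_rcons in_cons => /orP[/eqP -> | /sX].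
exists y => //; split.
  exists s1 => // x xs; rewrite inE sX' ?es ?mem_cat ?xs //=.
  by apply: contra ns => Px; apply/hasP; exists x.
have -> : z = last y s2 by rewrite -(last_rcons p s z) es last_cat.
apply: path_connect_restr => // x xs; apply: sX'.
by rewrite es mem_cat xs orbT.
Qed.

Lemma reach_last e X (P : pred V) (p z : V) : P z -> z \in X -> reach e X z p ->
  exists2 y, P y & reach e [set x in X | ~~ P x] y p /\ connect (restr e X) z y.
Proof.
move=> Pz zX [s ps sX].
have /split_last[s1 [y [s2 [es Py ns]]]] : has P (z :: s) by rewrite /= Pz.
have sX' : {subset z :: s <= X}.
  by move=> x; rewrite in_cons => /orP[/eqP -> | /sX].
have : sorted e (rcons (z :: s) p) by [].
rewrite es rcons_cat rcons_cons => /[dup] /cat_sorted2[_ p2].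
rewrite -cat_rcons => /cat_sorted2[p1 _].
exists y => //; split.
  exists s2 => // x xs; rewrite inE sX' ?es ?mem_cat ?in_cons ?xs ?orbT //=.
  by apply: contra ns => Px; apply/hasP; exists x.
case: s1 es p1 => [|a s1] /= [za es'] p1; first by rewrite za connect0.
subst a; rewrite -(last_rcons z s1 y); apply: path_connect_restr => // x xs.
apply: sX'; move: xs; rewrite es' !(in_cons, mem_rcons, mem_cat).
by case/or3P=> ->; rewrite ?orbT.
Qed.

End ClosedPaths.

(** Disjointness of many lists is kept as uniqueness of one concatenation; its rearrangements are
    matched by counting. *)
Ltac perm_count :=
  apply/permP => ?; rewrite /= ?count_cat /= ?count_cat /= ?count_cat /=;
  repeat match goal with
  | |- context [nat_of_bool ?b] => move: (nat_of_bool b) => ?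
  | |- context [count ?a ?s] => move: (count a s) => ?
  end; clear; lia.

(** * A vertex joined both ways to both ends of a digon *)

Section DigonObst.
Variable V : finType.
Implicit Types (e : rel V) (X : {set V}).

Lemma path_join e x s y t z : path e x (rcons s y) -> path e y (rcons t z) ->
  path e x (rcons (s ++ y :: t) z).
Proof. by move=> h1 h2; rewrite rcons_cat rcons_cons -cat_rcons cat_path h1 last_rcons. Qed.

Lemma path_unjoin e x s y t z : path e x (rcons (s ++ y :: t) z) ->
  path e x (rcons s y) /\ path e y (rcons t z).
Proof. by rewrite rcons_cat rcons_cons -cat_rcons cat_path last_rcons => /andP. Qed.

Lemma path_rconsW e x s y : path e x (rcons s y) -> path e x s /\ e (last x s) y.
Proof. by rewrite rcons_path => /andP. Qed.

Lemma path_sorted_rcons e x s y : path e x (rcons s y) -> sorted e (rcons s y).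
Proof. by case: s => //= a s /andP[]. Qed.

Lemma path_first e x s y : path e x (rcons s y) -> exists2 h, h \in y :: s & e x h.
Proof.
case: s => [|a s] /= /andP[xa _]; first by exists y; rewrite ?mem_head.
by exists a; rewrite // !in_cons eqxx orbT.
Qed.

(* On a closed path [P] through [d], call entry (exit) a vertex joined from (to)
   [p] outside [P]. If some entry does not come after some exit, then [P] can be
   contracted to one vertex. Otherwise [P] = [L] [M] [R] with all exits in [L]
   and all entries in [R]; contracting [L] and [R], a return path from [R] to
   [L] gives A_4 if it avoids [M], and a smaller instance if it does not. *)
Lemma digon_obst e X (d p z : V) : d != p -> digon e d p ->
  d \notin X -> p \notin X -> z \in X ->
  reach e X d z -> reach e X z d -> reach e X p z -> reach e X z p -> has_obst e.
Proof.
have [n] := ubnP #|X|; elim: n e X d p z => // n IH e X d p z leX ndp dp dX pX zX.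
move=> rdz rzd rpz rzp.
have [s [t [y [pP uP PX zy yz]]]] := closed_path_through zX dX rdz rzd.
have yP : y \in s ++ y :: t by rewrite mem_cat mem_head orbT.
move: {s t} (s ++ y :: t) => P in pP uP PX yP.
have yX := PX _ yP.
have rpy := reach_connectr rpz zy; have ryp := reach_connectl yz rzp.
pose XP := [set x in X | x \notin P].
have [a0 a0P [ra0 ca0]] := reach_first (P := fun x => x \in P) yP yX rpy.
have [b0 b0P [rb0 cb0]] := reach_last (P := fun x => x \in P) yP yX ryp.
rewrite -/XP in ra0 rb0; have {y yP yX rpy ryp ca0 cb0 zy yz} cab := connect_trans ca0 cb0.
pose entry v := reachb e XP p v; pose exit v := reachb e XP v p.
have {rb0} eb0 : exit b0 by apply/reachP.
have {ra0} ea0 : entry a0 by apply/reachP.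
have XPP x : x \in XP -> x \in X /\ x \notin P by rewrite inE => /andP.
have dP : d \notin P by apply: contra dX; apply: PX.
have pP' : p \notin P by apply: contra pX; apply: PX.
have uPq q : uniq q -> {subset q <= XP} -> uniq (P ++ q ++ [:: d; p]).
  move=> uq qX; apply: uniq_catI => //.
    apply: uniq_catI => //; first by rewrite /= !inE ndp.
    move=> x /qX/XPP[xX _]; rewrite !inE negb_or; apply/andP.
    by split; apply: contraTneq xX => ->.
  move=> x xP; rewrite mem_cat !inE !negb_or; apply/and3P; split.
  - by apply/negP => /qX/XPP[_]; rewrite xP.
  - by apply: contraTneq xP => ->.
  by apply: contraTneq xP => ->.
have /split_last[L [o [R0 [eP exo noR0]]]] : has exit P by apply/hasP; exists b0.
have [|noL] := boolP (has entry (rcons L o)).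
  case/hasP=> c cL /reachP rpc; have [pre [post eL]] : exists pre post,
      rcons L o = pre ++ c :: post.
    by case/splitPr: cL => pre post; exists pre, post.
  have oc : o \in c :: post.
    by rewrite -(last_rcons o L o) eL last_cat /= mem_last.
  have {}eP : P = pre ++ c :: (post ++ R0) by rewrite eP -cat_rcons eL -catA.
  apply: (@digon_bypass_obst _ e XP d p c o pre (post ++ R0)) => //.
  - by rewrite -eP !cons_uniq in_cons negb_or ndp dP pP' uP.
  - by rewrite -eP.
  - move=> x /XPP[xX xP]; rewrite -eP !in_cons !negb_or xP andbT.
    by apply/andP; split; apply: contraTneq xX => ->.
  - by rewrite -cat_cons mem_cat oc.
  exact/reachP.
have a0R : a0 \in R0.
  move: a0P; rewrite eP -cat_rcons mem_cat => /orP[aL|//].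
  by case/hasP: noL; exists a0.
have b0L : b0 \in rcons L o.
  move: b0P; rewrite eP -cat_rcons mem_cat => /orP[//|bR].
  by case/hasP: noR0; exists b0.
have /split_first[M [c [R [eR enc noM]]]] : has entry R0 by apply/hasP; exists a0.
have {}a0R : a0 \in c :: R.
  move: a0R; rewrite eR mem_cat => /orP[aM|//].
  by case/hasP: noM; exists a0.
have [pdo poc] : path e d (rcons L o) /\ path e o (rcons (M ++ c :: R) d).
  by apply: path_unjoin; rewrite -eR -eP.
have {poc} [poc pcd] := path_unjoin poc.
have oP : o \in P by rewrite eP mem_cat mem_head orbT.
have cP : c \in P by rewrite eP eR !(mem_cat, in_cons) eqxx !orbT.
have [w [pw wX uw]] : exists w, [/\ path e o (rcons w p), {subset w <= XP}
    & uniq (o :: rcons w p)].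
  by apply: reach_uniq; [apply/reachP | apply: contraNneq pP' => <-].
have [al [pal alX ual]] : exists al, [/\ path e p (rcons al c), {subset al <= XP}
    & uniq (p :: rcons al c)].
  by apply: reach_uniq; [apply/reachP | apply: contraNneq pP' => ->].
have {}uw : uniq w by move: uw; rewrite cons_uniq rcons_uniq => /and3P[].
have {}ual : uniq al by move: ual; rewrite cons_uniq rcons_uniq => /and3P[].
(* If the exit path [w] and the entry path [al] meet in [t], they provide a detour from [o] to [c]
   around [M]. On the new closed path [t] is an entry, and the last vertex [o'] of [t :: w2] on
   [t :: al2] is an exit that does not precede it. *)
have [|/hasPn dwal] := boolP (has (mem al) w).
  case/split_first=> w1 [t [w2 [ew tal nw1]]].
  have [al1 [al2 eal]] : exists al1 al2, al = al1 ++ t :: al2.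
    by case/splitPr: tal => al1 al2; exists al1, al2.
  have [po1 po2] : path e o (rcons w1 t) /\ path e t (rcons w2 p).
    by apply: path_unjoin; rewrite -ew.
  have [pp1 pp2] : path e p (rcons al1 t) /\ path e t (rcons al2 c).
    by apply: path_unjoin; rewrite -eal.
  have /split_last[s1 [o' [s2 [es o'al ns2]]]] : has (mem (t :: al2)) (t :: w2).
    by rewrite /= mem_head.
  have uq : uniq (w1 ++ al).
    apply: uniq_catI => //; first by move: uw; rewrite ew cat_uniq => /and3P[].
    by move=> x xw; apply/negP => xa; case/hasP: nw1; exists x.
  have qX : {subset w1 ++ al <= XP}.
    by move=> x; rewrite mem_cat => /orP[xw|/alX //]; apply: wX; rewrite ew mem_cat xw.
  have uall := uPq _ uq qX.
  have s2w : {subset s2 <= w2}.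
    by move=> x xs; case: s1 es => [|? s1] [_ ->] //; rewrite mem_cat in_cons xs !orbT.
  pose Y := [set x in XP | x \notin w1 ++ t :: al2].
  apply: (@digon_bypass_obst _ e Y d p t o' (L ++ o :: w1) (al2 ++ c :: R)) => //.
  - have : uniq ((d :: p :: (L ++ o :: w1) ++ t :: al2 ++ c :: R) ++ (M ++ al1)).
      by rewrite (perm_uniq (s2 := P ++ (w1 ++ al) ++ [:: d; p])) // eP eR eal; perm_count.
    by rewrite cat_uniq => /andP[].
  - rewrite -catA /=; apply: path_join => //; apply: path_join => //.
    exact: path_join.
  - move=> x; rewrite [x \in Y]inE => /andP[/XPP[xX xP]].
    move: xP; rewrite eP eR !(mem_cat, in_cons) !negb_or.
    case/and5P=> -> -> _ -> -> /and3P[-> -> ->] /=; rewrite !andbT.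
    by apply/andP; split; apply: contraTneq xX => ->.
  - exists al1 => // x xa; rewrite inE alX ?eal ?mem_cat ?xa //=.
    have : uniq (al1 ++ (w1 ++ t :: al2)).
      rewrite (perm_uniq (s2 := w1 ++ al)) // eal; perm_count.
    rewrite cat_uniq => /and3P[_ /hasPn h _]; apply/negP => xw.
    by have := h x; rewrite mem_cat xw xa => /(_ isT).
  - by move: o'al; rewrite /= -cat_cons mem_cat => ->.
  exists s2.
    have : sorted e (rcons (t :: w2) p) by [].
    by rewrite es rcons_cat => /cat_sorted2[].
  move=> x xs; rewrite inE wX ?ew ?mem_cat ?in_cons ?s2w ?orbT //= negb_or.
  apply/andP; split; last by apply/negP => xa; case/hasP: ns2; exists x.
  move: uw; rewrite ew cat_uniq => /and3P[_ /hasPn h _]; apply: h.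
  by rewrite in_cons s2w ?orbT.
have uM : uniq (P ++ (w ++ al) ++ [:: d; p]).
  apply: uPq; last by move=> x; rewrite mem_cat => /orP[/wX|/alX].
  by apply: uniq_catI => // x xw; apply/negP => /dwal; rewrite /= xw.
have RX x : x \in c :: R -> x \in X.
  by move=> xR; apply: PX; rewrite eP eR !(mem_cat, in_cons) -in_cons xR !orbT.
have LX x : x \in rcons L o -> x \in X.
  move=> xL; apply: PX; move: xL; rewrite eP !(mem_rcons, mem_cat, in_cons).
  by case/orP=> ->; rewrite ?orbT.
have dLR x : x \in rcons L o -> x \in M ++ c :: R -> False.
  move=> xL xR; move: uP; rewrite eP eR -cat_rcons cat_uniq => /and3P[_ /hasPn h _].
  by have := h _ xR; rewrite /= xL.
have dMR x : x \in M -> x \in c :: R -> False.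
  move=> xM xR; move: uP; rewrite eP eR -cat_rcons !cat_uniq.
  by case/and3P=> _ _ /and3P[_ /hasPn h _]; have := h _ xR; rewrite /= xM.
pose Z := [set x in X | (x \notin rcons L o) && (x \notin c :: R)].
(* The return path is cut from the connection of [a0] with [b0] in [X], so that no inner vertex lies
   in [rcons L o] or [c :: R]. It may still meet [M]. *)
have [u uR [v vL [r [pr rZ ur]]]] : exists2 u, u \in c :: R & exists2 v,
    v \in rcons L o & exists r, [/\ path e u (rcons r v), {subset r <= Z} & uniq r].
  have [q [pq qX lq]] := connect_restr_path (RX _ a0R) cab.
  case/lastP: q => [|q b] in pq qX lq *.
    by case: (dLR a0); rewrite ?mem_cat ?a0R ?orbT // -[a0]lq.
  rewrite last_rcons in lq; subst b.
  have [s1 [u [m [v [s2 [es uR vL nR nL]]]]]] :=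
    @split_segment _ (mem (c :: R)) (mem (rcons L o)) a0 q b0 a0R b0L.
  have {}uR : u \in c :: R by []; have {}vL : v \in rcons L o by [].
  have pm := path_segment es pq.
  have ruv : reach e Z u v.
    exists m => // x xm; rewrite inE qX ?es ?(mem_cat, in_cons) ?xm ?orbT //=.
    by apply/andP; split; apply/negP => h; [case/hasP: nL | case/hasP: nR]; exists x.
  have nuv : u != v.
    by apply/eqP => uv; subst v; apply: (dLR u) => //; rewrite mem_cat uR orbT.
  have [r [pr rZ ur]] := reach_uniq ruv nuv.
  exists u => //; exists v => //; exists r; split=> //.
  by move: ur; rewrite cons_uniq rcons_uniq => /and3P[].
have rX x : x \in r -> [/\ x \in X, x \notin rcons L o & x \notin c :: R].
  by move=> /rZ; rewrite inE => /and3P[].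
have XPI x : x \in X -> x \notin P -> x \in XP by rewrite inE => -> ->.
have PE x : x \in P -> [\/ x \in rcons L o, x \in M | x \in c :: R].
  rewrite eP eR -cat_rcons !mem_cat => /or3P[h|h|h];
    by [apply: Or31 | apply: Or32 | apply: Or33].
(* Otherwise the last vertex of [P] before the meeting point would be an exit after [o]. *)
have drw : {in r, forall x, x \notin w}.
  move=> x xr; apply/negP => xw.
  case/splitPr: xr => r1 r2 in pr rX *; case/splitPr: xw => w1 w2 in pw wX *.
  have [pr1 _] := path_unjoin pr; have [_ pw2] := path_unjoin pw.
  have uP' : u \in P by rewrite eP eR !mem_cat !in_cons mem_cat uR !orbT.
  have /split_last[s1 [b [s2 [es bP ns2]]]] : has (mem P) (u :: r1) by rewrite /= uP'.
  have s2X : {subset s2 <= r1}.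
    by move=> a xs; case: s1 es => [|? s1] [_ ->] //; rewrite mem_cat in_cons xs !orbT.
  have pb : path e b (rcons s2 x).
    have : sorted e (rcons (u :: r1) x) by [].
    by rewrite es rcons_cat => /cat_sorted2[].
  have exb : exit b.
    apply/reachP; exists (s2 ++ x :: w2); first exact: path_join.
    move=> a; rewrite mem_cat => /orP[as2|aw]; last first.
      by apply: wX; rewrite mem_cat aw orbT.
    apply: XPI; last by apply/negP => aP; case/hasP: ns2; exists a.
    by have [] := rX a; rewrite ?mem_cat ?s2X.
  have nbL : b \notin rcons L o.
    have : b \in u :: r1 by rewrite es mem_cat mem_head orbT.
    rewrite in_cons => /orP[/eqP -> | br1]; last by have [] := rX b; rewrite ?mem_cat ?br1.
    by apply/negP => uL; apply: (dLR u) => //; rewrite mem_cat uR orbT.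
  case/hasP: noR0; exists b => //; have : b \in P by [].
  by rewrite eP -cat_rcons mem_cat (negbTE nbL).
(* Otherwise the first vertex of [P] after the meeting point would be an entry before [c]. *)
have dra : {in r, forall x, x \notin al}.
  move=> x xr; apply/negP => xa.
  case/splitPr: xr => r1 r2 in pr rX *; case/splitPr: xa => a1 a2 in pal alX *.
  have [_ pr2] := path_unjoin pr; have [pa1 _] := path_unjoin pal.
  have vP : v \in P by rewrite eP -cat_rcons mem_cat vL.
  have /split_first[s1 [b [s2 [es bP ns1]]]] : has (mem P) (rcons r2 v).
    by rewrite has_rcons /= vP.
  have s1X : {subset s1 <= r2}.
    move=> a as1; have : a \in rcons r2 v by rewrite es mem_cat as1.
    rewrite mem_rcons in_cons => /orP[/eqP av|//].
    by case/hasP: ns1; exists a; rewrite // av.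
  have pb : path e x (rcons s1 b).
    by move: pr2; rewrite es -cat_rcons cat_path => /andP[].
  have enb : entry b.
    apply/reachP; exists (a1 ++ x :: s1); first exact: path_join.
    move=> a; rewrite mem_cat in_cons => /or3P[aa|/eqP ->|as1].
    - by apply: alX; rewrite mem_cat aa.
    - by apply: alX; rewrite mem_cat mem_head orbT.
    apply: XPI; last by apply/negP => aP; case/hasP: ns1; exists a.
    by have [] := rX a; rewrite ?mem_cat ?in_cons ?s1X ?orbT.
  have nbR : b \notin c :: R.
    have : b \in rcons r2 v by rewrite es mem_cat mem_head orbT.
    rewrite mem_rcons in_cons => /orP[/eqP -> | br].
      by apply/negP => uL; apply: (dLR v) => //; rewrite mem_cat uL orbT.
    by have [] := rX b; rewrite ?mem_cat ?in_cons ?br ?orbT.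
  case: (PE b bP) => [bL|bM|bR]; last by rewrite bR in nbR.
    by case/hasP: noL; exists b.
  by case/hasP: noM; exists b.
have rX' x : x \in r -> x \in X by case/rX.
have [pw1 lw] := path_rconsW pw; have [pal1 lal] := path_rconsW pal.
have [poc1 loc] := path_rconsW poc; have [pcd1 lcd] := path_rconsW pcd.
have [pr1 lr] := path_rconsW pr.
have [h ho dh] := path_first pdo.
have /andP[edp epd] : digon e d p by [].
have [|/hasPn dMr] := boolP (has (mem M) r); last first.
  have uF : uniq ((P ++ (w ++ al) ++ [:: d; p]) ++ r).
    apply: uniq_catI => // x xM; apply/negP => xr; move: xM; rewrite !mem_cat !inE.
    case/or3P=> [/PE[xL|xM|xR]|/orP[xw|xa]|/orP[]/eqP ex].
    - by have [_ /negP] := rX x xr.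
    - by have := dMr x xr; rewrite /= xM.
    - by have [_ _ /negP] := rX x xr.
    - by have := drw x xr; rewrite xw.
    - by have := dra x xr; rewrite xa.
    - by have := rX' x xr; rewrite ex (negbTE dX).
    by have := rX' x xr; rewrite ex (negbTE pX).
  (* The classes [d], [o], [p], [c] form A_4: [P], [w] and [al] give the cycle in this order, [d]
     and [p] are a digon by hypothesis, and [M] and [r] give the digon of [o] and [c]. *)
  pose bs : seq (branch V) := [:: (o, (L, M)); (p, (w, al)); (c, ([::], R ++ r))].
  have eb : bflat bs = (o :: L ++ M) ++ (p :: w ++ al) ++ (c :: R ++ r).
    by rewrite /bflat /= cats0.
  have : uniq (d :: bflat bs).
    by rewrite (perm_uniq (s2 := (P ++ (w ++ al) ++ [:: d; p]) ++ r)) // eb eP eR; perm_count.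
  rewrite cons_uniq => /andP[dF ub].
  have b1 : (o, (L, M)) \in bs by rewrite mem_head.
  have b2 : (p, (w, al)) \in bs by rewrite !in_cons eqxx orbT.
  have b3 : (c, ([::], R ++ r)) \in bs by rewrite !in_cons eqxx !orbT.
  apply: (has_obst_brel ub).
    move=> b; rewrite !in_cons in_nil orbF => /or3P[] /eqP ->.
    - by apply: branch_lists => //; apply: path_sorted_rcons pdo.
    - by apply: branch_lists => //; apply: path_sorted_rcons pw.
    split=> //= x; rewrite mem_cat.
    have cR q y : path e y q -> {subset q <= R ++ r} -> {in q, forall z,
        connect (fun a b0 => e a b0 && (b0 \in R ++ r)) y z}.
      move=> pq sq z' zq; apply: connect_sub (branch_out pq zq) => a b'.
      by case/andP=> ab /sq bR; apply: connect1; rewrite ab.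
    have sR : {subset R <= R ++ r} by move=> a ar; rewrite mem_cat ar.
    have sr : {subset r <= R ++ r} by move=> a ar; rewrite mem_cat ar orbT.
    case/orP=> xR; first exact: cR xR.
    apply: connect_trans (cR _ _ pr1 sr _ xR).
    by move: uR; rewrite in_cons => /orP[/eqP -> | uR]; [exact: connect0 | exact: cR uR].
  have [od id] := fixpt_out dF.
  have [oo io] := fixpt_center ub b1; have [op ip] := fixpt_center ub b2.
  have [oc ic] := fixpt_center ub b3.
  have oL : h \in o :: L by [].
  apply: (@A4_obst _ _ d o p c).
  - have : uniq ([:: d; o; p; c] ++ (L ++ M ++ w ++ al ++ R ++ r)).
      rewrite (perm_uniq (s2 := (P ++ (w ++ al) ++ [:: d; p]) ++ r)) // eP eR; perm_count.
    by rewrite cat_uniq => /andP[].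
  - exact: brelI od (in_ptB ub b1 ho) dh.
  - have [h' hp oh] := path_first pw; exact: brelI oo (in_ptB ub b2 hp) oh.
  - exact: brelI (out_ptB ub b2 (mem_last _ _)) ic lal.
  - apply: brelI (out_ptB ub b3 _) id lcd => /=.
    by have := mem_last c R; rewrite !in_cons mem_cat => /orP[->|->]; rewrite ?orbT.
  - by rewrite /digon (brelI od ip edp) (brelI op id epd).
  apply/andP; split; first exact: brelI (out_ptB ub b1 (mem_last _ _)) ic loc.
  apply: brelI (out_ptB ub b3 _) (in_ptB ub b1 _) lr => /=.
    have := mem_last u r; rewrite !in_cons mem_cat => /orP[/eqP -> | ->]; rewrite ?orbT //.
    by move: uR; rewrite in_cons => /orP[->|->]; rewrite ?orbT.
  by move: vL; rewrite mem_rcons.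
case/hasP=> x xr xM; have {}xM : x \in M by [].
(* Here [p] goes into [o] together with [w] and [al], and [d] goes into [c]. The result is a digon
   of [o] and [c], to both of which the common vertex [x] of [M] and [r] is joined both ways inside
   [Y]. The instance is smaller because [o] is not in [Y]. *)
pose bs : seq (branch V) := [:: (o, (L, w ++ p :: al)); (c, ([::], rcons R d))].
have eb : bflat bs = (o :: L ++ w ++ p :: al) ++ (c :: rcons R d).
  by rewrite /bflat /= cats0.
have uF : uniq (bflat bs ++ M).
  rewrite (perm_uniq (s2 := P ++ (w ++ al) ++ [:: d; p])) // eb eP eR -cats1; perm_count.
have ub : uniq (bflat bs) by move: uF; rewrite cat_uniq => /and3P[].
have dM : {in M, forall x, x \notin bflat bs}.
  by move=> a aM; move: uF; rewrite cat_uniq => /and3P[_ /hasPn dM _]; exact: dM.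
have dr : {in r, forall x, x \notin bflat bs}.
  move=> a ar; rewrite eb !(mem_cat, in_cons, mem_rcons) !negb_or.
  have [aX aL aR] := rX a ar; move: aL aR.
  rewrite mem_rcons !in_cons !negb_or => /andP[-> ->] /andP[-> ->].
  have nd : a != d by apply: contraTneq aX => ->.
  have np : a != p by apply: contraTneq aX => ->.
  by rewrite drw // dra // nd np.
have b1 : (o, (L, w ++ p :: al)) \in bs by rewrite mem_head.
have b2 : (c, ([::], rcons R d)) \in bs by rewrite !in_cons eqxx orbT.
apply: (has_obst_brel ub).
  move=> b; rewrite !in_cons in_nil orbF => /orP[] /eqP ->; apply: branch_lists => //.
    exact: path_sorted_rcons pdo.
  by rewrite -cat_rcons cat_path pw last_rcons.
have [oo io] := fixpt_center ub b1; have [oc ic] := fixpt_center ub b2.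
pose Y := [set a | (a \in M) || (a \in r)].
have YF a : a \in Y -> a \notin bflat bs by rewrite inE => /orP[/dM|/dr].
have [r1 [r2 er]] : exists r1 r2, r = r1 ++ x :: r2.
  by case/splitPr: {+}xr => r1 r2; exists r1, r2.
have oF : o \in bflat bs by rewrite eb mem_head.
have cF : c \in bflat bs by rewrite eb mem_cat mem_head orbT.
have MX a : a \in M -> a \in X.
  by move=> aM; apply: PX; rewrite eP eR !(mem_cat, in_cons) aM !orbT.
have sM : {subset M <= Y} by move=> a aM; rewrite inE aM.
have sr : {subset r <= Y} by move=> a ar; rewrite inE ar orbT.
have pr' := pr; rewrite er in pr' sr dr.
have [M1 [M2 eM]] : exists M1 M2, M = M1 ++ x :: M2.
  by case/splitPr: {+}xM => M1 M2; exists M1, M2.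
have xF : x \notin bflat bs by exact: dM.
have [ox ix] := fixpt_out xF.
apply: (IH _ Y o c x).
- apply: leq_trans (proper_card _) leX; apply/properP; split.
    by apply/subsetP => a; rewrite inE => /orP[/MX|/rX'].
  by exists o; [exact: PX | apply/negP => /YF; rewrite oF].
- apply/eqP => oc'; apply: (dLR o); first by rewrite mem_rcons mem_head.
  by rewrite oc' mem_cat mem_head orbT.
- apply/andP; split.
    apply: (brelI (x := last o (w ++ p :: al)) _ ic).
      by apply: (out_ptB ub b1); apply: mem_last.
    by rewrite last_cat.
  apply: brelI (out_ptB ub b2 _) (in_ptB ub b1 ho) dh.
  by rewrite in_cons mem_rcons mem_head orbT.
- by apply/negP => /YF; rewrite oF.
- by apply/negP => /YF; rewrite cF.
- exact: sM.
- by rewrite eM in poc dM sM; have [p1 _] := path_unjoin poc; exists M1;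
    [apply: brel_path p1 => // a a1; apply: dM; rewrite mem_cat a1
    | move=> a a1; apply: sM; rewrite mem_cat a1].
- have [_ p2] := path_unjoin pr'; exists r2; last by move=> a a2; apply: sr;
    rewrite mem_cat in_cons a2 !orbT.
  apply: brel_path p2 => //; first by apply: (in_ptB ub b1); rewrite -mem_rcons.
  by move=> a a2; apply: dr; rewrite mem_cat in_cons a2 !orbT.
- have [p1 _] := path_unjoin pr'; exists r1; last by move=> a a1; apply: sr;
    rewrite mem_cat a1.
  apply: brel_path p1 => //; last by move=> a a1; apply: dr; rewrite mem_cat a1.
  apply: (out_ptB ub b2); move: uR; rewrite !in_cons mem_rcons in_cons.
  by case/orP=> ->; rewrite ?orbT.
rewrite eM in poc dM sM; have [_ p2] := path_unjoin poc; exists M2.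
  by apply: brel_path p2 => // a a2; apply: dM; rewrite mem_cat in_cons a2 !orbT.
by move=> a a2; apply: sM; rewrite mem_cat in_cons a2 !orbT.
Qed.
End DigonObst.

(** * Two cycles that share one vertex *)

Section TwoCycles.
Variable V : finType.
Implicit Types (e : rel V) (X S : {set V}).

Lemma path_connect_in e X x s y : path e x (rcons s y) -> x \in X -> y \in X ->
  {subset s <= X} -> connect (restr e X) x y.
Proof. by move=> ps xX yX sX; apply: reach_connect => //; exists s. Qed.

Lemma path_connect_sub e X x s : path e x s -> {subset x :: s <= X} ->
  {in x :: s, forall y, connect (restr e X) x y}.
Proof.
move=> ps sX y; rewrite in_cons => /orP[/eqP ->|ys]; first exact: connect0.
case/splitPr: ys => s1 s2 in ps sX *.
move: ps; rewrite -cat_rcons cat_path => /andP[ps _].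
apply: path_connect_in ps _ _ _; first by apply: sX; rewrite mem_head.
  by apply: sX; rewrite in_cons mem_cat mem_head !orbT.
by move=> z zs; apply: sX; rewrite in_cons mem_cat zs orbT.
Qed.

Lemma sorted_connect_sub e X s y : sorted e (rcons s y) -> {subset rcons s y <= X} ->
  {in rcons s y, forall x, connect (restr e X) x y}.
Proof.
move=> ps sX x; rewrite mem_rcons in_cons => /orP[/eqP ->|xs]; first exact: connect0.
case/splitPr: xs => s1 s2 in ps sX *.
move: ps; rewrite rcons_cat => /cat_sorted2[_ ps].
apply: path_connect_in ps _ _ _.
- by apply: sX; rewrite mem_rcons !(in_cons, mem_cat) eqxx !orbT.
- by apply: sX; rewrite mem_rcons in_cons eqxx.
by move=> z zs; apply: sX; rewrite mem_rcons !(in_cons, mem_cat) zs !orbT.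
Qed.

(** Collapsing the closed path to [c] makes a digon of [c] and [d], and [z] is joined both ways to
    both of them: this is the situation of [digon_obst]. Again [o] has to lie in the part that can
    emit arcs. *)
Lemma bypass_obst e X (d z c o : V) pre post :
  uniq (d :: pre ++ c :: post) -> path e d (rcons (pre ++ c :: post) d) ->
  {in X, forall x, x \notin d :: pre ++ c :: post} -> z \in X ->
  reach e X d z -> reach e X z d -> reach e X z c ->
  o \in c :: post -> reach e X o z -> has_obst e.
Proof.
rewrite cons_uniq => /andP[dP uP] pd dX zX rdz rzd rzc oc roz.
have [pre_c post_c [h hc dh] ld] := closed_path pd.
have [ub eb] := single_branch uP pre_c post_c; apply.
set bs := [:: _] in ub eb *; have b1 : (c, (pre, post)) \in bs by rewrite mem_head.
have [od id] : fixpt bs d by apply: fixpt_out; rewrite eb.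
have [oC iC] := fixpt_center ub b1.
have nX x : x \in X -> x \notin bflat bs.
  by move=> /dX; rewrite eb !in_cons !negb_or => /andP[].
have [oz iz] := fixpt_out (nX _ zX).
have nX' (s : seq V) : {subset s <= X} -> {in s, forall x, x \notin bflat bs}.
  by move=> sX x /sX/nX.
apply: (@digon_obst _ _ X d c z) => //.
- by apply: contraNneq dP => ->; rewrite mem_cat mem_head orbT.
- apply/andP; split; first exact: brelI od (in_ptB ub b1 hc) dh.
  exact: brelI (out_ptB ub b1 (mem_last _ _)) id ld.
- by apply/negP => /dX; rewrite mem_head.
- by apply/negP => /dX; rewrite in_cons mem_cat mem_head !orbT.
- case: rdz => s ps sX; exists s => //; exact: brel_path od iz (nX' _ sX) ps.
- case: rzd => s ps sX; exists s => //; exact: brel_path oz id (nX' _ sX) ps.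
- case: roz => s ps sX; exists s => //.
  exact: brel_path (out_ptB ub b1 oc) iz (nX' _ sX) ps.
case: rzc => s ps sX; exists s => //; exact: brel_path oz iC (nX' _ sX) ps.
Qed.

(** The last vertex [b] of the second closed path serves as the [z] of [bypass_obst]: that path
    joins it to [d] in both directions and also leads from [q] on to [b]. *)
Lemma closed_paths_good e S (d c o q b : V) pre post s :
  d \notin S -> uniq ((pre ++ c :: post) ++ rcons s b) ->
  {subset (pre ++ c :: post) ++ rcons s b <= S} ->
  path e d (rcons (pre ++ c :: post) d) -> path e d (rcons (rcons s b) d) ->
  reach e [set x in S | x \notin pre ++ c :: post] b c ->
  o \in c :: post -> q \in rcons s b ->
  reach e [set x in S | x \notin pre ++ c :: post] o q -> has_obst e.
Proof.
set X := [set x in S | _]; set P := pre ++ c :: post.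
move=> dS uPP PS pP ps rbc oc qs roq.
have sX : {subset rcons s b <= X}.
  move=> x xs; rewrite inE; apply/andP; split.
    by apply: PS; rewrite mem_cat xs orbT.
  by move: uPP; rewrite cat_uniq => /and3P[_ /hasPn h _]; exact: (h x xs).
have bX : b \in X by apply: sX; rewrite mem_rcons mem_head.
have [ps1 lb] := path_rconsW ps; rewrite last_rcons in lb.
apply: (@bypass_obst e X d b c o pre post) => //.
- rewrite cons_uniq; move: uPP; rewrite cat_uniq => /and3P[-> _ _]; rewrite andbT.
  by apply: contra dS => dP; apply: PS; rewrite mem_cat dP.
- move=> x; rewrite inE => /andP[xS xP]; rewrite in_cons negb_or xP andbT.
  by apply: contraNneq dS => <-.
- by exists s => // x xs; apply: sX; rewrite mem_rcons in_cons xs orbT.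
- by exists [::] => //=; rewrite lb.
apply: reach_connectr roq (sorted_connect_sub _ sX qs).
by case: (s) ps1 => //= a s' /andP[].
Qed.

(* As in [digon_obst], with [Q] in the role of [p]: an entry is now reached from
   the last vertex of [Q]. If neither path can be contracted to one vertex, then
   the two ends [L] and [R] of [P] form digons with [d], the connections to [Q]
   being contracted into [d]. *)
Lemma two_cycles_obst e S (d : V) (P Q : seq V) :
  d \notin S -> {in S &, forall x y, connect (restr e S) x y} ->
  P != [::] -> Q != [::] -> uniq (P ++ Q) -> {subset P ++ Q <= S} ->
  path e d (rcons P d) -> path e d (rcons Q d) -> has_obst e.
Proof.
move=> dS Sc P0 Q0 uPQ PQS pP pQ.
have [P' [p eP']] : exists P' p, P = rcons P' p by case/lastP: P P0 {uPQ PQS pP} => // s x; exists s, x.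
have [Q' [q0 eQ']] : exists P' p, Q = rcons P' p by case/lastP: Q Q0 {uPQ PQS pQ} => // s x; exists s, x.
have pP0 : p \in P by rewrite eP' mem_rcons mem_head.
have qQ0 : q0 \in Q by rewrite eQ' mem_rcons mem_head.
have dPQ x : x \in P -> x \notin Q.
  move=> xP; move: uPQ; rewrite cat_uniq => /and3P[_ /hasPn h _].
  by apply/negP => /h; rewrite /= xP.
have PS x : x \in P -> x \in S by move=> xP; apply: PQS; rewrite mem_cat xP.
have QS x : x \in Q -> x \in S by move=> xQ; apply: PQS; rewrite mem_cat xQ orbT.
pose SP := [set x in S | x \notin P]; pose SQ := [set x in S | x \notin Q].
pose SPQ := [set x in SQ | x \notin P].
have PSQ : {subset P <= SQ} by move=> x xP; rewrite inE PS // dPQ.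
have QSP : {subset Q <= SP}.
  by move=> x xQ; rewrite inE QS //; apply: contraL xQ => /dPQ.
have SPQ1 x : x \in SPQ -> [/\ x \in S, x \notin P & x \notin Q].
  by rewrite !inE => /andP[/andP[-> ->] ->].
have SPQ2 x : x \in S -> x \notin P -> x \notin Q -> x \in SPQ.
  by rewrite !inE => -> -> ->.
have npq : p != q0 by apply: contraTneq qQ0 => <-; apply: dPQ.
have reachS x y : x \in S -> y \in S -> x != y -> reach e S x y.
  move=> xS yS nxy; have [s [ps sS lsy]] := connect_restr_path xS (Sc x y xS yS).
  case/lastP: s ps sS lsy => [|s z] ps sS lsy; first by rewrite lsy eqxx in nxy.
  rewrite last_rcons in lsy; subst z; exists s => // z zs; apply: sS.
  by rewrite in_cons mem_rcons in_cons zs !orbT.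
have [q qQ [rpq _]] : exists2 q, q \in Q &
    reach e SQ p q /\ connect (restr e S) q q0.
  by apply: (reach_first (P := fun x => x \in Q)) => //; [exact: QS|apply: reachS => //; [exact: PS | exact: QS]].
have [b0 b0P [rb0 cb0]] : exists2 y, y \in P &
    reach e SPQ y q /\ connect (restr e SQ) p y.
  by apply: (reach_last (P := fun x => x \in P)); rewrite ?PSQ.
have [a0 a0P [ra0 _]] : exists2 y, y \in P &
    reach e SP q0 y /\ connect (restr e S) y p.
  by apply: (reach_first (P := fun x => x \in P)) => //; [exact: PS|apply: reachS; rewrite 1?eq_sym //; [exact: QS | exact: PS]].
(* Every vertex of [Q] leads to [q0] along [Q]. Hence an exit may end anywhere on [Q], while entries
   are counted from [q0]. *)
pose exit v := [exists q in Q, reachb e SPQ v q]; pose entry v := reachb e SP q0 v.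
have {ra0} ea0 : entry a0 by apply/reachP.
have {q qQ rpq rb0} eb0 : exit b0 by apply/exists_inP; exists q => //; apply/reachP.
have /split_last[L [o [R0 [eP exo noR0]]]] : has exit P by apply/hasP; exists b0.
have /exists_inP[q qQ /reachP roq] := exo.
have sSPQP : {subset SPQ <= SP} by move=> x /SPQ1[xS xP _]; rewrite inE xS.
have sSPQQ : {subset SPQ <= SQ} by move=> x /SPQ1[xS _ xQ]; rewrite inE xS.
have [|noL] := boolP (has entry (rcons L o)).
  case/hasP=> c cL /reachP rpc; have [pre [post eL]] : exists pre post,
      rcons L o = pre ++ c :: post.
    by case/splitPr: cL => pre post; exists pre, post.
  have oc : o \in c :: post.
    by rewrite -(last_rcons o L o) eL last_cat /= mem_last.
  have {}eP : P = pre ++ c :: (post ++ R0) by rewrite eP -cat_rcons eL -catA.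
  apply: (@closed_paths_good e S d c o q q0 pre (post ++ R0) Q'); rewrite -?eP -?eQ' //.
    by rewrite -cat_cons mem_cat oc.
  exact: reach_sub sSPQP roq.
have a0R : a0 \in R0.
  move: a0P; rewrite eP -cat_rcons mem_cat => /orP[aL|//].
  by case/hasP: noL; exists a0.
have b0L : b0 \in rcons L o.
  move: b0P; rewrite eP -cat_rcons mem_cat => /orP[//|bR].
  by case/hasP: noR0; exists b0.
have /split_first[M [c [R [eR enc noM]]]] : has entry R0 by apply/hasP; exists a0.
have uP : uniq P by move: uPQ; rewrite cat_uniq => /and3P[].
have uQ : uniq Q by move: uPQ; rewrite cat_uniq => /and3P[].
have [pdo poc] : path e d (rcons L o) /\ path e o (rcons (M ++ c :: R) d).
  by apply: path_unjoin; rewrite -eR -eP.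
have {poc} [poc pcd] := path_unjoin poc.
have oP : o \in P by rewrite eP mem_cat mem_head orbT.
have cP : c \in P by rewrite eP eR !(mem_cat, in_cons) eqxx !orbT.
have LP : {subset rcons L o <= P}.
  by move=> x xL; rewrite eP -cat_rcons mem_cat xL.
have RP : {subset c :: R <= P}.
  by move=> x xR; rewrite eP eR -cat_rcons !mem_cat xR !orbT.
have cb0o : connect (restr e SQ) b0 o.
  by apply: sorted_connect_sub b0L; [exact: path_sorted_rcons pdo | move=> x /LP/PSQ].
have rpq : reach e SQ p q.
  by apply: reach_connectl (connect_trans cb0 cb0o) _; exact: reach_sub sSPQQ roq.
have nPQ x : x \in P -> x \in Q -> False by move=> /dPQ/negP.
have noq : o != q by apply/eqP => oq; apply: (nPQ o); rewrite // oq.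
have [w [pw wX]] := reach_uniq roq noq; rewrite cons_uniq rcons_uniq => /and3P[_ _ uw].
have [a aQ [rac caq]] : exists2 y, y \in Q &
    reach e [set x in SP | x \notin Q] y c /\ connect (restr e SP) q0 y.
  by apply: (reach_last (P := fun x => x \in Q)) => //; [exact: QSP | apply/reachP].
have {}rac : reach e SPQ a c.
  by apply: reach_sub rac => x; rewrite !inE => /andP[/andP[-> ->] ->].
have nac : a != c by apply/eqP => ac; apply: (nPQ a); rewrite // ac.
have [bt [pbt btX]] := reach_uniq rac nac; rewrite cons_uniq rcons_uniq => /and3P[_ _ ubt].
have [B1 [B2 eQ]] : exists B1 B2, Q = B1 ++ q :: B2.
  by case/splitPr: qQ => B1 B2; exists B1, B2.
(* If [a] does not precede [q] on [Q], the roles are exchanged: [Q] collapses to [q], which is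
   reached from the last vertex [p] of [P], and [a] is the exit leading to [c] on [P]. *)
have [aB2|aB2] := boolP (a \in q :: B2).
  apply: (@closed_paths_good e S d q a c p B1 B2 P'); rewrite -?eQ -?eP' //.
  - by rewrite uniq_catC.
  - by move=> x; rewrite mem_cat => /orP[/QS|/PS].
  exact: reach_sub sSPQQ rac.
have [A [A2 eB1]] : exists A A2, B1 = A ++ a :: A2.
  have : a \in B1 by move: aQ; rewrite eQ mem_cat (negbTE aB2) orbF.
  by case/splitPr=> A A2; exists A, A2.
have [pdq pqd] : path e d (rcons B1 q) /\ path e q (rcons B2 d).
  by apply: path_unjoin; rewrite -eQ.
have [pda paq] : path e d (rcons A a) /\ path e a (rcons A2 q).
  by apply: path_unjoin; rewrite -eB1.
have noR1 x : x \in M ++ c :: R -> exit x -> False.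
  by rewrite -eR => xR exx; case/hasP: noR0; exists x.
have PE x : x \in P -> [\/ x \in rcons L o, x \in M | x \in c :: R].
  rewrite eP eR -cat_rcons !mem_cat => /or3P[h|h|h];
    by [apply: Or31 | apply: Or32 | apply: Or33].
have dLR x : x \in rcons L o -> x \in M ++ c :: R -> False.
  move=> xL xR; move: uP; rewrite eP eR -cat_rcons cat_uniq => /and3P[_ /hasPn h _].
  by have := h _ xR; rewrite /= xL.
have pR : p \in c :: R.
  have ep : p = last d P by rewrite eP' last_rcons.
  by rewrite ep eP eR last_cat /= last_cat /= mem_last.
pose Z := [set x in SQ | (x \notin rcons L o) && (x \notin c :: R)].
(* The return path is cut from the connection of [p] with [b0] that avoids [Q]. It starts in
   [c :: R] because [p] is the last vertex of [P]. *)
have [u uR [v vL [r [pr rZ ur]]]] : exists2 u, u \in c :: R & exists2 v,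
    v \in rcons L o & exists r, [/\ path e u (rcons r v), {subset r <= Z} & uniq r].
  have [s [ps sX ls]] := connect_restr_path (PSQ _ pP0) cb0.
  case/lastP: s => [|s b] in ps sX ls *.
    by case: (dLR b0) => //; rewrite ls mem_cat pR orbT.
  rewrite last_rcons in ls; subst b.
  have [s1 [u [m [v [s2 [es uR vL nR nL]]]]]] :=
    @split_segment _ (mem (c :: R)) (mem (rcons L o)) p s b0 pR b0L.
  have {}uR : u \in c :: R by []; have {}vL : v \in rcons L o by [].
  have pm := path_segment es ps.
  have ruv : reach e Z u v.
    exists m => // x xm; have xQ : x \in SQ.
      by apply: sX; rewrite es !(mem_cat, in_cons) xm !orbT.
    rewrite inE xQ /=.
    by apply/andP; split; apply/negP => h; [case/hasP: nL | case/hasP: nR]; exists x.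
  have nuv : u != v.
    by apply/eqP => uv; subst v; apply: (dLR u) => //; rewrite mem_cat uR orbT.
  have [r [pr rZ ur]] := reach_uniq ruv nuv.
  exists u => //; exists v => //; exists r; split=> //.
  by move: ur; rewrite cons_uniq rcons_uniq => /and3P[].
have rX x : x \in r -> [/\ x \in S, x \notin Q, x \notin rcons L o & x \notin c :: R].
  by move=> /rZ; rewrite !inE => /and3P[/andP[-> ->] -> ->].
have uP1 : u \in P := RP _ uR.
have vP1 : v \in P := LP _ vL.
have drw : {in r, forall x, x \notin w}.
  move=> x xr; apply/negP => xw.
  case/splitPr: xr => r1 r2 in pr rX *; case/splitPr: xw => w1 w2 in pw wX *.
  have [pr1 _] := path_unjoin pr; have [_ pw2] := path_unjoin pw.
  have /split_last[s1 [b [s2 [es bP ns2]]]] : has (mem P) (u :: r1) by rewrite /= uP1.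
  have s2X : {subset s2 <= r1}.
    by move=> y xs; case: s1 es => [|? s1] [_ ->] //; rewrite mem_cat in_cons xs !orbT.
  have pb : path e b (rcons s2 x).
    have : sorted e (rcons (u :: r1) x) by [].
    by rewrite es rcons_cat => /cat_sorted2[].
  have exb : exit b.
    apply/exists_inP; exists q => //.
    apply/reachP; exists (s2 ++ x :: w2); first exact: path_join.
    move=> y; rewrite mem_cat => /orP[as2|aw]; last first.
      by apply: wX; rewrite mem_cat aw orbT.
    have [] := rX y; rewrite ?mem_cat ?s2X // => yS yQ _ _.
    apply: SPQ2 => //; apply/negP => yP; case/hasP: ns2; by exists y.
  have nbL : b \notin rcons L o.
    have : b \in u :: r1 by rewrite es mem_cat mem_head orbT.
    rewrite in_cons => /orP[/eqP -> | br1]; last by have [] := rX b; rewrite ?mem_cat ?br1.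
    by apply/negP => uL; apply: (dLR u) => //; rewrite mem_cat uR orbT.
  have {}bP : b \in P by [].
  apply: (noR1 b) => //; move: bP.
  by rewrite eP eR -cat_rcons mem_cat (negbTE nbL).
have drb : {in r, forall x, x \notin bt}.
  move=> x xr; apply/negP => xa.
  case/splitPr: xr => r1 r2 in pr rX *; case/splitPr: xa => a1 a2 in pbt btX *.
  have [_ pr2] := path_unjoin pr; have [pa1 _] := path_unjoin pbt.
  have /split_first[s1 [b [s2 [es bP ns1]]]] : has (mem P) (rcons r2 v).
    by rewrite has_rcons /= vP1.
  have s1X : {subset s1 <= r2}.
    move=> y as1; have : y \in rcons r2 v by rewrite es mem_cat as1.
    rewrite mem_rcons in_cons => /orP[/eqP av|//].
    by case/hasP: ns1; exists y; rewrite // av.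
  have pb : path e x (rcons s1 b).
    by move: pr2; rewrite es -cat_rcons cat_path => /andP[].
  have enb : entry b.
    apply/reachP; apply: reach_connectl caq _.
    exists (a1 ++ x :: s1); first exact: path_join.
    move=> y; rewrite mem_cat in_cons => /or3P[aa|/eqP ->|as1].
    - by apply/sSPQP/btX; rewrite mem_cat aa.
    - by apply/sSPQP/btX; rewrite mem_cat mem_head orbT.
    have [] := rX y; rewrite ?mem_cat ?in_cons ?s1X ?orbT // => yS yQ _ _.
    rewrite inE yS /=; apply/negP => yP; case/hasP: ns1; by exists y.
  have nbR : b \notin c :: R.
    have : b \in rcons r2 v by rewrite es mem_cat mem_head orbT.
    rewrite mem_rcons in_cons => /orP[/eqP -> | br].
      by apply/negP => uL; apply: (dLR v) => //; rewrite mem_cat uL orbT.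
    by have [] := rX b; rewrite ?mem_cat ?in_cons ?br ?orbT.
  case: (PE b bP) => [bL|bM|bR]; last by rewrite bR in nbR.
    by case/hasP: noL; exists b.
  by case/hasP: noM; exists b.
have [pw1 lw] := path_rconsW pw; have [pbt1 lbt] := path_rconsW pbt.
have [poc1 loc] := path_rconsW poc; have [pcd1 lcd] := path_rconsW pcd.
have [pr1 lr] := path_rconsW pr.
have dwP x : x \in w -> [/\ x \in S, x \notin P & x \notin Q] by move/wX/SPQ1.
have dbP x : x \in bt -> [/\ x \in S, x \notin P & x \notin Q] by move/btX/SPQ1.
have dP : d \notin P by apply: contra dS; apply: PS.
have dQ : d \notin Q by apply: contra dS; apply: QS.
have uM s : uniq s -> {subset s <= SPQ} -> uniq (((P ++ Q) ++ s) ++ [:: d]).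
  move=> us sX; apply: uniq_catI => //.
    apply: uniq_catI => // x xPQ; apply/negP => /sX/SPQ1[_ xP xQ].
    by move: xPQ; rewrite mem_cat (negbTE xP) (negbTE xQ).
  move=> x xs; rewrite inE; apply: contraTneq xs => ->.
  rewrite !mem_cat !negb_or dP dQ /=; apply/negP => /sX/SPQ1[dS' _ _].
  by rewrite dS' in dS.
(* If [bt] and [w] meet in [t], the part of [Q] from [a] to [q] can be replaced by a path through
   [t]. The new closed path is disjoint from [P], and [o] serves as the [z] of [bypass_obst]: [P]
   joins it to [d] both ways, and from [o'] it is reached through [c], the return path [r] and the
   end of [rcons L o]. *)
have [|/hasPn dbw] := boolP (has (mem w) bt).
  case/split_first=> t1 [t [t2 [ebt tw nt1]]].
  have [w1 [w2 ew]] : exists w1 w2, w = w1 ++ t :: w2.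
    by case/splitPr: tw => w1 w2; exists w1, w2.
  have [pa1 pa2] : path e a (rcons t1 t) /\ path e t (rcons t2 c).
    by apply: path_unjoin; rewrite -ebt.
  have [po1 po2] : path e o (rcons w1 t) /\ path e t (rcons w2 q).
    by apply: path_unjoin; rewrite -ew.
  have /split_last[s1 [o' [s2 [es o'w ns2]]]] : has (mem (t :: w2)) (t :: t2).
    by rewrite /= mem_head.
  have s2t : {subset s2 <= t2}.
    by move=> x xs; case: s1 es => [|? s1] [_ ->] //; rewrite mem_cat in_cons xs !orbT.
  have uq : uniq (t1 ++ w).
    apply: uniq_catI => //; first by move: ubt; rewrite ebt cat_uniq => /and3P[].
    by move=> x xt; apply/negP => xw; case/hasP: nt1; exists x.
  have qX : {subset t1 ++ w <= SPQ}.
    by move=> x; rewrite mem_cat => /orP[xt|/wX //]; apply: btX; rewrite ebt mem_cat xt.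
  have uall : uniq (d :: (A ++ a :: t1) ++ t :: w2 ++ q :: B2).
    have := uM _ uq qX.
    rewrite (perm_uniq (s2 := (d :: (A ++ a :: t1) ++ t :: w2 ++ q :: B2) ++ (P ++ A2 ++ w1))).
      by rewrite cat_uniq => /andP[].
    by rewrite ew eQ eB1; perm_count.
  pose T := (A ++ a :: t1) ++ t :: w2 ++ q :: B2.
  pose X := [set x in S | x \notin T].
  have TE x : x \in T -> [\/ x \in Q, x \in t1 | x \in t :: w2].
    rewrite /T eQ eB1 !(mem_cat, in_cons) => xT.
    case: (boolP (x \in t1)) => [_|n1]; first exact: Or32.
    case: (boolP ((x == t) || (x \in w2))) => [_|]; first exact: Or33.
    rewrite negb_or => /andP[n2 n3]; apply: Or31; move: xT.
    rewrite (negbTE n1) (negbTE n2) (negbTE n3) /= orbF.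
    by case/orP=> [/orP[]|/orP[]] ->; rewrite ?orbT.
  have wt x : x \in t :: w2 -> x \in w by rewrite ew mem_cat => ->; rewrite orbT.
  have btt x : x \in t1 -> x \in bt by rewrite ebt mem_cat => ->.
  have PX x : x \in P -> x \in X.
    move=> xP; rewrite inE PS //=; apply/negP => /TE[|/btt/dbP[_]|/wt/dwP[_]].
    - exact: nPQ.
    - by rewrite xP.
    by rewrite xP.
  have rX' x : x \in r -> x \in X.
    move=> xr; have [xS xQ _ _] := rX x xr; rewrite inE xS /=; apply/negP.
    case/TE=> [xQ'|/btt xb|/wt xw]; first by rewrite xQ' in xQ.
      by have := drb x xr; rewrite xb.
    by have := drw x xr; rewrite xw.
  have oX := PX _ oP; have cX := PX _ cP.
  apply: (@bypass_obst e X d o t o' (A ++ a :: t1) (w2 ++ q :: B2)) => //.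
  - rewrite -catA /=; apply: path_join => //; apply: path_join => //.
    exact: path_join.
  - move=> x; rewrite inE in_cons negb_or => /andP[xS ->]; rewrite andbT.
    by apply: contraNneq dS => <-.
  - exists L; first by [].
    by move=> x xL; apply/PX/LP; rewrite mem_rcons in_cons xL orbT.
  - exists (M ++ c :: R); first exact: path_join.
    by move=> x xM; apply: PX; rewrite eP eR mem_cat in_cons xM !orbT.
  - exists w1 => // x xw; have xw' : x \in w by rewrite ew mem_cat xw.
    have [xS xP xQ] := dwP x xw'; rewrite inE xS /=; apply/negP.
    case/TE=> [xQ'|xt|xt]; first by rewrite xQ' in xQ.
      by case/hasP: nt1; exists x.
    by move: uw; rewrite ew cat_uniq => /and3P[_ /hasPn h _]; have := h _ xt; rewrite /= xw.
  - by move: o'w; rewrite /= -cat_cons mem_cat => ->.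
  have ro'c : reach e X o' c.
    exists s2.
      have : sorted e (rcons (t :: t2) c) by [].
      by rewrite es rcons_cat => /cat_sorted2[].
    move=> x xs; have xb : x \in bt by rewrite ebt mem_cat in_cons s2t ?orbT.
    have [xS xP xQ] := dbP x xb; rewrite inE xS /=; apply/negP.
    case/TE=> [xQ'|xt|xt]; first by rewrite xQ' in xQ.
      move: ubt; rewrite ebt cat_uniq => /and3P[_ /hasPn h _].
      by have := h x; rewrite in_cons s2t // orbT /= xt => /(_ isT).
    by case/hasP: ns2; exists x.
  apply: reach_connectr ro'c _.
  apply: connect_trans (path_connect_sub pcd1 (fun x xR => PX x (RP x xR)) uR) _.
  apply: connect_trans (path_connect_in pr (PX _ uP1) (PX _ vP1) rX') _.
  by apply: sorted_connect_sub vL; [exact: path_sorted_rcons pdo | move=> x /LP/PX].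
have uF : uniq (((P ++ Q) ++ (w ++ bt)) ++ [:: d]).
  apply: uM; last by move=> x; rewrite mem_cat => /orP[/wX|/btX].
  by apply: uniq_catI => // x xw; apply/negP => /dbw; rewrite /= xw.
(* Absorbing into [d] the connections [w] and [bt] with the two ends of [Q] makes digons of [d] with
   [o] and with [c]. Then [M] and [r] join [o] and [c] in the two directions, as [digon_path_obst]
   requires. *)
pose bs : seq (branch V) :=
  [:: (o, (L, [::])); (c, ([::], R)); (d, (w ++ q :: B2, A ++ a :: bt))].
have eb : bflat bs = (o :: L) ++ (c :: R) ++ (d :: (w ++ q :: B2) ++ A ++ a :: bt).
  by rewrite /bflat /= !cats0.
have uFM : uniq (bflat bs ++ M).
  have : uniq ((bflat bs ++ M) ++ A2).
    rewrite (perm_uniq (s2 := ((P ++ Q) ++ (w ++ bt)) ++ [:: d])) //.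
    by rewrite eb eP eR eQ eB1; perm_count.
  by rewrite cat_uniq => /andP[].
have ub : uniq (bflat bs) by move: uFM; rewrite cat_uniq => /and3P[].
have dM : {in M, forall x, x \notin bflat bs}.
  by move=> x xM; move: uFM; rewrite cat_uniq => /and3P[_ /hasPn h _]; exact: h.
have nQ x : x \notin Q -> [/\ x \notin q :: B2, x \notin A & x != a].
  rewrite eQ eB1 !(mem_cat, in_cons) !negb_or.
  by case/andP=> /and3P[-> -> _] /andP[-> ->].
have dr : {in r, forall x, x \notin bflat bs}.
  move=> x xr; rewrite eb !(mem_cat, in_cons) !negb_or.
  have [xS xQ xL xR] := rX x xr; move: xL xR.
  have [q1 q2 q3] := nQ x xQ; move: q1.
  rewrite mem_rcons !in_cons !negb_or => /andP[-> ->] /andP[-> ->] /andP[-> ->].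
  have nd : x != d by apply: contraTneq xS => ->.
  by rewrite drw // drb // nd q2 q3.
have b1 : (o, (L, [::])) \in bs by rewrite mem_head.
have b2 : (c, ([::], R)) \in bs by rewrite !in_cons eqxx orbT.
have b3 : (d, (w ++ q :: B2, A ++ a :: bt)) \in bs by rewrite !in_cons eqxx !orbT.
apply: (has_obst_brel ub).
  move=> b; rewrite !in_cons in_nil orbF => /or3P[] /eqP ->; apply: branch_lists => //.
  - exact: path_sorted_rcons pdo.
  - by apply: (@path_sorted_rcons _ e o); apply: path_join.
  by rewrite -cat_rcons cat_path pda last_rcons.
have [oo io] := fixpt_center ub b1; have [oc ic] := fixpt_center ub b2.
have [od id] := fixpt_center ub b3.
pose Y := [set x | (x \in M) || (x \in r)].
have YF x : x \in Y -> x \notin bflat bs by rewrite inE => /orP[/dM|/dr].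
apply: (@digon_path_obst _ _ Y o [:: d] c) => //.
- have : uniq ([:: o; d; c] ++ (L ++ R ++ (w ++ q :: B2) ++ A ++ a :: bt)).
    by rewrite (perm_uniq (s2 := bflat bs)) // eb; perm_count.
  by rewrite cat_uniq => /andP[].
- have [h hL dh] := path_first pdo.
  have [h' hw oh] := path_first pw.
  rewrite /= /digon !andbT; apply/andP; split; apply/andP; split.
  + apply: brelI oo (in_ptB ub b3 _) oh.
    by move: hw; rewrite !(in_cons, mem_cat) => /orP[->|->]; rewrite ?orbT.
  + exact: brelI od (in_ptB ub b1 hL) dh.
  + apply: brelI (out_ptB ub b3 _) ic lbt.
    have := mem_last a bt; rewrite !(in_cons, mem_cat) => /orP[->|->]; by rewrite ?orbT.
  exact: brelI (out_ptB ub b2 (mem_last _ _)) id lcd.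
- move=> x /YF; apply: contra; rewrite eb !(in_cons, mem_cat).
  by case/or4P=> // /eqP->; rewrite eqxx ?orbT.
- exists M; last by move=> x xM; rewrite inE xM.
  exact: brel_path oo ic dM poc.
exists r; last by move=> x xr; rewrite inE xr orbT.
apply: brel_path (out_ptB ub b2 uR) (in_ptB ub b1 _) dr pr.
by rewrite -mem_rcons.
Qed.

End TwoCycles.

(** * Two disjoint paths *)

Section Menger.
Variable V : finType.
Implicit Types (e : rel V) (A B : {set V}) (s : seq V).

Definition link e A B s :=
  if s is a :: p then [&& a \in A, path e a p & last a p \in B] else false.

Lemma link_prefix e A B s1 w s2 : link e A B (s1 ++ w :: s2) ->
  link e A [set w] (rcons s1 w).
Proof.
case: s1 => [|a s1] /= /and3P[-> pp _]; first by rewrite inE eqxx.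
by move: pp; rewrite -cat_rcons cat_path last_rcons inE eqxx => /andP[->].
Qed.

Lemma link_suffix e A B s1 w s2 : link e A B (s1 ++ w :: s2) ->
  link e [set w] B (w :: s2).
Proof.
case: s1 => [|a s1] /= /and3P[_ pp]; first by rewrite inE eqxx pp.
by move: pp; rewrite cat_path last_cat inE eqxx /= => /and3P[_ _ ->] ->.
Qed.

Lemma link_cat e A B s1 w s2 : link e A [set w] (rcons s1 w) ->
  link e [set w] B (w :: s2) -> link e A B (s1 ++ w :: s2).
Proof.
case: s1 => [/= /andP[-> _] /and3P[_ -> ->] //|a s1].
move=> /= /and3P[-> pp _] /and3P[_ p2 l2]; by rewrite -cat_rcons cat_path pp last_rcons p2 last_cat last_rcons.
Qed.

Lemma link_sub e e' A B A' B' s : subrel e e' -> {subset A <= A'} ->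
  {subset B <= B'} -> link e A B s -> link e' A' B' s.
Proof.
move=> se sA sB; case: s => //= a s /and3P[/sA -> pp /sB ->].
by rewrite (sub_path se pp).
Qed.

Lemma link_subr e e' A B s : subrel e e' -> link e A B s -> link e' A B s.
Proof. by move=> se; apply: link_sub. Qed.

Lemma path_avoid_arc e (x y a : V) s :
  (x \notin belast a s) || (y \notin s) -> path e a s ->
  path (fun u v => e u v && ((u, v) != (x, y))) a s.
Proof.
elim: s a => //= b s IH a; rewrite !in_cons !negb_or => h /andP[-> /IH ->] /=.
  rewrite andbT; apply: contraTneq h => -[-> ->].
  by rewrite !eqxx.
by case/orP: h => /andP[_ ->]; rewrite ?orbT.
Qed.

Definition linkable e A B (t : V) :=
  [exists a in A, [exists b in B,
    [&& a != t, b != t & connect (restr e [set~ t]) a b]]].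

Lemma linkableP e A B (t : V) :
  reflect (exists2 s, link e A B s & t \notin s) (linkable e A B t).
Proof.
apply: (iffP 'exists_in_exists_inP) => [[a aA [b bB /and3P[nat nbt cab]]]|].
  have at' : a \in [set~ t] by rewrite !inE.
  have [s [ps ss ls]] := connect_restr_path at' cab.
  exists (a :: s); first by rewrite /= aA ps -ls.
  by apply/negP => /ss; rewrite !inE eqxx.
case=> -[|a s] //= /and3P[aA ps lB] nt.
have sub : {subset a :: s <= [set~ t]}.
  by move=> z zs; rewrite !inE; apply: contraNneq nt => <-.
exists a => //; exists (last a s) => //; rewrite (path_connect_restr ps sub) andbT.
have := sub a (mem_head _ _); have := sub _ (mem_last a s).
by rewrite !inE => -> ->.
Qed.

(* Goering's proof: delete an arc; if a vertex [t] then separates [A] from [B],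
   apply induction on both sides of the separators {t, x} and {t, y}. *)
Lemma menger2 e A B (v0 : V) : (forall t, linkable e A B t) ->
  exists P Q, [/\ link e A B P, link e A B Q & uniq (P ++ Q)].
Proof.
have [n] := ubnP #|[set a : V * V | e a.1 a.2]|.
elim: n e A B => // n IH e A B; rewrite ltnS => len lnk.
have [[x y] /= exy|noarc] := pickP (fun a : V * V => e a.1 a.2); last first.
  have one t : exists2 a, a \in A :&: B & a != t.
    have /linkableP[[|a [|b s]] //=] := lnk t.
      by rewrite inE => /andP[aA aB] nt; exists a; rewrite ?inE ?aA // eq_sym.
    by rewrite (noarc (a, b)) /= andbF.
  have [a aAB _] := one v0; have [b bAB nab] := one a.
  move: aAB bAB; rewrite !inE => /andP[aA aB] /andP[bA bB].
  exists [:: a], [:: b]; rewrite /= aA aB bA bB; split=> //.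
  by rewrite inE eq_sym nab.
pose e' u v := e u v && ((u, v) != (x, y)).
have se : subrel e' e by move=> u v /andP[].
have len' : #|[set a : V * V | e' a.1 a.2]| < n.
  apply: leq_trans _ len; apply: proper_card; apply/properP; split.
    by apply/subsetP => -[u v]; rewrite !inE /= => /se.
  by exists (x, y); rewrite !inE /e' ?eqxx ?andbF.
have [/forallP h|/forallPn[t nt]] := boolP [forall t, linkable e' A B t].
  have [P [Q [lP lQ uPQ]]] := IH e' A B len' h.
  by exists P, Q; split=> //; [apply: (link_subr se lP) | apply: (link_subr se lQ)].
have nlink s : link e' A B s -> t \in s.
  by move=> ls; apply: contraNT nt => ts; apply/linkableP; exists s.
have nexy s : link e A B s -> (x \notin s) || (y \notin s) -> link e' A B s.
  case: s => //= a s /and3P[-> ps ->] h; rewrite andbT /=; apply: path_avoid_arc ps.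
  case/orP: h => h; apply/orP; [left|right]; first by apply: contra h => /mem_belast.
  by move: h; rewrite in_cons negb_or => /andP[].
(* A link avoiding [w] is followed to its first vertex in [{t, x}]; up to there it cannot use the
   deleted arc, which leaves [x]. A link missing both vertices would survive the deletion and avoid
   [t]. The next claim is dual. *)
have c1 w : linkable e' A [set t; x] w.
  have /linkableP[s ls ws] := lnk w; apply/linkableP.
  have [|/hasPn no] := boolP (has (mem [set t; x]) s).
    case/split_first=> s1 [q [s2 [es qtx n1]]]; rewrite es in ls ws.
    exists (rcons s1 q); last first.
      by apply: contra ws; rewrite -cat_rcons mem_cat => ->.
    have := link_prefix ls.
    have xs1 : x \notin s1.
      by apply/negP => h; case/hasP: n1; exists x; rewrite //= !inE eqxx orbT.
    have {}qtx : q \in [set t; x] by [].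
    case: (s1) xs1 => [|a s3] /= xs1; first by case/andP=> -> _.
    case/and3P=> -> pp _.
    rewrite last_rcons qtx andbT; apply: path_avoid_arc pp.
    by rewrite belast_rcons xs1.
  have := nlink s (nexy s ls _); case: (boolP (x \in s)) => [/no|_].
    by rewrite /= !inE eqxx orbT.
  by move=> /(_ isT) /no; rewrite /= !inE eqxx.
have c2 w : linkable e' [set t; y] B w.
  have /linkableP[s ls ws] := lnk w; apply/linkableP.
  have [|/hasPn no] := boolP (has (mem [set t; y]) s).
    case/split_last=> s1 [q [s2 [es qty n2]]]; rewrite es in ls ws.
    exists (q :: s2); last by apply: contra ws; rewrite mem_cat orbC => ->.
    have {}qty : q \in [set t; y] by [].
    have /= /and3P[_ pp ->] := link_suffix ls; rewrite qty andbT.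
    apply: path_avoid_arc pp; apply/orP; right.
    by apply/negP => h; case/hasP: n2; exists y; rewrite //= !inE eqxx orbT.
  have := nlink s (nexy s ls _); case: (boolP (y \in s)) => [/no|_].
    by rewrite /= !inE eqxx orbT.
  by rewrite orbT => /(_ isT) /no; rewrite /= !inE eqxx.
have [p1 [q1 [lp1 lq1 u1]]] : exists p1 q1, [/\ link e' A [set t] (rcons p1 t),
    link e' A [set x] (rcons q1 x) & uniq (rcons p1 t ++ rcons q1 x)].
  have [P [Q [lP lQ uPQ]]] := IH e' _ _ len' c1.
  have endP s : link e' A [set t; x] s -> exists s' z, [/\ s = rcons s' z,
      z \in [set t; x] & link e' A [set z] (rcons s' z)].
    case/lastP: s => // s z ls; exists s, z; split=> //.
      by case: s ls => [|a s] /= => [/andP[]|/and3P[_ _]]; rewrite ?last_rcons.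
    by apply: (@link_prefix e' A [set t; x] s z [::]); rewrite cats1.
  have [P' [z [eP zt lP']]] := endP _ lP; have [Q' [z' [eQ zt' lQ']]] := endP _ lQ.
  rewrite {}eP {}eQ {lP lQ} in uPQ.
  have nzz : z != z'.
    move: uPQ; rewrite cat_uniq => /and3P[_ /hasPn h _].
    have := h z'; rewrite mem_rcons mem_head => /(_ isT) /=.
    by apply: contraNneq => ->; rewrite mem_rcons mem_head.
  move: zt zt'; rewrite !inE => /orP[]/eqP ez /orP[]/eqP ez'; subst z z'.
  - by rewrite eqxx in nzz.
  - by exists P', Q'.
  - by exists Q', P'; rewrite uniq_catC.
  by rewrite eqxx in nzz.
have [p2 [q2 [lp2 lq2 u2]]] : exists p2 q2, [/\ link e' [set t] B (t :: p2),
    link e' [set y] B (y :: q2) & uniq ((t :: p2) ++ (y :: q2))].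
  have [P [Q [lP lQ uPQ]]] := IH e' _ _ len' c2.
  have endP s : link e' [set t; y] B s -> exists s' z, [/\ s = z :: s',
      z \in [set t; y] & link e' [set z] B (z :: s')].
    case: s => // z s ls; exists s, z; split=> //; first by case/and3P: ls.
    exact: (@link_suffix e' [set t; y] B [::] z s).
  have [P' [z [eP zt lP']]] := endP _ lP; have [Q' [z' [eQ zt' lQ']]] := endP _ lQ.
  rewrite {}eP {}eQ {lP lQ} in uPQ.
  have nzz : z != z'.
    move: uPQ; rewrite cat_uniq => /and3P[_ /hasPn h _].
    have := h z'; rewrite mem_head => /(_ isT) /=.
    by apply: contraNneq => ->; rewrite mem_head.
  move: zt zt'; rewrite !inE => /orP[]/eqP ez /orP[]/eqP ez'; subst z z'.
  - by rewrite eqxx in nzz.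
  - by exists P', Q'.
  - by exists Q', P'; rewrite uniq_catC.
  by rewrite eqxx in nzz.
(* A common vertex would give a link avoiding [t] and the deleted arc. *)
have cross w s1 s2 : link e' A [set w] (rcons s1 w) -> t \notin rcons s1 w ->
    link e' [set w] B (w :: s2) -> t \notin w :: s2 -> False.
  move=> l1 n1 l2 n2; have := nlink _ (link_cat l1 l2).
  move: n1; rewrite mem_cat mem_rcons in_cons negb_or => /andP[_ /negbTE ->].
  by rewrite (negbTE n2).
have left1 w : w \in p1 ++ rcons q1 x ->
    exists2 s1, link e' A [set w] (rcons s1 w) & t \notin rcons s1 w.
  rewrite mem_cat => /orP[wp|wq].
    case/splitPr: wp => s1 s2 in lp1 u1.
    exists s1; first by move: lp1; rewrite rcons_cat => /link_prefix.
    move: u1; rewrite cat_uniq rcons_uniq -cat_rcons mem_cat negb_or.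
    by case/and3P=> /andP[/andP[]].
  have tq : t \notin rcons q1 x.
    move: u1; rewrite cat_uniq => /and3P[_ /hasPn h _]; apply/negP => /h.
    by rewrite /= mem_rcons mem_head.
  case/splitPr: wq => s1 s2 in lq1 tq; exists s1; first exact: link_prefix lq1.
  by move: tq; rewrite -cat_rcons mem_cat negb_or => /andP[].
have right1 w : w \in p2 ++ y :: q2 ->
    exists2 s2, link e' [set w] B (w :: s2) & t \notin w :: s2.
  rewrite mem_cat => /orP[wp|wq].
    case/splitPr: wp => s1 s2 in lp2 u2.
    exists s2; first by move: lp2; rewrite -cat_cons => /link_suffix.
    move: u2; rewrite cat_uniq cons_uniq mem_cat negb_or.
    by case/and3P=> /andP[/andP[]].
  have tq : t \notin y :: q2.
    move: u2; rewrite cat_uniq => /and3P[_ /hasPn h _]; apply/negP => /h.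
    by rewrite /= mem_head.
  case/splitPr: wq => s1 s2 in lq2 tq; exists s2; first exact: link_suffix lq2.
  by move: tq; rewrite mem_cat negb_or => /andP[].
have tl : t \notin p1 ++ rcons q1 x.
  by apply/negP => /left1[s1 _]; rewrite mem_rcons mem_head.
have tr : t \notin p2 ++ y :: q2.
  by apply/negP => /right1[s1 _]; rewrite mem_head.
exists (p1 ++ t :: p2), (q1 ++ x :: y :: q2); split.
- exact: link_subr se (link_cat lp1 lp2).
- apply: link_cat.
    exact: link_subr se lq1.
  have /= /and3P[_ pp lB] := link_subr se lq2.
  by rewrite /= inE eqxx exy pp.
rewrite (perm_uniq (s2 := t :: (p1 ++ rcons q1 x) ++ (p2 ++ y :: q2))).
  rewrite cons_uniq mem_cat negb_or tl tr /=; apply: uniq_catI.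
  - by move: u1; rewrite -cats1 -catA cat_uniq => /and3P[u h1 /= /andP[_ u']];
      rewrite cat_uniq u u' andbT; apply: contra h1 => /hasP[z zz zp];
      apply/hasP; exists z; rewrite //= in_cons zz orbT.
  - by move: u2; rewrite cat_cons cons_uniq => /andP[].
  move=> w /left1[s1 l1 n1]; apply/negP => /right1[s2 l2 n2].
  exact: cross l1 n1 l2 n2.
rewrite -cats1; perm_count.
Qed.
End Menger.

(** * Gates *)

Section Gates.
Variables (V : finType) (e : rel V).
Implicit Types (X C : {set V}).

Definition minus (d : V) : rel V := restr e [set~ d].

Definition scomp (d x : V) : {set V} :=
  [set y | [&& y != d, connect (minus d) x y & connect (minus d) y x]].

Definition strongb X := [forall x in X, [forall y in X, connect (restr e X) x y]].

Lemma strongbP X : reflect (induces_connected e X) (strongb X).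
Proof.
apply: (iffP forall_inP) => [h x y xX yX|h x xX].
  by have /forall_inP/(_ y yX) := h x xX.
by apply/forall_inP => y; apply: h.
Qed.

Definition gate d C t :=
  forall X, induces_connected e X -> d \in X -> ~~ [disjoint C & X] -> t \in X.

Lemma connect_restrS X (Y : {set V}) x y : {subset X <= Y} ->
  connect (restr e X) x y -> connect (restr e Y) x y.
Proof.
move=> sub; apply: connect_sub => a b /and3P[ab aX bX]; apply: connect1.
by rewrite /restr ab !sub.
Qed.

Lemma scomp_neq d x y : y \in scomp d x -> y != d.
Proof. by rewrite inE => /and3P[]. Qed.

Lemma scomp_connect d x : {in scomp d x &, forall y z, connect (minus d) y z}.
Proof.
move=> y z; rewrite !inE => /and3P[_ _ yx] /and3P[_ xz _].
exact: connect_trans yx xz.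
Qed.

Lemma scomp_mid d x y z w : y \in scomp d x -> z \in scomp d x ->
  connect (minus d) y w -> connect (minus d) w z -> w != d -> w \in scomp d x.
Proof.
rewrite !inE => /and3P[_ xy yx] /and3P[_ xz zx] yw wz ->.
by rewrite (connect_trans xy yw) (connect_trans wz zx).
Qed.

Lemma scomp_path d x y s : y \in scomp d x -> last y s \in scomp d x ->
  path e y s -> {subset s <= [set~ d]} -> {subset s <= scomp d x}.
Proof.
move=> yC lC ps sd w ws; have yd := scomp_neq yC.
have sub : {subset y :: s <= [set~ d]}.
  by move=> v; rewrite in_cons => /orP[/eqP -> | /sd //]; rewrite !inE.
have wd : w != d by have := sd _ ws; rewrite !inE.
apply: (scomp_mid yC lC) => //.
  by apply: path_connect_sub ps sub _ _; rewrite in_cons ws orbT.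
case/splitPr: ws => s1 s2 in ps sub lC *.
move: ps; rewrite cat_path last_cat /= => /and3P[_ _ ps].
by apply: path_connect_restr ps _ => v vs; apply: sub; rewrite in_cons mem_cat vs !orbT.
Qed.

Lemma scomp_strong d x : induces_connected e (scomp d x).
Proof.
move=> y z yC zC; have cyz := scomp_connect yC zC.
have yd : y \in [set~ d] by rewrite !inE (scomp_neq yC).
have [s [ps sub lz]] := connect_restr_path yd cyz.
have sC : {subset s <= scomp d x}.
  apply: scomp_path yC _ ps _; first by rewrite -lz.
  by move=> w ws; apply: sub; rewrite in_cons ws orbT.
rewrite lz; apply: path_connect_restr ps _ => w.
by rewrite in_cons => /orP[/eqP -> | /sC].
Qed.

Lemma scomp_max d x X : induces_connected e X -> d \notin X ->
  ~~ [disjoint scomp d x & X] -> {subset X <= scomp d x}.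
Proof.
move=> cX dX /pred0Pn[y /andP[/= yC yX]] z zX.
have sub : {subset X <= [set~ d]}.
  by move=> w wX; rewrite !inE; apply: contraNneq dX => <-.
have cm a b : a \in X -> b \in X -> connect (minus d) a b.
  by move=> aX bX; apply: connect_restrS sub _; apply: cX.
by apply: (scomp_mid yC yC) (cm _ _ _ _) (cm _ _ _ _) _; rewrite // ?(scomp_neq yC);
  have := sub _ zX; rewrite !inE.
Qed.

Lemma scomp_self d x : x != d -> x \in scomp d x.
Proof. by move=> xd; rewrite inE xd !connect0. Qed.

Lemma reach_strong X x y : induces_connected e X -> x \in X -> y \in X ->
  x != y -> reach e X x y.
Proof.
move=> cX xX yX nxy; have [s [ps sX ls]] := connect_restr_path xX (cX x y xX yX).
case/lastP: s => [|s z] in ps sX ls *; first by rewrite ls eqxx in nxy.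
rewrite last_rcons in ls; subst z; exists s => // z zs.
by apply: sX; rewrite in_cons mem_rcons in_cons zs !orbT.
Qed.

(* [O] and [I] collect the vertices outside [C] on paths from [d] to [C] and from
   [C] to [d]; they are disjoint since [C] is a strong component. *)
Lemma scomp_gateless_obst d x : x != d ->
  (forall t, t \in scomp d x -> ~ gate d (scomp d x) t) -> has_obst e.
Proof.
move=> xd nogate; set C := scomp d x.
have xC : x \in C := scomp_self xd.
have dC : d \notin C by apply/negP => /scomp_neq; rewrite eqxx.
pose Up := [set w | [&& w != d, w \notin C & connect (minus d) w x]].
pose Dn := [set w | [&& w != d, w \notin C & connect (minus d) x w]].
pose O := [set w in Up | connect (fun a b => e a b && (b \in Up)) d w].
pose I := [set w in Dn | connect (fun a b => e a b && (a \in Dn)) w d].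
pose k w := if w \in I :|: O then d else w.
have UD w : w \in Up -> w \in Dn -> False.
  rewrite !inE => /and3P[wd wC wx] /and3P[_ _ xw].
  by move: wC; rewrite wd xw wx.
have IDn w : w \in I -> w \in Dn by rewrite inE => /andP[].
have OUp w : w \in O -> w \in Up by rewrite inE => /andP[].
have dO : d \notin O by apply/negP => /OUp; rewrite inE eqxx.
have dI : d \notin I by apply/negP => /IDn; rewrite inE eqxx.
have kd : k d = d by rewrite /k; case: ifP.
have kI w : w \in I -> k w = d by rewrite /k in_setU => ->.
have kO w : w \in O -> k w = d by rewrite /k in_setU => ->; rewrite orbT.
have CI w : w \in C -> w \notin I.
  by move=> wC; apply/negP => /IDn; rewrite inE wC andbF.
have CO w : w \in C -> w \notin O.
  by move=> wC; apply/negP => /OUp; rewrite inE wC andbF.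
have kC w : w \in C -> k w = w.
  by move=> wC; rewrite /k in_setU (negbTE (CI w wC)) (negbTE (CO w wC)).
have contr : contraction e I O k.
  split.
  - by move=> w /IDn wD; apply/negP => /OUp wU; exact: UD wU wD.
  - by move=> w wI wO; rewrite /k in_setU (negbTE wI) (negbTE wO).
  - move=> w; rewrite /k; case: ifP => [_|]; first by rewrite dI dO.
    by rewrite in_setU => /negbT; rewrite negb_or.
  - move=> w wI; rewrite (kI w wI); move: (wI); rewrite inE => /andP[_ /connectP[s]].
    elim: s w wI => [|b s IH] w wI /=; first by move=> _ ->; rewrite connect0.
    case/andP=> /andP[wb wD] ps ls.
    have [bI|bd] : b \in I \/ b = d.
      case: s {IH} ps ls => [_ /= ->|c s]; first by right.
      move=> ps ls; left; rewrite inE; have /andP[/andP[_ ->] _] := ps.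
      by apply/connectP; exists (c :: s).
      apply: connect_trans (IH b bI ps ls); apply: connect1.
      by rewrite /in_rel wb wI (kI _ wI) (kI _ bI) eqxx.
    by rewrite bd in wb *; apply: connect1; rewrite /in_rel wb wI kd (kI _ wI) eqxx.
  move=> w wO; rewrite (kO w wO); move: (wO); rewrite inE => /andP[_ /connectP[s]].
  elim/last_ind: s w wO => [|s b IH] w wO; first by move=> _ ->; rewrite connect0.
  rewrite rcons_path last_rcons => /andP[ps /andP[wb wD]] ew; subst b.
  case/lastP: s => [|s c] in IH ps wb *.
    by apply: connect1; rewrite /= in wb; rewrite /out_rel wb wO kd (kO _ wO) eqxx.
  rewrite last_rcons in wb.
  have cO : c \in O.
    rewrite inE; move: (ps); rewrite rcons_path => /andP[_ /andP[_ ->]] /=.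
    by apply/connectP; exists (rcons s c); rewrite ?last_rcons.
  apply: connect_trans (IH c cO ps _) _; first by rewrite last_rcons.
  by apply: connect1; rewrite /out_rel wb wO (kO _ wO) (kO _ cO) eqxx.
apply: (has_obst_contraction contr); set e' := minor_rel e I O k.
have e'C : {in C &, forall u v, e u v -> e' u v}.
  move=> u v uC vC uv; rewrite -(kC u uC) -(kC v vC).
  by apply: minor_relI; rewrite ?CI ?CO.
have C' X : {subset X <= C} -> subrel (restr e X) (restr e' X).
  by move=> sub u v /and3P[uv uX vX]; rewrite /restr uX vX e'C ?sub.
pose A := [set a in C | e' d a]; pose B := [set b in C | e' b d].
(* On a path from [d] to [s] inside [X], the inner vertices before the first one in [C] belong to
   [O] and are contracted into [d]. From there on the path avoids [d] and ends in [C], hence stays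
   in [C]. *)
have entry X s : d \in X -> s \in X -> s \in C -> induces_connected e X ->
    exists2 a, a \in A :&: X & connect (restr e (C :&: X)) a s.
  move=> dX sX sC cX; have nds : d != s by apply: contraNneq dC => ->.
  have [p [pp pX up]] := reach_uniq (reach_strong cX dX sX nds) nds.
  have rds : reach e (X :\ d) d s.
    exists p => // w wp; rewrite in_setD1 pX // andbT.
    by move: up; rewrite cons_uniq mem_rcons in_cons negb_or => /andP[/andP[_ h] _];
      apply: contraNneq h => <-.
  have sXd : s \in X :\ d by rewrite in_setD1 eq_sym nds.
  have [a aC [[q pq qX] cas]] := reach_first (P := fun v => v \in C) sC sXd rds.
  have aXd : a \in X :\ d.
    have /connectP[[|b r] /= pr lr] := cas; first by rewrite -lr.
    by case/andP: pr => /and3P[].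
  have {aXd} [aX ad] : a \in X /\ a != d by move: aXd; rewrite in_setD1 => /andP[].
  have qUp : {subset q <= Up}.
    move=> w wq; have /setIdP[/setD1P[wd _] wC] := qX w wq; rewrite inE wd wC /=.
    have cax : connect (minus d) a x := scomp_connect aC xC.
    apply: (connect_trans _ cax); case/splitPr: wq => q1 q2 in pq qX *.
    have [_ p2] := path_unjoin pq; apply: path_connect_in p2 _ _ _; rewrite ?inE //.
    move=> v vq; have := qX v; rewrite mem_cat in_cons vq !orbT.
    by move=> /(_ isT)/setIdP[/setD1P[vd _] _]; rewrite !inE.
  have e'da : e' d a.
    have [pq1 lq] := path_rconsW pq.
    suff [oi ok] : last d q \notin I /\ k (last d q) = d.
      by rewrite -{1}ok -(kC a aC); apply: minor_relI; rewrite ?CO.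
    case/lastP: q => [|q w] in pq1 lq qUp {pq qX} *; first by [].
    rewrite last_rcons; have wO : w \in O.
      rewrite inE qUp ?mem_rcons ?mem_head //=.
      have wq : w \in rcons q w by rewrite mem_rcons mem_head.
      apply: connect_sub (branch_out pq1 wq) => u v /andP[uv /qUp vU].
      by apply: connect1; rewrite uv.
    by rewrite kO //; split=> //; apply/negP => /IDn wD; apply: UD wD; apply: OUp.
  exists a; first by rewrite in_setI aX inE e'da !andbT.
  have aXd : a \in X :\ d by rewrite in_setD1 ad.
  have [r [pr rX lr]] := connect_restr_path aXd cas.
  have rC : {subset r <= C}.
    apply: scomp_path aC _ pr _; first by rewrite -lr.
    by move=> w wr; have := rX w; rewrite in_cons wr orbT !inE => /(_ isT) /andP[].
  rewrite lr; apply: path_connect_restr pr _ => w; rewrite in_cons in_setI => wr.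
  have := rX w; rewrite in_cons wr in_setD1 => /(_ isT) /andP[_ ->]; rewrite andbT.
  by case/orP: wr => [/eqP -> | /rC].
have exit X s : d \in X -> s \in X -> s \in C -> induces_connected e X ->
    exists2 b, b \in B :&: X & connect (restr e (C :&: X)) s b.
  move=> dX sX sC cX; have nsd : s != d by apply: contraNneq dC => <-.
  have [p [pp pX up]] := reach_uniq (reach_strong cX sX dX nsd) nsd.
  have rsd : reach e (X :\ d) s d.
    exists p => // w wp; rewrite in_setD1 pX // andbT.
    by move: up; rewrite -rcons_cons rcons_uniq in_cons negb_or => /andP[/andP[_ h] _];
      apply: contraNneq h => <-.
  have sXd : s \in X :\ d by rewrite in_setD1 nsd.
  have [b bC [[q pq qX] csb]] := reach_last (P := fun v => v \in C) sC sXd rsd.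
  have [r [pr rX lr]] := connect_restr_path sXd csb.
  have bXd : b \in X :\ d by rewrite lr rX ?mem_last.
  have {bXd} [bX bd] : b \in X /\ b != d by move: bXd; rewrite in_setD1 => /andP[].
  have qDn : {subset q <= Dn}.
    move=> w wq; have /setIdP[/setD1P[wd _] wC] := qX w wq; rewrite inE wd wC /=.
    have cxb : connect (minus d) x b := scomp_connect xC bC.
    apply: (connect_trans cxb); case/splitPr: wq => q1 q2 in pq qX *.
    have [p1 _] := path_unjoin pq; apply: path_connect_in p1 _ _ _; rewrite ?inE //.
    move=> v vq; have := qX v; rewrite mem_cat vq.
    by move=> /(_ isT)/setIdP[/setD1P[vd _] _]; rewrite !inE.
  have e'bd : e' b d.
    have [h hq bh] := path_first pq.
    suff [oi ok] : h \notin O /\ k h = d.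
      by rewrite -{1}ok -(kC b bC); apply: minor_relI; rewrite ?CI.
    move: hq; rewrite in_cons => /orP[/eqP -> //|hq].
    have hI : h \in I.
      rewrite inE qDn //=; have := branch_in (path_sorted_rcons pq) hq.
      apply: connect_sub => u v /andP[uv /qDn vU].
      by apply: connect1; rewrite uv.
    by rewrite kI //; split=> //; apply/negP => /OUp hU; apply: UD hU _; apply: IDn.
  exists b; first by rewrite in_setI bX inE e'bd !andbT.
  have rC : {subset r <= C}.
    apply: scomp_path sC _ pr _; first by rewrite -lr.
    by move=> w wr; have := rX w; rewrite in_cons wr orbT !inE => /(_ isT) /andP[].
  rewrite lr; apply: path_connect_restr pr _ => w; rewrite in_cons in_setI => wr.
  have := rX w; rewrite in_cons wr in_setD1 => /(_ isT) /andP[_ ->]; rewrite andbT.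
  by case/orP: wr => [/eqP -> | /rC].
(* A strong set showing that [t] is not a gate contains a link that avoids [t]. If [t] lies outside
   [C], every link inside [C] avoids it, and the set is taken for [x] instead. *)
have lnk t : linkable (restr e' C) A B t.
  have [t' [t'C et']] : exists t', t' \in C /\ (t \in C -> t' = t).
    by case: (boolP (t \in C)) => tC; [exists t | exists x].
  have [X [cX dX /pred0Pn[s /andP[/= sC sX]] t'X]] : exists X,
      [/\ induces_connected e X, d \in X, ~~ [disjoint C & X] & t' \notin X].
    have [/forallP h|] := boolP [forall X, [&& strongb X, d \in X &
        ~~ [disjoint C & X]] ==> (t' \in X)].
      by case: (nogate t' t'C) => X /strongbP cX dX CX; have := h X; rewrite cX dX CX.
    by rewrite negb_forall => /existsP[X]; rewrite negb_imply => /andP[/and3P[/strongbP ? ? ?] ?];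
      exists X.
  have [a aA ca] := entry X s dX sX sC cX; have [b bB cb] := exit X s dX sX sC cX.
  have nt : t \notin C :&: X.
    by rewrite inE; apply/negP => /andP[tC]; rewrite -(et' tC) (negbTE t'X).
  move: aA bB; rewrite !in_setI => /andP[aA aX] /andP[bB bX].
  have aC : a \in C by move: aA; rewrite inE => /andP[].
  have bC : b \in C by move: bB; rewrite inE => /andP[].
  apply/exists_inP; exists a => //; apply/exists_inP; exists b => //.
  apply/and3P; split.
  - by apply: contraNneq nt => <-; rewrite inE aC.
  - by apply: contraNneq nt => <-; rewrite inE bC.
  apply: connect_sub (connect_trans ca cb) => u v uv; apply: connect1.
  have /and3P[uv' uX vX] := C' _ (fun z zC => subsetP (subsetIl C X) z zC) _ _ uv.
  move: (uX) (vX); rewrite !in_setI => /andP[uC _] /andP[vC _].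
  rewrite /restr uv' uC vC !inE.
  by rewrite /=; apply/andP; split; apply: contraNneq nt => <-.
have [P [Q [lP lQ uPQ]]] := menger2 x lnk.
have linkC s : link (restr e' C) A B s -> [/\ s != [::], {subset s <= C}
    & path e' d (rcons s d)].
  case: s => //= a s /and3P[/setIdP[aC da] ps /setIdP[lC ld]].
  split=> //; last first.
    rewrite da rcons_path ld andbT /=.
    by apply: (sub_path _ ps) => u v /and3P[].
  elim: s a aC {da ld lC} ps => [|b s IH] a aC /=.
    by move=> _ z; rewrite inE => /eqP ->.
  case/andP=> /and3P[_ _ bC] ps z; rewrite in_cons => /orP[/eqP -> //|].
  exact: IH bC ps z.
have [P0 PC pP] := linkC P lP; have [Q0 QC pQ] := linkC Q lQ.
apply: (@two_cycles_obst _ e' C d P Q) => //.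
  move=> y z yC zC; apply: connect_sub (scomp_strong yC zC) => u v uv.
  exact: connect1 (C' C (fun _ h => h) _ _ uv).
by move=> z; rewrite mem_cat => /orP[/PC|/QC].
Qed.

End Gates.

(** * The tree of gates *)

Section GateTree.
Variables (V : finType) (e : rel V).
Hypothesis gates : forall d x, x != d ->
  exists2 t, t \in scomp e d x & gate e d (scomp e d x) t.
Implicit Types (S C X : {set V}).

(* [par] is the parent function of a tree on [S] rooted at [t], and [B x] is
   the set of descendants of [x]. *)
Definition gate_tree S t (par : V -> V) (B : V -> {set V}) :=
  [/\ B t = S,
      forall x, x \in S -> x != t -> [/\ par x \in S, x \in B x,
        gate e (par x) (B x) x, B x \subset B (par x) &
        exists2 y, y != par x & B x = scomp e (par x) y]
    & forall x y, x \in S -> y \in B x -> y != x ->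
        exists c, [/\ c \in S, c != t, par c = x & y \in B c]].

Lemma scomp_eq d x y : y \in scomp e d x -> scomp e d y = scomp e d x.
Proof.
rewrite inE => /and3P[_ xy yx]; apply/setP => z; rewrite !inE; congr (_ && _).
by apply/andP/andP => -[h1 h2]; split; apply: connect_trans; eassumption.
Qed.

Lemma scomp_sub_gate d x t y : t \in scomp e d x -> gate e d (scomp e d x) t ->
  y \in scomp e d x -> y != t -> scomp e t y \subset scomp e d x.
Proof.
move=> tC gt yC yt; apply/subsetP.
have yS := scomp_self e yt.
have dis : ~~ [disjoint scomp e d x & scomp e t y].
  by apply/pred0Pn; exists y; rewrite /= yC yS.
apply: (scomp_max _ _ dis); first exact: scomp_strong.
apply/negP => dS; have := gt _ (@scomp_strong _ e t y) dS dis.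
by move/scomp_neq; rewrite eqxx.
Qed.

Lemma gate_tree_exists S t : t \in S ->
  (forall x, x \in S -> x != t -> scomp e t x \subset S) ->
  exists par B, gate_tree S t par B.
Proof.
have [n] := ubnP #|S|; elim: n S t => // n IH S t leS tS subS.
(* Gate and subtree are chosen per component and not per vertex, so that all vertices of a component
   refer to the same subtree. The value at other sets is a dummy. *)
have /fin_all_exists[r Hr] : forall C : {set V}, exists r : V * (V -> V) * (V -> {set V}),
    (exists x, [/\ x \in S, x != t & C = scomp e t x]) ->
    [/\ r.1.1 \in C, gate e t C r.1.1 & gate_tree C r.1.1 r.1.2 r.2].
  move=> C; have [/existsP[x /and3P[xS xt /eqP eC]]|no] :=
      boolP [exists x, [&& x \in S, x != t & C == scomp e t x]]; last first.
    exists (t, id, fun => S) => -[x [xS xt eC]]; case/negP: no.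
    by apply/existsP; exists x; rewrite xS xt eC eqxx.
  have [c cC gc] := gates xt; rewrite -eC in cC gc.
  have [||par [B tr]] := IH C c _ cC.
  - apply: leq_trans (proper_card _) leS; apply/properP; split.
      by rewrite eC; apply: subS.
    by exists t => //; rewrite eC; apply/negP => /scomp_neq; rewrite eqxx.
  - by move=> y yC yc; rewrite eC in cC gc yC *; apply: scomp_sub_gate.
  by exists (c, par, B).
pose K x := scomp e t x.
have HK x : x \in S -> x != t -> [/\ (r (K x)).1.1 \in K x, gate e t (K x) (r (K x)).1.1
    & gate_tree (K x) (r (K x)).1.1 (r (K x)).1.2 (r (K x)).2].
  by move=> xS xt; apply: Hr; exists x.
have KS x y : x \in S -> x != t -> y \in K x -> [/\ y \in S, y != t & K y = K x].
  move=> xS xt yK; split; last exact: scomp_eq.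
    exact: subsetP (subS x xS xt) _ yK.
  exact: scomp_neq yK.
pose par x := if x == (r (K x)).1.1 then t else (r (K x)).1.2 x.
pose B x := if x == t then S else (r (K x)).2 x.
exists par, B; split.
- by rewrite /B eqxx.
- move=> x xS xt; rewrite /par /B (negbTE xt).
  have [rK gK [trB trx _]] := HK x xS xt; have xK : x \in K x := scomp_self e xt.
  case: (eqVneq x (r (K x)).1.1) => [ex|nx].
    rewrite -ex in trB gK; rewrite trB eqxx; split=> //; first exact: subS.
    by exists x.
  have [pK xB gB sB [y yp eB]] := trx x xK nx.
  have [pS pt pKe] := KS _ _ xS xt pK.
  by rewrite (negbTE pt) pKe; split=> //; exists y.
move=> x y xS; rewrite {1}/B; case: (eqVneq x t) => [-> yS yt|xt yB yx].
  have [rK gK [trB trx _]] := HK y yS yt; have yK : y \in K y := scomp_self e yt.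
  set c := (r (K y)).1.1 in rK gK trB trx *.
  have [cS ct cK] := KS _ _ yS yt rK.
  by exists c; rewrite /par /B (negbTE ct) cK eqxx; split=> //; rewrite trB.
have [rK gK [trB trx trc]] := HK x xS xt; have xK : x \in K x := scomp_self e xt.
have [c [cK cr pc yc]] := trc x y xK yB yx.
have [cS ct cKx] := KS _ _ xS xt cK.
by exists c; rewrite /par /B (negbTE ct) cKx (negbTE cr).
Qed.

End GateTree.

Section GateTreeTheory.
Variables (V : finType) (e : rel V) (r : V) (par : V -> V) (B : V -> {set V}).
Hypothesis tr : gate_tree e [set: V] r par B.
Implicit Types (X : {set V}).

Definition par_rel : rel V := fun d x => (x != r) && (par x == d).
Definition par_sym : rel V := fun x y => par_rel x y || par_rel y x.

Lemma mem_desc x : x \in B x.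
Proof.
have [Br Bx _] := tr; case: (eqVneq x r) => [->|xr]; first by rewrite Br inE.
by have [] := Bx x (in_setT x) xr.
Qed.

Lemma desc_scomp x : x != r -> exists2 y, y != par x & B x = scomp e (par x) y.
Proof. by move=> xr; have [_ Bx _] := tr; have [] := Bx x (in_setT x) xr. Qed.

Lemma desc_proper d x : par_rel d x -> B x \proper B d.
Proof.
case/andP=> xr /eqP <-; have [_ Bx _] := tr.
have [_ _ _ sB [y _ eB]] := Bx x (in_setT x) xr.
apply/properP; split=> //; exists (par x); first exact: mem_desc.
by rewrite eB; apply/negP => /scomp_neq; rewrite eqxx.
Qed.

Lemma desc_connect t x : connect par_rel t x = (x \in B t).
Proof.
apply/idP/idP.
  case/connectP=> p; elim: p t => [|y p IH] t /=; first by move=> _ ->; apply: mem_desc.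
  case/andP=> ty pp lp; exact: subsetP (proper_sub (desc_proper ty)) _ (IH y pp lp).
have [n] := ubnP #|B t|; elim: n t => // n IH t leB xB.
case: (eqVneq x t) => [->|xt]; first exact: connect0.
have [_ _ Bc] := tr; have [c [_ cr pc xc]] := Bc t x (in_setT t) xB xt.
have tc : par_rel t c by rewrite /par_rel cr pc eqxx.
apply: connect_trans (connect1 tc) (IH c _ xc).
exact: leq_trans (proper_card (desc_proper tc)) leB.
Qed.

Lemma par_symC : symmetric par_sym.
Proof. by move=> x y; rewrite /par_sym orbC. Qed.

Lemma par_rel_asym x y : par_rel x y -> ~~ par_rel y x.
Proof.
move=> xy; apply/negP => yx; have := proper_trans (desc_proper xy) (desc_proper yx).
by rewrite properxx.
Qed.

(** A vertex with the fewest descendants on a cycle has no child there, so its two neighbours on the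
    cycle would both be its parent. *)
Lemma par_tree : is_tree par_sym.
Proof.
have [Br _ _] := tr; split.
- by apply/card_gt0P; exists r.
- exact: par_symC.
- move=> x; apply/negbTE/negP; rewrite /par_sym orbb => xx.
  by have := desc_proper xx; rewrite properxx.
- have rx x : connect par_sym r x.
    have : connect par_rel r x by rewrite desc_connect Br inE.
    by apply: connect_sub => u v uv; apply: connect1; rewrite /par_sym uv.
  move=> x y; apply: connect_trans (rx y).
  by rewrite (sym_connect_sym par_symC).
move=> c uc; rewrite ltnNge; apply/negP => c3.
have [x0 x0c] : exists x, x \in c by case: c c3 {uc} => // x c _; exists x; rewrite mem_head.
have [x xc xmin] := @arg_minnP _ x0 (fun x => x \in c) (fun x => #|B x|) x0c.
have [i s es] := rot_to xc.
have : ucycle par_sym (rot i c) by rewrite rot_ucycle.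
have sz : size (rot i c) = size c := size_rot i c.
rewrite es /= in sz *; case: s es sz => [|y s] es sz; first by rewrite -sz in c3.
case/lastP: s es sz => [|s z] es sz; first by rewrite -sz in c3.
have memc u : u \in x :: y :: rcons s z -> u \in c by rewrite -es mem_rot.
have up u : u \in x :: y :: rcons s z -> par_sym x u -> par x = u.
  move=> /memc uc' /orP[xu|/andP[_ /eqP //]].
  by have := xmin u uc'; rewrite leqNgt (proper_card (desc_proper xu)).
case/andP=> /= /andP[xy]; rewrite rcons_path last_rcons => /andP[_ zx].
rewrite !inE !mem_rcons !inE !negb_or => /and3P[_ /andP[yz _] _].
have py : par x = y by apply: up xy; rewrite !in_cons eqxx orbT.
have pz : par x = z.
  by apply: up; [rewrite !in_cons mem_rcons mem_head !orbT | rewrite par_symC].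
by rewrite -py -pz eqxx in yz.
Qed.

Lemma par_arborescence : arborescence par_rel.
Proof.
have [Br _ _] := tr; split; [exact: par_rel_asym | exact: par_tree |].
exists r; split=> [t|r' hr]; first by rewrite desc_connect Br inE.
have /connectP[p] := hr r; case/lastP: p => [|p z] //=.
by rewrite rcons_path last_rcons => /andP[_ /andP[zr _]] rz; rewrite rz eqxx in zr.
Qed.

(** Let [B t] be a smallest set of descendants containing [X]. Then [t] is in [X]: otherwise [X]
    would lie in the component below a single child. Going down from [t] to a vertex of [X], each
    next vertex is the gate of a component that [X] meets while containing the parent, so it is in
    [X] too. *)
Lemma strong_par_connected X : induces_connected e X -> induces_connected par_sym X.
Proof.
move=> cX x y xX yX; have [Br Bx Bc] := tr.
have Pr : X \subset B r by rewrite Br subsetT.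
have [t Xt tmin] := @arg_minnP _ r (fun t => X \subset B t) (fun t => #|B t|) Pr.
have tX : t \in X.
  apply/negPn/negP => tX; have xt : x != t by apply: contraNneq tX => <-.
  have [c [_ cr pc xc]] := Bc t x (in_setT t) (subsetP Xt x xX) xt.
  have [z _ eB] := desc_scomp cr; rewrite pc in eB.
  have tc : par_rel t c by rewrite /par_rel cr pc eqxx.
  have Xc : X \subset B c.
    apply/subsetP; rewrite eB; apply: scomp_max => //.
    by apply/pred0Pn; exists x; rewrite /= -eB xc xX.
  by have := tmin c Xc; rewrite leqNgt (proper_card (desc_proper tc)).
have ct z : z \in X -> connect (restr par_sym X) t z.
  move=> zX; have : connect par_rel t z by rewrite desc_connect (subsetP Xt).
  case/connectP=> p; elim: p t tX {Xt tmin} => [|c p IH] t tX /=.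
    by move=> _ ->; apply: connect0.
  case/andP=> tc pp lz; have /andP[cr /eqP pc] := tc.
  have cX' : c \in X.
    have [_ _ gc _ _] := Bx c (in_setT c) cr; apply: gc => //; first by rewrite pc.
    apply/pred0Pn; exists z; rewrite /= zX andbT -desc_connect.
    by apply/connectP; exists p.
  apply: connect_trans (IH c cX' pp lz); apply: connect1.
  by rewrite /restr /par_sym tc tX cX'.
have sym : symmetric (restr par_sym X).
  by move=> u v; rewrite /restr par_symC; case: (u \in X); rewrite ?andbF // andbT.
by apply: connect_trans (ct y yX); rewrite (sym_connect_sym sym) ct.
Qed.

End GateTreeTheory.

(** * The decomposition read off a gate tree *)

(** The set below [t] is a strong component of the digraph without the parent of [t], so a walk that
    leaves it and returns passes through the parent. *)
Lemma gate_tree_decomposition (D : digraph) r par B :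
  gate_tree (@arc D) [set: D] r par B ->
  exists X : dir_tree_decomp D, dtd_width X <= 1.
Proof.
move=> tr; pose a := par_rel r par.
have below t : bag_below a (fun x => [set x]) t = B t.
  apply/setP => x; rewrite -(desc_connect tr); apply/bigcupP/idP.
    by case=> t' tt' /set1P ->.
  by move=> tx; exists x; rewrite ?set11.
have hn (t : D) : [set t] != set0 by apply/set0Pn; exists t; rewrite set11.
have hd (s t : D) : s != t -> [disjoint [set s] & [set t]].
  by move=> st; rewrite disjoints1 inE.
have hc : \bigcup_(t : D) [set t] = [set: D].
  by apply/setP => x; rewrite inE; apply/bigcupP; exists x; rewrite ?set11.
have hg d t : a d t -> guards [set d] (bag_below a (fun x : D => [set x]) t).
  rewrite below => /andP[tr' /eqP pt] x p pp xB lB [y yp yB].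
  have [/hasP[z zp /= /eqP zd]|/hasPn nod] := boolP (has (pred1 d) (x :: p)).
    by exists z; rewrite // zd set11.
  have [w _ eB] := desc_scomp tr tr'; rewrite pt in eB.
  case/negP: yB; move: yp; rewrite in_cons => /orP[/eqP -> //|yp].
  rewrite eB in xB lB *; apply: scomp_path xB lB pp _ _ yp => z zp.
  by rewrite !inE; apply: nod; rewrite in_cons zp orbT.
exists (DirTreeDecomp (dtd_gamma := fun d t => [set d]) (par_arborescence tr) hn hd hc hg).
rewrite /dtd_width -subn1 leq_subLR; apply/bigmax_leqP => t _.
(* At the root [par t] is an arbitrary vertex, which is harmless for an upper bound. *)
apply: leq_trans (_ : #|[set t; par t]| <= _); last by rewrite cards2; case: eqP.
apply/subset_leq_card/subsetP => x; rewrite /dtd_Gamma /= !inE.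
case/orP=> [/orP[->//|/bigcupP[s st /set1P ->]]|/bigcupP[s _ /set1P ->]].
  by have /andP[_ /eqP ->] := st; rewrite eqxx orbT.
by rewrite eqxx.
Qed.

(** * The Helly property of strong sets *)

Section Helly.
Variable V : finType.
Implicit Types (e : rel V) (A B C X : {set V}).

Definition non_helly e := exists A B C : {set V},
  [/\ induces_connected e A, induces_connected e B & induces_connected e C] /\
  [/\ ~~ [disjoint A & B], ~~ [disjoint B & C], ~~ [disjoint A & C]
    & [disjoint A :&: B & C]].

Definition cut_edge e (x y : V) : rel V := fun u v =>
  e u v && ~~ ((u == x) && (v == y) || (u == y) && (v == x)).

Lemma tree_bridge e x y : is_tree e -> e x y -> ~~ connect (cut_edge e x y) x y.
Proof.
move=> [_ sym irr _ nocyc] exy; apply/negP => /connectP[p pp lp].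
move: lp; case/shortenP: pp => q pq uq _ lq.
case/lastP: q => [|q z] in pq uq lq *.
  by rewrite /= in lq; rewrite lq irr in exy.
rewrite last_rcons in lq; subst z.
have pe : path e x (rcons q y) by apply: (sub_path _ pq) => u v /andP[].
have : ucycle e (x :: rcons q y).
  by rewrite /ucycle uq andbT /= rcons_path pe last_rcons sym.
move/nocyc; rewrite /= size_rcons; case: q {pe uq} pq => // + _.
by rewrite /= /cut_edge !eqxx andbF.
Qed.

Lemma connect_cut_edge e x y X u v : (x \notin X) || (y \notin X) ->
  connect (restr e X) u v -> connect (cut_edge e x y) u v.
Proof.
move=> xyX; apply: connect_sub => a b /and3P[ab aX bX]; apply: connect1.
rewrite /cut_edge ab negb_or !negb_and /=.
case/orP: xyX => h; apply/andP; split; apply/orP.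
- by left; apply: contraNneq h => <-.
- by right; apply: contraNneq h => <-.
- by right; apply: contraNneq h => <-.
by left; apply: contraNneq h => <-.
Qed.

(** A walk in [A] from a vertex of [B] to a vertex of [C] leaves [B] for the last time along an edge
    from [y] to [y']. If [y] is not in [C], then [B], [C] and the rest of the walk connect [y] to
    [y'] without using this edge, which a tree forbids. *)
Lemma tree_helly e A B C : is_tree e -> induces_connected e A ->
  induces_connected e B -> induces_connected e C ->
  ~~ [disjoint A & B] -> ~~ [disjoint B & C] -> ~~ [disjoint A & C] ->
  ~~ [disjoint A :&: B & C].
Proof.
move=> te cA cB cC /pred0Pn[c /andP[/= cA' cB']] /pred0Pn[a /andP[/= aB aC]].
move=> /pred0Pn[b /andP[/= bA bC]].
have [p [pp pA lp]] := connect_restr_path cA' (cA c b cA' bA).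
have /split_last[s1 [y [s2 [es yB ns2]]]] : has (mem B) (c :: p) by rewrite /= cB'.
have {}yB : y \in B by [].
have yA : y \in A by apply: pA; rewrite es mem_cat mem_head orbT.
have done_ : y \in C -> ~~ [disjoint A :&: B & C].
  by move=> yC; apply/pred0Pn; exists y; rewrite /= !inE yA yB yC.
case: s2 => [|y' s3] in es ns2 *.
  have yb : b = y by rewrite lp -[last c p]/(last c (c :: p)) es last_cat.
  by apply: done_; rewrite -yb.
case: (boolP (y \in C)) => // yC; have [_ sym _ _ _] := te.
have pyy : path e y (y' :: s3).
  have : sorted e (s1 ++ y :: y' :: s3) by rewrite -es.
  by case/cat_sorted2.
have [yy' p3] : e y y' /\ path e y' s3 by move: pyy => /= /andP.
have y'B : y' \notin B by move: ns2; rewrite /= negb_or => /andP[].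
have lb : b = last y' s3 by rewrite lp -[last c p]/(last c (c :: p)) es last_cat.
case/negP: (tree_bridge te yy'); apply: connect_trans (_ : connect _ y a) _.
  by apply: connect_cut_edge (cB y a yB aB); rewrite y'B orbT.
apply: connect_trans (_ : connect _ a b) _.
  by apply: connect_cut_edge (cC a b aC bC); rewrite yC.
have symc : symmetric (cut_edge e y y').
  by move=> u v; rewrite /cut_edge sym orbC (andbC (u == y')) (andbC (u == y)).
rewrite (sym_connect_sym symc) lb.
apply: (@connect_cut_edge _ _ _ [set~ y]); first by rewrite !inE eqxx.
apply: path_connect_restr p3 _ => z zs; rewrite !inE; apply: contraNneq ns2 => zy.
by apply/hasP; exists z; rewrite //= zy.
Qed.

Lemma strong_cycle e c : cycle e c -> induces_connected e [set x in c].
Proof.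
move=> cc x y; rewrite !inE => xc yc; have [i s es] := rot_to xc.
have : cycle e (rot i c) by rewrite rot_cycle.
have memc z : (z \in x :: s) = (z \in c) by rewrite -es mem_rot.
rewrite es /= rcons_path => /andP[ps _].
have sub : {subset x :: s <= [set z in c]} by move=> z; rewrite memc inE.
have ys : y \in x :: s by rewrite memc.
exact: (path_connect_sub ps sub ys).
Qed.

End Helly.

(** * Cycles, strong sets and the tree of a hypertree *)

Lemma dicycle_verts_strong (D : digraph) (C : dicycle D) :
  induces_connected (@arc D) (dicycle_verts C).
Proof.
case: C => A hA; have /is_dicycleP[c /and3P[_ _ cc] eA] := hA.
suff -> : dicycle_verts (exist _ A hA) = [set x in c] by apply: strong_cycle.
apply/setP => x; rewrite inE; apply/imsetP/idP => /= [[p]|xc].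
  by rewrite eA => /imsetP[y yc ->] ->.
by exists (x, next c x) => //; rewrite eA; apply/imsetP; exists x.
Qed.

(** An arc inside [X] closes up, with a path back inside [X], to a cycle whose vertices the tree
    connects. *)
Lemma strong_hypertree_connected (D : digraph) (e : rel D) (X : {set D}) :
  symmetric e ->
  (forall C : dicycle D, induces_connected e (dicycle_verts C)) ->
  induces_connected (@arc D) X -> induces_connected e X.
Proof.
move=> sym hC cX x y xX yX; apply: connect_sub (cX x y xX yX) => a b.
move=> /and3P[ab aX bX]; have nba : b != a by rewrite eq_sym; apply: arc_neq.
have [p [pp pX up]] := reach_uniq (reach_strong cX bX aX nba) nba.
pose c := b :: rcons p a.
have cc : cyclic_seq c by rewrite /cyclic_seq up /= rcons_path pp last_rcons ab.
have hA : is_dicycle (seq_arcs c) by apply/is_dicycleP; exists c.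
pose C : dicycle D := exist _ (seq_arcs c) hA.
have eC : dicycle_verts C = [set x in c].
  apply/setP => z; rewrite inE; apply/imsetP/idP => /= [[q]|zc].
    by case/imsetP=> w wc -> ->.
  by exists (z, next c z) => //; apply/imsetP; exists z.
have := hC C a b; rewrite eC !inE mem_rcons in_cons !eqxx !orbT.
move=> /(_ isT isT); apply: connect_restrS => z.
rewrite !inE mem_rcons in_cons => /or3P[/eqP -> // | /eqP -> // | /pX //].
Qed.

Lemma hypertree_helly (D : digraph) :
  hypertree (cycle_hypergraph D) -> ~ non_helly (@arc D).
Proof.
move=> [e te hC] [A [B [C [[cA cB cC] [AB BC AC]]]]].
have [_ sym _ _ _] := te; have tc := strong_hypertree_connected sym hC.
by apply/negP; apply: tree_helly te _ _ _ AB BC AC; apply: tc.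
Qed.

(** * Lifting strong sets through butterfly minors *)

Section Lift.
Variables (T T' : finType) (e : rel T) (e' : rel T') (q : T -> T') (u v : T).
Hypotheses (euv : e u v) (nuv : u != v) (quv : q u = q v).
Hypothesis q_inj : forall x y, q x = q y -> [\/ x = y, x = u /\ y = v | x = v /\ y = u].
Hypothesis q_arc : forall a b, e' a b -> exists x y, [/\ e x y, q x = a & q y = b].
Hypothesis q_irr : forall a, ~~ e' a a.

(** The full preimage of [X'] need not be strong, since [u] may have no arc entering it from there.
    So [u] is kept only if it has such an in-neighbour. Its only out-arc leads to [v], which is kept
    whenever its class is in [X']. *)
Lemma lift_strong_out (X' : {set T'}) : (forall w, e u w -> w = v) ->
  induces_connected e' X' -> exists X : {set T}, [/\ induces_connected e X,
    forall x, x \in X -> q x \in X' & forall x, x != u -> q x \in X' -> x \in X].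
Proof.
move=> outu cX'.
pose X := [set x | (q x \in X') && ((x != u) || [exists w, e w u && (q w \in X')])].
have Xq x : x \in X -> q x \in X' by rewrite inE => /andP[].
have qX x : x != u -> q x \in X' -> x \in X by rewrite inE => -> ->.
exists X; split=> // x y xX yX.
have step x1 b : x1 \in X -> b \in X' -> e' (q x1) b ->
    exists y1, [/\ y1 \in X, q y1 = b & connect (restr e X) x1 y1].
  move=> x1X bX x1b; have [x0 [y0 [xy0 ex0 ey0]]] := q_arc x1b.
  have y0X : y0 \in X.
    rewrite inE ey0 bX /=; case: (eqVneq y0 u) => //= ey; apply/existsP; exists x0.
    by rewrite -ey xy0 ex0 Xq.
  (* The lifted arc may start at the other end of the contracted arc. If it starts at [u] it is the
     contracted arc and would give a loop; if it starts at [v], the arc from [u] to [v] is put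
     before it. *)
  exists y0; split=> //; case: (q_inj ex0) => [xx|[xu xv]|[xv xu]].
  - by subst x0; apply: connect1; rewrite /restr xy0 x1X.
  - subst x0 x1; have yv := outu y0 xy0; subst y0.
    by case/negP: (q_irr b); rewrite -{1}ey0.
  subst x0 x1; have vX : v \in X by apply: qX; rewrite 1?eq_sym // -quv Xq.
  apply: connect_trans (_ : connect _ u v) (connect1 _).
    by apply: connect1; rewrite /restr euv x1X vX.
  by rewrite /restr xy0 vX.
have walk x1 b : x1 \in X -> b \in X' ->
    exists y1, [/\ y1 \in X, q y1 = b & connect (restr e X) x1 y1].
  move=> x1X bX; have := cX' _ _ (Xq _ x1X) bX; case/connectP=> p.
  elim: p x1 x1X => [|c p IH] x1 x1X /=.
    by move=> _ ->; exists x1; split=> //; apply: connect0.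
  case/andP=> /and3P[xc _ cX] pp lp.
  have [y1 [y1X ey1 cy1]] := step x1 c x1X cX xc; subst c.
  have [y2 [y2X ey2 cy2]] := IH y1 y1X pp lp.
  by exists y2; split=> //; apply: connect_trans cy1 cy2.
have [y1 [y1X ey1 cy1]] := walk x (q y) xX (Xq _ yX).
case: (q_inj ey1) => [<- //|[yu yv]|[yv yu]]; subst y1 y.
  by apply: connect_trans cy1 (connect1 _); rewrite /restr euv y1X.
(* The target is [u] but the walk has ended in [v]. It is continued to the in-neighbour [w] on whose
   account [u] belongs to [X]. *)
apply: connect_trans cy1 _; move: (yX); rewrite inE eqxx /= => /andP[_ /existsP[w]].
case/andP=> wu wX'; have [wv|nwv] := eqVneq w v.
  by apply: connect1; rewrite /restr -{1}wv wu y1X.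
have nwu : w != u.
  by apply: contraTneq wu => ->; apply/negP => /outu uv; have := nuv; rewrite -uv eqxx.
have wX := qX w nwu wX'.
have [y2 [y2X ey2 cy2]] := walk v (q w) y1X wX'.
have ew : y2 = w.
  by case: (q_inj ey2) => [//|[_ wv]|[_ wu']]; [rewrite wv eqxx in nwv | rewrite wu' eqxx in nwu].
subst y2; apply: connect_trans cy2 (connect1 _).
by rewrite /restr wu y2X.
Qed.

End Lift.

Lemma strong_rev (T : finType) (e : rel T) (X : {set T}) :
  induces_connected e X -> induces_connected (fun x y => e y x) X.
Proof.
move=> cX x y xX yX; have := cX y x yX xX.
have := connect_rev (restr e X) x y; rewrite /= => <-.
by apply: connect_sub => u v /= /and3P[uv uX vX]; apply: connect1; rewrite uv uX vX.
Qed.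

Lemma lift_strong_in (T T' : finType) (e : rel T) (e' : rel T') (q : T -> T')
    (u v : T) (X' : {set T'}) :
  e u v -> u != v -> q u = q v ->
  (forall x y, q x = q y -> [\/ x = y, x = u /\ y = v | x = v /\ y = u]) ->
  (forall a b, e' a b -> exists x y, [/\ e x y, q x = a & q y = b]) ->
  (forall a, ~~ e' a a) -> (forall w, e w v -> w = u) ->
  induces_connected e' X' -> exists X : {set T}, [/\ induces_connected e X,
    forall x, x \in X -> q x \in X' & forall x, x != v -> q x \in X' -> x \in X].
Proof.
move=> uv nuv quv qi qa qr inv cX'.
have nvu : v != u by rewrite eq_sym.
have qi' x y : q x = q y -> [\/ x = y, x = v /\ y = u | x = u /\ y = v].
  by move=> /qi[]; [apply: Or31 | apply: Or33 | apply: Or32].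
have qa' a b : e' b a -> exists x y, [/\ e y x, q x = a & q y = b].
  by move=> /qa[x [y [xy ex ey]]]; exists y, x.
have [X [cX h1 h2]] := @lift_strong_out _ _ (fun x y => e y x) (fun x y => e' y x)
  q v u uv nvu (esym quv) qi' qa' qr X' inv (strong_rev cX').
by exists X; split=> //; apply: (strong_rev cX).
Qed.

(** Each vertex of the minor has a preimage other than [u], and the lifts keep such preimages, so
    sets that meet lift to sets that meet. A common vertex of the three lifts would be mapped to a
    common vertex below. *)
Lemma non_helly_lift (T T' : finType) (e : rel T) (e' : rel T') (q : T -> T') (u : T) :
  (forall X' : {set T'}, induces_connected e' X' -> exists X : {set T},
    [/\ induces_connected e X, forall x, x \in X -> q x \in X'
      & forall x, x != u -> q x \in X' -> x \in X]) ->
  (forall a, exists2 x, x != u & q x = a) ->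
  non_helly e' -> non_helly e.
Proof.
move=> lift surj [A' [B' [C' [[/lift[A [cA A1 A2]] /lift[B [cB B1 B2]] /lift[C [cC C1 C2]]]]]]].
have meet (X Y : {set T}) (X' Y' : {set T'}) :
    (forall x, x != u -> q x \in X' -> x \in X) ->
    (forall x, x != u -> q x \in Y' -> x \in Y) ->
    ~~ [disjoint X' & Y'] -> ~~ [disjoint X & Y].
  move=> hX hY /pred0Pn[a /andP[/= aX aY]]; have [x xu qx] := surj a.
  by apply/pred0Pn; exists x; rewrite /= hX ?hY // qx.
move=> [AB BC AC ABC]; exists A, B, C; split=> //; split.
- exact: meet AB.
- exact: meet BC.
- exact: meet AC.
apply: contraLR ABC => /pred0Pn[x /andP[/=]]; rewrite inE => /andP[xA xB] xC.
by apply/pred0Pn; exists (q x); rewrite /= inE A1 ?B1 ?C1.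
Qed.

Lemma non_helly_contract (D : digraph) (u v : D) : butterfly_contractible u v ->
  non_helly (@arc (contract u v)) -> non_helly (@arc D).
Proof.
move=> /andP[auv suv]; have uv : u != v := arc_neq auv.
have mv x : merge u v x != v by rewrite /merge; case: ifP => // /negbT.
pose q (x : D) : contract u v := Sub (merge u v x) (mv x).
have quv : q u = q v by apply/val_inj; rewrite /= /merge eqxx (negbTE uv).
have qi x y : q x = q y -> [\/ x = y, x = u /\ y = v | x = v /\ y = u].
  move/(congr1 val); rewrite /= /merge.
  case: (eqVneq x v) => [->|xv]; case: (eqVneq y v) => [->|yv] h.
  - exact: Or31.
  - by apply: Or33.
  - by apply: Or32.
  exact: Or31.
have qa a b : @arc (contract u v) a b -> exists x y, [/\ arc x y, q x = a & q y = b].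
  case/andP=> nab /existsP[x /existsP[y /and3P[xy /eqP ex /eqP ey]]].
  by exists x, y; split=> //; apply/val_inj.
have qr a : ~~ @arc (contract u v) a a by rewrite arc_irr.
have surj w : w \in [:: u; v] -> forall a, exists2 x, x != w & q x = a.
  move=> wuv a; case: (eqVneq (val a) w) => [aw|naw]; last first.
    by exists (val a) => //; apply/val_inj; rewrite /= /merge (negbTE (valP a)).
  have wu : w = u.
    move: wuv; rewrite !inE => /orP[/eqP //|/eqP wv].
    by have := valP a; rewrite /= aw wv eqxx.
  exists v; first by rewrite wu eq_sym.
  by rewrite -quv; apply/val_inj; rewrite /= /merge (negbTE uv) aw wu.
case/orP: suv => /forallP h.
  apply: (@non_helly_lift _ _ _ _ q u); last by apply: surj; rewrite mem_head.
  move=> X' cX'; apply: (lift_strong_out auv uv quv qi qa qr) cX' => w uw.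
  by have := h w; rewrite uw => /eqP.
apply: (@non_helly_lift _ _ _ _ q v); last by apply: surj; rewrite !inE eqxx orbT.
move=> X' cX'; apply: (lift_strong_in auv uv quv qi qa qr) cX' => w uw.
by have := h w; rewrite uw => /eqP.
Qed.

Lemma non_helly_contracts (D M : digraph) : butterfly_contracts D M ->
  non_helly (@arc M) -> non_helly (@arc D).
Proof. by elim=> // {}D u v {}M cuv _ IH /IH; apply: non_helly_contract. Qed.

Lemma non_helly_sub (S D : digraph) : subdigraph S D ->
  non_helly (@arc S) -> non_helly (@arc D).
Proof.
move=> [f fi fa] [A [B [C [[cA cB cC] [AB BC AC ABC]]]]].
have strong (X : {set S}) : induces_connected (@arc S) X ->
    induces_connected (@arc D) (f @: X).
  move=> cX _ _ /imsetP[x xX ->] /imsetP[y yX ->]; have /connectP[p] := cX x y xX yX.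
  elim: p x {xX} => [|z p IH] x /= => [_ ->|]; first exact: connect0.
  case/andP=> /and3P[xz xX zX] pp lp; apply: connect_trans (IH z pp lp).
  by apply: connect1; rewrite fa // !imset_f.
exists (f @: A), (f @: B), (f @: C); split; first by split; apply: strong.
have meet (X Y : {set S}) : ~~ [disjoint X & Y] -> ~~ [disjoint f @: X & f @: Y].
  by move=> /pred0Pn[x /andP[/= xX xY]]; apply/pred0Pn; exists (f x);
    rewrite /= !imset_f.
split; try exact: meet.
apply: contraLR ABC => /pred0Pn[x /andP[/=]]; rewrite inE => /andP[].
move=> /imsetP[x1 x1A ->] /imsetP[x2 x2B /fi e2] /imsetP[x3 x3C /fi e3]; subst x2 x3.
by apply/pred0Pn; exists x1; rewrite /= inE x1A x2B.
Qed.

Lemma non_helly_minor (M D : digraph) : butterfly_minor M D ->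
  non_helly (@arc M) -> non_helly (@arc D).
Proof.
move=> [S [N [sS cS iN]]] hM; apply: non_helly_sub sS _; apply: non_helly_contracts cS _.
have [g bg eg] := digraph_iso_sym iN.
by apply: non_helly_sub hM; exists g; [exact: bij_inj | move=> x y; rewrite eg].
Qed.

(** * The excluded minors fail the Helly property *)

Lemma A4_non_helly : non_helly (@arc A4).
Proof.
pose i0 : A4 := @Ordinal 4 0 isT; pose i1 : A4 := @Ordinal 4 1 isT.
pose i2 : A4 := @Ordinal 4 2 isT; pose i3 : A4 := @Ordinal 4 3 isT.
(* The digon of [v_1] and [v_3], and two directed triangles; the triangles meet exactly in [v_2] and
   [v_4], which that digon avoids. *)
exists [set x in [:: i0; i2]], [set x in [:: i1; i2; i3]], [set x in [:: i0; i1; i3]].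
split; first by split; apply: strong_cycle.
split.
- by apply/pred0Pn; exists i2; rewrite /= !inE.
- by apply/pred0Pn; exists i1; rewrite /= !inE.
- by apply/pred0Pn; exists i0; rewrite /= !inE.
by apply/pred0P => x; rewrite /= !inE; case: x => [[|[|[|[|]]]]].
Qed.

Lemma bicycle_non_helly l : 3 <= l -> non_helly (@arc (bicycle l)).
Proof.
move=> l3; pose i0 : bicycle l := Ordinal (ltnW (ltnW l3)).
pose i1 : bicycle l := Ordinal (ltnW l3); pose i2 : bicycle l := Ordinal l3.
have sym : symmetric (@arc (bicycle l)).
  by move=> i j; rewrite /= /bicycle_arc eq_sym [in RHS]orbC.
have next i j : val j = (val i).+1 -> @arc (bicycle l) i j.
  move=> ij; rewrite /= /bicycle_arc; apply/andP; split.
    by apply/eqP => eij; move: ij; rewrite eij; apply: n_Sn.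
  apply/orP; left; apply/eqP/val_inj => /=; rewrite modn_small //.
  by rewrite -[i.+1]/((val i).+1) -ij ltn_ord.
have pair i j : @arc (bicycle l) i j -> induces_connected (@arc (bicycle l)) [set x in [:: i; j]].
  by move=> ij; apply: strong_cycle; apply/and3P; split; rewrite // sym.
(* Two adjacent digons, and all vertices but the one common to them; what remains of the bicycle is
   a path of digons, hence strong. *)
exists [set x in [:: i0; i1]], [set x in [:: i1; i2]], [set~ i1]; split; last first.
  split.
  - by apply/pred0Pn; exists i1; rewrite /= !inE.
  - by apply/pred0Pn; exists i2; rewrite /= !inE.
  - by apply/pred0Pn; exists i0; rewrite /= !inE.
  apply/pred0P => x; rewrite /= !inE; case: (eqVneq x i1) => [->|] //=; rewrite !andbT.
  by case: (eqVneq x i0) => [->|].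
split; [by apply/pair/next|by apply/pair/next|].
pose E := restr (@arc (bicycle l)) [set~ i1].
have symE : symmetric E.
  by move=> i j; rewrite /E /restr sym; case: (i \in _); case: (j \in _).
have to2 k (hk : k < l) : 2 <= k -> connect E i2 (Ordinal hk).
  elim: k hk => // k IH hk; rewrite leq_eqVlt => /orP[/eqP k1|k2].
    have -> : Ordinal hk = i2 by apply/val_inj; rewrite /= -k1.
    exact: connect0.
  have hk' : k < l by apply: ltnW.
  apply: connect_trans (IH hk' k2) (connect1 _).
  rewrite /E /restr next //= !inE; apply/andP; split; apply/eqP => /(congr1 val) /=; lia.
have hl : l.-1 < l by lia.
have last0 : E (Ordinal hl) i0.
  rewrite /E /restr !inE; apply/and3P; split; last by apply/eqP => /(congr1 val).
    rewrite /= /bicycle_arc; apply/andP; split; first by apply/eqP => /(congr1 val) /=; lia.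
    apply/orP; left; apply/eqP/val_inj; rewrite /=; have -> : l.-1.+1 = l by lia.
    by rewrite modnn.
  by apply/eqP => /(congr1 val) /=; lia.
have all2 (j : 'I_l) : j \in [set~ i1] -> connect E i2 j.
  rewrite !inE => j1; case: (ltnP 1 j) => hj.
    by have -> : j = Ordinal (ltn_ord j); [apply/val_inj | apply: to2].
  have -> : j = i0.
    apply/val_inj; rewrite /=; have : val j <> 1 by move=> h; case/eqP: j1; apply/val_inj.
    by rewrite /=; lia.
  by apply: connect_trans (connect1 last0); apply: to2; lia.
by move=> x y xX yX; apply: connect_trans (all2 y yX); rewrite (sym_connect_sym symE) all2.
Qed.

(** * Decompositions of width one *)

Section Arborescence.
Variables (T : finType) (a : rel T).
Hypothesis arb : arborescence a.

Let sa : rel T := fun x y => a x y || a y x.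

Let path_cut_edge (t d x : T) q : ~~ a t d -> path a x q -> t \notin q ->
  path (cut_edge sa t d) x q.
Proof.
move=> ntd; elim: q x => //= y q IH x /andP[xy pq].
rewrite in_cons negb_or => /andP[ty tq]; rewrite IH // andbT.
rewrite /cut_edge /sa xy /=; apply/negP => /orP[]/andP[/eqP ex /eqP ey].
  by rewrite -ex -ey xy in ntd.
by rewrite ey eqxx in ty.
Qed.

Lemma arb_acyclic d t : a d t -> ~~ connect a t d.
Proof.
move=> dt; have [asym tr _] := arb.
have std : sa t d by rewrite /sa dt orbT.
apply: contra (tree_bridge tr std) => /connectP[p pp lp].
move: lp; case/shortenP: pp => q pq uq sq ld; apply/connectP; exists q => //.
by apply: path_cut_edge; [exact: asym | | case/andP: uq].
Qed.

(** Both parents are reached from the root without passing [t], hence are connected to each other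
    off [t]. A second parent would thus give a way around the tree edge between [d] and [t]. *)
Lemma arb_parent_uniq d d' t : a d t -> a d' t -> d = d'.
Proof.
move=> dt d't; have [asym tr [r [hr _]]] := arb.
apply/eqP/negPn/negP => ndd; have [_ sym _ _ _] := tr.
have sdt : sa d t by rewrite /sa dt.
have away c : a c t -> connect (restr sa [set~ t]) r c.
  move=> ct; have /connectP[p pp lp] := hr c; rewrite lp.
  apply: path_connect_restr => [|x xp].
    by apply: (sub_path _ pp) => u v uv; rewrite /sa uv.
  rewrite !inE; apply/eqP => xt; subst x; case/negP: (arb_acyclic ct).
  case/splitPl: xp pp lp => p1 p2 l1; rewrite cat_path last_cat l1.
  by case/andP=> _ pp ->; apply/connectP; exists p2.
have symr : symmetric (restr sa [set~ t]).
  by move=> u v; rewrite /restr /sa orbC; case: (u \in _); case: (v \in _).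
case/negP: (tree_bridge tr sdt); apply: connect_trans (_ : connect _ d d') (connect1 _).
  apply: (@connect_cut_edge _ _ _ _ [set~ t]); first by rewrite !inE eqxx orbT.
  by apply: connect_trans (away d' d't); rewrite (sym_connect_sym symr) away.
have ndt : d != t by apply: contraTneq (arb_acyclic dt) => ->; rewrite connect0.
by rewrite /cut_edge /sa d't eq_sym (negbTE ndd) (eq_sym t d) (negbTE ndt) andbF.
Qed.

Lemma arb_connect_last u x : connect a u x -> u != x ->
  exists2 y, a y x & connect a u y.
Proof.
case/connectP=> p; case/lastP: p => [|p y]; first by move=> _ ->; rewrite eqxx.
rewrite rcons_path last_rcons => /andP[pp ly] ->.
by exists (last u p) => //; apply/connectP; exists p.
Qed.

Lemma arb_comparable u v x : connect a u x -> connect a v x ->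
  connect a u v || connect a v u.
Proof.
case/connectP=> p; elim/last_ind: p x => [|p y IH] x.
  by move=> _ -> ->; rewrite orbT.
rewrite rcons_path last_rcons => /andP[pp ly] -> vy.
case: (eqVneq v y) => [->|nvy].
  apply/orP; left; apply: connect_trans (connect1 ly).
  by apply/connectP; exists p.
have [z zy vz] := arb_connect_last vy nvy.
by apply: (IH z) => //; apply: arb_parent_uniq zy ly.
Qed.

Lemma arb_siblings t c c' x : a t c -> a t c' -> c != c' ->
  connect a c x -> ~~ connect a c' x.
Proof.
move=> tc tc' ncc cx; apply/negP => c'x.
have wlog_ u v : a t u -> a t v -> u != v -> connect a u v -> False.
  move=> tu tv nuv cuv; have [y yv uy] := arb_connect_last cuv nuv.
  by case/negP: (arb_acyclic tu); rewrite (arb_parent_uniq tv yv).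
case/orP: (arb_comparable cx c'x); first exact: wlog_.
by apply: wlog_; rewrite // eq_sym.
Qed.

End Arborescence.

Section Width.
Variables (D : digraph) (X : dir_tree_decomp D).

Let a := @dtd_arc D X.
Let beta := @dtd_beta D X.
Let below t := bag_below a beta t.

Let arb : arborescence a := dtd_arborescence X.

Lemma bag_exists y : exists t, y \in beta t.
Proof.
have : y \in \bigcup_t beta t by rewrite dtd_beta_cover inE.
by case/bigcupP=> t _ yt; exists t.
Qed.

Lemma bag_uniq s t y : y \in beta s -> y \in beta t -> s = t.
Proof.
move=> ys yt; apply/eqP/negPn/negP => /dtd_beta_disjoint/pred0P/(_ y).
by rewrite /= ys yt.
Qed.

Lemma mem_below s t y : y \in beta s -> (y \in below t) = connect a t s.
Proof.
move=> ys; apply/bigcupP/idP => [[s' ts' ys']|ts]; last by exists s.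
by rewrite (bag_uniq ys ys').
Qed.

(** Inside [Y] there is a closed walk from [x] through [x'] back to [x], which leaves the set below
    [t] and returns. *)
Lemma below_guard d t (Y : {set D}) x x' : a d t -> induces_connected (@arc D) Y ->
  x \in Y -> x' \in Y -> x \in below t -> x' \notin below t ->
  exists2 z, z \in dtd_gamma d t & z \in Y.
Proof.
move=> dt cY xY x'Y xB x'B.
have [p [pp pY lp]] := connect_restr_path xY (cY x x' xY x'Y).
have [q [pq qY lq]] := connect_restr_path x'Y (cY x' x x'Y xY).
have pc : path (@arc D) x (p ++ q) by rewrite cat_path pp -lp.
have x'in : x' \in x :: p ++ q.
  by rewrite -cat_cons mem_cat lp mem_last.
have [|z zin zG] := @dtd_guards D X d t dt x (p ++ q) pc xB _ (ex_intro2 _ _ x' x'in x'B).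
  by rewrite last_cat -lp -lq.
exists z => //; move: zin; rewrite -cat_cons mem_cat => /orP[/pY //|zq].
by apply: qY; rewrite in_cons zq orbT.
Qed.

(* [Y] is the union of the bags on the side of [t1] of the edge between the
   adjacent nodes [t0] and [t1], and [G] is the guard of that edge. *)
Definition side t0 t1 (Y G : {set D}) :=
  [/\ a t0 t1, Y = below t1 & G = dtd_gamma t0 t1] \/
  [/\ a t1 t0, Y = ~: below t0 & G = dtd_gamma t1 t0].

Lemma side_Gamma t0 t1 Y G : side t0 t1 Y G ->
  G \subset dtd_Gamma t0 /\ G \subset dtd_Gamma t1.
Proof.
case=> -[h _ ->]; split; apply/subsetP => z zG; rewrite !inE.
- by apply/orP; right; apply/bigcupP; exists t1.
- by apply/orP; left; apply/orP; right; apply/bigcupP; exists t0.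
- by apply/orP; left; apply/orP; right; apply/bigcupP; exists t1.
by apply/orP; right; apply/bigcupP; exists t0.
Qed.

Lemma beta_Gamma t : beta t \subset dtd_Gamma t.
Proof. by apply/subsetP => z zt; rewrite !inE zt. Qed.

Lemma side_beta t0 t1 Y G : side t0 t1 Y G ->
  (forall y, y \in beta t1 -> y \in Y) /\ (forall y, y \in beta t0 -> y \notin Y).
Proof.
case=> -[h -> _]; split=> y yt.
- by rewrite (mem_below _ yt) connect0.
- by rewrite (mem_below _ yt) (arb_acyclic arb h).
- by rewrite inE (mem_below _ yt) (arb_acyclic arb h).
by rewrite inE negbK (mem_below _ yt) connect0.
Qed.

Lemma side_guard t0 t1 Y G (Z : {set D}) x x' : side t0 t1 Y G ->
  induces_connected (@arc D) Z -> x \in Z -> x' \in Z -> x \in Y -> x' \notin Y ->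
  exists2 z, z \in G & z \in Z.
Proof.
case=> -[h -> ->] cZ xZ x'Z xY x'Y; first exact: (below_guard h cZ xZ x'Z).
rewrite inE in xY; rewrite inE negbK in x'Y; exact: (below_guard h cZ x'Z xZ).
Qed.

Lemma side_exists t0 y : y \notin beta t0 -> exists t1 Y G,
  side t0 t1 Y G /\ y \in Y.
Proof.
move=> yt; have [s ys] := bag_exists y; have nts : t0 != s by apply: contraNneq yt => ->.
case: (boolP (y \in below t0)) => yB.
  have := yB; rewrite (mem_below _ ys) => /connectP[[|c p] /=].
    by move=> _ st; rewrite st eqxx in nts.
  case/andP=> tc pp lp; exists c, (below c), (dtd_gamma t0 c); split; first by left.
  by rewrite (mem_below _ ys); apply/connectP; exists p.
have [_ _ [r [hr _]]] := arb.
have nrt : r != t0.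
  by apply: contraNneq yB => <-; rewrite (mem_below _ ys).
have [d dt _] := arb_connect_last (hr t0) nrt.
by exists d, (~: below t0), (dtd_gamma d t0); split; [right | rewrite inE].
Qed.

(** The next node towards [y] cannot be [t0], since [y] lies on the side of [t1]; hence the sides
    are nested. *)
Lemma side_next t0 t1 Y G y : side t0 t1 Y G -> y \in Y -> y \notin beta t1 ->
  exists t2 Y2 G2, [/\ side t1 t2 Y2 G2, y \in Y2 & Y2 \subset Y].
Proof.
move=> s01 yY yt; have [t2 [Y2 [G2 [s12 yY2]]]] := side_exists yt.
exists t2, Y2, G2; split=> //; apply/subsetP => z; have [s zs] := bag_exists z.
have [w yw] := bag_exists y.
case: s01 s12 yY yY2 => -[h -> _] [] [h2 -> _]; rewrite ?inE ?(mem_below _ zs) ?(mem_below _ yw).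
- by move=> _ _; apply: connect_trans; apply: connect1.
- by move=> ->.
- move=> nt0 t2y; apply: (arb_siblings arb h2 h) => //.
  by apply: contraNneq nt0 => <-.
move=> _ _; apply: contra; apply: connect_trans; exact: connect1.
Qed.

(** Otherwise [Gamma] at [t0] consists of some [g] in [B] only and some [h] in [C] only. The guard
    of the edge towards [y] meets both sets, so it contains [g] and [h], and the next node has the
    same [Gamma]. As [y] is neither [g] nor [h], it is in neither bag, and a third node with the
    same [Gamma] follows. Three nonempty disjoint bags do not fit into two vertices. *)
Lemma narrow_guard t0 (B C : {set D}) y :
  (forall t, #|dtd_Gamma (X := X) t| <= 2) ->
  induces_connected (@arc D) B -> induces_connected (@arc D) C ->
  (forall t1 Y G, side t0 t1 Y G -> exists2 x, x \in B & x \notin Y) ->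
  (forall t1 Y G, side t0 t1 Y G -> exists2 x, x \in C & x \notin Y) ->
  y \in B -> y \in C ->
  exists x, [/\ x \in dtd_Gamma t0, x \in B & x \in C].
Proof.
move=> w2 cB cC outB outC yB yC.
have meet (Z : {set D}) : induces_connected (@arc D) Z -> y \in Z ->
    (forall t1 Y G, side t0 t1 Y G -> exists2 x, x \in Z & x \notin Y) ->
    exists2 z, z \in dtd_Gamma t0 & z \in Z.
  move=> cZ yZ outZ; case: (boolP (y \in beta t0)) => [yt|/side_exists].
    by exists y => //; exact: subsetP (beta_Gamma t0) _ yt.
  move=> [t1 [Y [G [s01 yY]]]]; have [x xZ xY] := outZ _ _ _ s01.
  have [z zG zZ] := side_guard s01 cZ yZ xZ yY xY.
  by have [/subsetP sG _] := side_Gamma s01; exists z => //; apply: sG.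
have [g gG gB] := meet B cB yB outB; have [h hG hC] := meet C cC yC outC.
case: (boolP (g \in C)) => gC; first by exists g.
case: (boolP (h \in B)) => hB; first by exists h.
have ngh : g != h by apply: contraNneq gC => ->.
have two (t : dtd_node X) : g \in dtd_Gamma t -> h \in dtd_Gamma t -> dtd_Gamma t = [set g; h].
  move=> gt ht; apply/esym/eqP; rewrite eqEcard cards2 ngh; apply/andP; split; last by have := w2 t.
  by apply/subsetP => z; rewrite in_set2 => /orP[] /eqP ->.
have E0 := two t0 gG hG.
have cross t1 t2 Y G : side t1 t2 Y G -> y \in Y -> (exists2 x, x \in B & x \notin Y) ->
    (exists2 x, x \in C & x \notin Y) -> dtd_Gamma t1 = [set g; h] ->
    dtd_Gamma t2 = [set g; h].
  move=> s12 yY [x xB xY] [x' x'C x'Y] E1.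
  have [/subsetP G1 /subsetP G2] := side_Gamma s12.
  have [z zG zB] := side_guard s12 cB yB xB yY xY.
  have [z' z'G z'C] := side_guard s12 cC yC x'C yY x'Y.
  have zg : z = g.
    have := G1 z zG; rewrite E1 !inE => /orP[/eqP //|/eqP zh].
    by rewrite -zh zB in hB.
  have z'h : z' = h.
    have := G1 z' z'G; rewrite E1 !inE => /orP[/eqP zg'|/eqP //].
    by rewrite -zg' z'C in gC.
  by subst z z'; apply: two; apply: G2.
have ngb (t : dtd_node X) : dtd_Gamma t = [set g; h] -> y \notin beta t.
  move=> Et; apply/negP => /(subsetP (beta_Gamma t)); rewrite Et !inE.
  by case/orP=> /eqP ey; [rewrite -ey yC in gC | rewrite -ey yB in hB].
have [t1 [Y1 [G1 [s01 yY1]]]] := side_exists (ngb _ E0).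
have [x xB xY] := outB _ _ _ s01; have [x' x'C x'Y] := outC _ _ _ s01.
have E1 : dtd_Gamma t1 = [set g; h].
  by apply: cross s01 yY1 _ _ E0; [exists x | exists x'].
have [t2 [Y2 [G2 [s12 yY2 /subsetP sY]]]] := side_next s01 yY1 (ngb _ E1).
have E2 : dtd_Gamma t2 = [set g; h].
  by apply: cross s12 yY2 _ _ E1; [exists x => //; apply: contra xY; apply: sY
    | exists x' => //; apply: contra x'Y; apply: sY].
have [w0 w0t] := set0Pn _ (dtd_beta_neq0 t0).
have [w1 w1t] := set0Pn _ (dtd_beta_neq0 t1).
have [w2' w2t] := set0Pn _ (dtd_beta_neq0 t2).
have [in1 out0] := side_beta s01; have [in2 out1] := side_beta s12.
have n01 : w0 != w1 by apply: contraTneq (in1 _ w1t) => <-; apply: out0.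
have n02 : w0 != w2' by apply: contraTneq (sY _ (in2 _ w2t)) => <-; apply: out0.
have n12 : w1 != w2' by apply: contraTneq (in2 _ w2t) => <-; apply: out1.
have := subsetP (beta_Gamma t0) _ w0t; have := subsetP (beta_Gamma t1) _ w1t.
have := subsetP (beta_Gamma t2) _ w2t; rewrite E0 E1 E2 !inE.
by move=> /orP[]/eqP e2 /orP[]/eqP e1 /orP[]/eqP e0; subst w0 w1 w2';
  rewrite ?eqxx in n01 n02 n12.
Qed.

Lemma width1_helly : dtd_width X <= 1 -> ~ non_helly (@arc D).
Proof.
move=> w1 [A [B [C [[cA cB cC] [AB BC AC ABC]]]]].
have w2 t : #|dtd_Gamma (X := X) t| <= 2.
  apply: leq_trans (@leq_bigmax _ (fun t => #|dtd_Gamma (X := X) t|) t) _.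
  by move: w1; rewrite /dtd_width; case: (\max_(_ : _) _) => [|[|[|]]].
have /pred0Pn[z1 /andP[/= z1B z1C]] := BC.
have /pred0Pn[z2 /andP[/= z2A z2C]] := AC.
have /pred0Pn[z3 /andP[/= z3A z3B]] := AB.
(* A lowest node with two of the three points below it is their median: a side of an edge at this
   node contains at most one of the points. Each of the three sets contains two of them, so it lies
   within no side. *)
pose two t := [|| (z1 \in below t) && (z2 \in below t),
  (z2 \in below t) && (z3 \in below t) | (z1 \in below t) && (z3 \in below t)].
have [_ _ [r [hr _]]] := arb.
have inr z : z \in below r by have [s zs] := bag_exists z; rewrite (mem_below _ zs).
have two_r : two r by rewrite /two !inr.
have [t0 tw tmin] := @arg_minnP _ r two (fun t => #|below t|) two_r.
have out (Z : {set D}) z z' : z \in Z -> z' \in Z ->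
    (forall t, ~~ two t -> (z \notin below t) || (z' \notin below t)) ->
    (forall t, two t -> (z \in below t) || (z' \in below t)) ->
    forall t1 Y G, side t0 t1 Y G -> exists2 x, x \in Z & x \notin Y.
  move=> zZ z'Z h1 h2 t1 Y G [[t01 -> _]|[t10 -> _]]; last first.
    by case/orP: (h2 t0 tw) => h; [exists z | exists z']; rewrite // inE negbK.
  have nt : ~~ two t1.
    apply/negP => /tmin; rewrite leqNgt => /negP; apply.
    apply/proper_card/properP; split.
      apply/subsetP => v; have [s vs] := bag_exists v; rewrite !(mem_below _ vs).
      by apply: connect_trans; apply: connect1.
    have [v vt] := set0Pn _ (dtd_beta_neq0 t0).
    by exists v; rewrite (mem_below _ vt) ?connect0 // (arb_acyclic arb t01).
  by case/orP: (h1 t1 nt) => h; [exists z | exists z'].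
have outA : forall t1 Y G, side t0 t1 Y G -> exists2 x, x \in A & x \notin Y.
  by apply: (out A z2 z3) => // t; rewrite /two; do 3!case: (_ \in below t).
have outB : forall t1 Y G, side t0 t1 Y G -> exists2 x, x \in B & x \notin Y.
  by apply: (out B z1 z3) => // t; rewrite /two; do 3!case: (_ \in below t).
have outC : forall t1 Y G, side t0 t1 Y G -> exists2 x, x \in C & x \notin Y.
  by apply: (out C z1 z2) => // t; rewrite /two; do 3!case: (_ \in below t).
have [x1 [x1t x1B x1C]] := narrow_guard w2 cB cC outB outC z1B z1C.
have [x2 [x2t x2A x2C]] := narrow_guard w2 cA cC outA outC z2A z2C.
have [x3 [x3t x3A x3B]] := narrow_guard w2 cA cB outA outB z3A z3B.
have nABC x : x \in A -> x \in B -> x \in C -> False.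
  by move=> xA xB xC; have /pred0P/(_ x) := ABC; rewrite /= inE xA xB xC.
have n12 : x1 != x2 by apply/eqP => e; subst x2; exact: nABC x2A x1B x1C.
have n13 : x1 != x3 by apply/eqP => e; subst x3; exact: nABC x3A x1B x1C.
have n23 : x2 != x3 by apply/eqP => e; subst x3; exact: nABC x2A x3B x2C.
have : #|[set x in [:: x1; x2; x3]]| <= #|dtd_Gamma t0|.
  apply/subset_leq_card/subsetP => x; rewrite [x \in _]in_set !in_cons orbF.
  by case/or3P=> /eqP ->.
rewrite cardsE; have /card_uniqP -> : uniq [:: x1; x2; x3].
  by rewrite /= !inE negb_or n12 n13 n23.
by rewrite leqNgt ltnS (leq_trans (w2 t0)).
Qed.

(** By strong connectivity the guard of an edge of the decomposition is nonempty. If every [Gamma]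
    had at most one element, a guard vertex would be the bag of both ends of the edge. *)
Lemma width_gt0 : strongly_connected D -> 2 <= #|D| -> 0 < dtd_width X.
Proof.
move=> cD c2; rewrite lt0n; apply/negP => /eqP w0.
have w1 t : #|dtd_Gamma (X := X) t| <= 1.
  apply: leq_trans (@leq_bigmax _ (fun t => #|dtd_Gamma (X := X) t|) t) _.
  by move: w0; rewrite /dtd_width; case: (\max_(_ : _) _) => [|[|]].
have cT : induces_connected (@arc D) [set: D].
  move=> x y _ _; apply: connect_sub (cD x y) => u v uv; apply: connect1.
  by rewrite uv !inE.
have [x _] : exists x : D, x \in D by apply/card_gt0P; apply: ltnW.
have [t xt] := bag_exists x.
have xG : x \in dtd_Gamma t := subsetP (beta_Gamma t) _ xt.
have one (s : dtd_node X) y y' : y \in dtd_Gamma s -> y' \in dtd_Gamma s -> y = y'.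
  move=> ys y's; apply/eqP/negPn/negP => nyy.
  have : [set y; y'] \subset dtd_Gamma s.
    by apply/subsetP => z; rewrite in_set2 => /orP[] /eqP ->.
  by move/subset_leq_card; rewrite cards2 nyy leqNgt ltnS w1.
have [x' nxx] : exists x', x' != x.
  apply/existsP; apply: contraLR c2; rewrite negb_exists -leqNgt => /forallP h.
  rewrite -(card1 x); apply/subset_leq_card/subsetP => y _.
  by have := h y; rewrite negbK inE.
have x't : x' \notin beta t.
  by apply: contra nxx => /(subsetP (beta_Gamma t)) h; rewrite (one t x' x).
have [t1 [Y [G [s01 x'Y]]]] := side_exists x't.
have [in1 out0] := side_beta s01.
have [z zG _] := side_guard s01 cT (in_setT x') (in_setT x) x'Y (out0 x xt).
have [w1' w1t] := set0Pn _ (dtd_beta_neq0 t1).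
have [/subsetP G0 /subsetP G1] := side_Gamma s01.
have zx := one t z x (G0 _ zG) xG.
have zw := one t1 z w1' (G1 _ zG) (subsetP (beta_Gamma t1) _ w1t).
by have := in1 _ w1t; rewrite -zw zx (negbTE (out0 x xt)).
Qed.

End Width.

(** * From excluded minors to gates, and the equivalence *)

(** Being a gate is decidable, since [X] ranges over a finite type; this permits the case
    distinction constructively. *)
Lemma gate_or_obst (V : finType) (e : rel V) d x : x != d ->
  (exists2 t, t \in scomp e d x & gate e d (scomp e d x) t) \/ has_obst e.
Proof.
move=> xd; set C := scomp e d x.
pose gateb t := [forall X, [&& strongb e X, d \in X & ~~ [disjoint C & X]] ==> (t \in X)].
have gateP t : reflect (gate e d C t) (gateb t).
  apply: (iffP forallP) => [h X /strongbP cX dX CX|h X].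
    by have := h X; rewrite cX dX CX.
  by apply/implyP => /and3P[/strongbP]; apply: h.
have [/exists_inP[t tC /gateP gt]|no] := boolP [exists t in C, gateb t].
  by left; exists t.
right; apply: (scomp_gateless_obst xd) => t tC /gateP gt.
by case/negP: no; apply/exists_inP; exists t.
Qed.

Theorem theorem4p2 (D : digraph) (hconn : strongly_connected D)
    (hcard : 2 <= #|D|) :
  (has_dtw D 1 <-> hypertree (cycle_hypergraph D)) /\
  (hypertree (cycle_hypergraph D) <->
    ((forall l : nat, 3 <= l -> ~ butterfly_minor (bicycle l) D) /\
     ~ butterfly_minor A4 D)).
Proof.
have dtw_helly : has_dtw D 1 -> ~ non_helly (@arc D).
  by case=> [[X w1] _]; apply: (width1_helly (X := X)); rewrite w1.
have helly_free : ~ non_helly (@arc D) ->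
    (forall l, 3 <= l -> ~ butterfly_minor (bicycle l) D) /\ ~ butterfly_minor A4 D.
  move=> nh; split=> [l l3|] m; apply: nh; apply: (non_helly_minor m).
    exact: bicycle_non_helly.
  exact: A4_non_helly.
have free_tree : (forall l, 3 <= l -> ~ butterfly_minor (bicycle l) D) /\
    ~ butterfly_minor A4 D -> has_dtw D 1 /\ hypertree (cycle_hypergraph D).
  move=> [nb nA].
  have gates d x : x != d ->
      exists2 t, t \in scomp (@arc D) d x & gate (@arc D) d (scomp (@arc D) d x) t.
    by case/(gate_or_obst (@arc D)) => // /has_obst_minor[[l /nb]|].
  have [r _] : exists r : D, r \in D by apply/card_gt0P; apply: ltnW.
  have [//|par [B tr]] := gate_tree_exists gates (in_setT r).
  split; last first.
    exists (par_sym r par); first exact: par_tree tr.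
    move=> C; apply: (strong_par_connected tr); exact: dicycle_verts_strong.
  have [X wX] := gate_tree_decomposition tr.
  split=> [|Y]; last exact: width_gt0.
  by exists X; apply/eqP; rewrite eqn_leq wX; apply: width_gt0.
split; split.
- by move/dtw_helly/helly_free/free_tree => [].
- by move/hypertree_helly/helly_free/free_tree => [].
- by move/hypertree_helly/helly_free.
by move/free_tree => [].
Qed.
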